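(* Fix constants $m\ge 1$ and $k\ge 1$. The problem $P_m(O_k)\,||\,C_{\max}$ admits an efficient polynomial-time approximation scheme (EPTAS): there is an algorithm which, given an instance with $n$ jobs and a parameter $\epsilon\in(0,1)$, returns a feasible (non-preemptive) schedule whose makespan is at most $(1+\epsilon)$ times the minimum possible makespan, in time $f(1/\epsilon)\cdot n^{O(1)}$ for some computable function $f$ (depending on $m,k$).
   Context: The problem $P_m(O_k)\,||\,C_{\max}$: there are $m$ identical $k$-stage open shops $S_1,\dots,S_m$, where $S_\ell$ consists of machines $M_{\ell,1},\dots,M_{\ell,k}$, and $n$ jobs $J_1,\dots,J_n$. Job $J_i$ consists of $k$ operations $O_{i,1},\dots,O_{i,k}$ with nonnegative processing times $p_{i,1},\dots,p_{i,k}$. Each job must be assigned to exactly one open shop $S_\ell$, and then operation $O_{i,j}$ is processed on machine $M_{\ell,j}$ for $p_{i,j}$ consecutive time units (no preemption), in any order of the operations. Each machine processes at most one operation at a time, and no two operations of the same job are processed simultaneously. The makespan is the completion time of the last operation; the goal is to minimize it. An approximation ratio $1+\epsilon$ means the returned makespan is at most $(1+\epsilon)$ times the optimum for every instance. *)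

(* Defs.v *)
From HB Require Import structures.
From mathcomp Require Import all_boot all_order all_algebra.

Set Implicit Arguments.
Unset Strict Implicit.
Unset Printing Implicit Defensive.

Import Order.TTheory GRing.Theory Num.Theory.
Local Open Scope ring_scope.

(** * Scheduling on [m] identical [k]-stage open shops *)

Section Scheduling.
Variables (R : realFieldType) (m k n : nat).

(* [p i j] is the processing time of operation [j] of job [i]. *)
Implicit Type p : 'I_n -> 'I_k -> R.

(* Job [i] is assigned to open shop [shop i]; its [j]-th operation starts at
   time [start i j] on machine [j] of that shop and is never interrupted. *)
Record schedule := Schedule {
  shop : 'I_n -> 'I_m;
  start : 'I_n -> 'I_k -> R }.

Definition completion p (S : schedule) i j : R := start S i j + p i j.

(* Half-open intervals: an operation may start exactly when another one ends,
   and an operation of length zero never occupies its machine. *)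
Definition running p (S : schedule) i j (t : R) : bool :=
  start S i j <= t < completion p S i j.

Record feasible p (S : schedule) : Prop := Feasible {
  start_ge0 : forall i j, 0 <= start S i j;
  machine_exclusive : forall i i' j t,
    shop S i = shop S i' -> running p S i j t -> running p S i' j t -> i = i';
  job_exclusive : forall i j j' t,
    running p S i j t -> running p S i j' t -> j = j' }.

(* With feasible schedules and nonnegative processing times all completion
   times are nonnegative, so the default value [0] only matters for [n = 0]. *)
Definition makespan p (S : schedule) : R :=
  \big[Num.max/0]_(i < n) \big[Num.max/0]_(j < k) completion p S i j.

Definition is_min_makespan p (opt : R) : Prop :=
  (exists2 S, feasible p S & makespan p S = opt) /\
  (forall S, feasible p S -> opt <= makespan p S).

End Scheduling.

(** * The model of computation: a linear real RAM

   An algorithm is a finite program text of a while language (hence uniform in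
   the number of jobs, in the processing times and in the accuracy), with
   variables and unbounded arrays for indices (type [nat]) and for numbers
   (type [R]).  Index operations are addition, truncated subtraction and
   comparison; number operations are addition, subtraction, multiplication by a
   rational constant of the program text, and comparison.  Neither products of
   two stored values nor rounding are available, so (over a common
   denominator of the data) every step adds only O(1) bits to the length of the
   values involved: on rational data, unit cost and bit cost differ by at most a
   factor polynomial in the running time and the bit length of the data. *)

Inductive iexp :=
  | IConst of nat
  | IVar of nat
  | IAdd of iexp & iexp
  | ISub of iexp & iexp
  | IGet of nat & iexp. (* array name, position *)

Inductive rexp :=
  | RConst of rat
  | RVar of nat
  | RAdd of rexp & rexp
  | RSub of rexp & rexp
  | RScale of rat & rexp
  | RGet of nat & iexp.

Inductive bexp :=
  | BILe of iexp & iexp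
  | BRLe of rexp & rexp
  | BNot of bexp
  | BAnd of bexp & bexp.

Inductive cmd :=
  | Skip
  | ISetVar of nat & iexp
  | RSetVar of nat & rexp
  | ISet of nat & iexp & iexp  (* array name, position, value *)
  | RSet of nat & iexp & rexp
  | Seq of cmd & cmd
  | If of bexp & cmd & cmd
  | While of bexp & cmd.

(* The cost of evaluating an expression is its number of nodes. *)
Fixpoint icost (e : iexp) : nat :=
  match e with
  | IConst _ | IVar _ => 1
  | IAdd e1 e2 | ISub e1 e2 => (icost e1 + icost e2)%N.+1
  | IGet _ e => (icost e).+1
  end.

Fixpoint rcost (e : rexp) : nat :=
  match e with
  | RConst _ | RVar _ => 1
  | RAdd e1 e2 | RSub e1 e2 => (rcost e1 + rcost e2)%N.+1
  | RScale _ e => (rcost e).+1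
  | RGet _ e => (icost e).+1
  end.

Fixpoint bcost (b : bexp) : nat :=
  match b with
  | BILe e1 e2 => (icost e1 + icost e2)%N.+1
  | BRLe e1 e2 => (rcost e1 + rcost e2)%N.+1
  | BNot b => (bcost b).+1
  | BAnd b1 b2 => (bcost b1 + bcost b2)%N.+1
  end.

Section Semantics.
Variable R : realFieldType.

Record state := State {
  ivar : nat -> nat;
  rvar : nat -> R;
  iarr : nat -> nat -> nat;
  rarr : nat -> nat -> R }.

Definition upd (T : Type) (g : nat -> T) (x : nat) (v : T) : nat -> T :=
  fun y => if y == x then v else g y.

Definition upd2 (T : Type) (g : nat -> nat -> T) (a x : nat) (v : T) :=
  upd g a (upd (g a) x v).

Fixpoint ieval (s : state) (e : iexp) : nat :=
  match e with
  | IConst c => c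
  | IVar x => ivar s x
  | IAdd e1 e2 => (ieval s e1 + ieval s e2)%N
  | ISub e1 e2 => (ieval s e1 - ieval s e2)%N
  | IGet a e => iarr s a (ieval s e)
  end.

Fixpoint reval (s : state) (e : rexp) : R :=
  match e with
  | RConst q => ratr q
  | RVar x => rvar s x
  | RAdd e1 e2 => reval s e1 + reval s e2
  | RSub e1 e2 => reval s e1 - reval s e2
  | RScale q e => ratr q * reval s e
  | RGet a e => rarr s a (ieval s e)
  end.

Fixpoint beval (s : state) (b : bexp) : bool :=
  match b with
  | BILe e1 e2 => (ieval s e1 <= ieval s e2)%N
  | BRLe e1 e2 => reval s e1 <= reval s e2
  | BNot b => ~~ beval s b
  | BAnd b1 b2 => beval s b1 && beval s b2
  end.

(* [exec c s t s']: started in state [s], the program [c] halts in state [s']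
   after [t] elementary steps. *)
Inductive exec : cmd -> state -> nat -> state -> Prop :=
  | ExecSkip s : exec Skip s 1 s
  | ExecISetVar x e s :
      exec (ISetVar x e) s (icost e).+1
        (State (upd (ivar s) x (ieval s e)) (rvar s) (iarr s) (rarr s))
  | ExecRSetVar x e s :
      exec (RSetVar x e) s (rcost e).+1
        (State (ivar s) (upd (rvar s) x (reval s e)) (iarr s) (rarr s))
  | ExecISet a d e s :
      exec (ISet a d e) s (icost d + icost e)%N.+1
        (State (ivar s) (rvar s)
           (upd2 (iarr s) a (ieval s d) (ieval s e)) (rarr s))
  | ExecRSet a d e s :
      exec (RSet a d e) s (icost d + rcost e)%N.+1
        (State (ivar s) (rvar s) (iarr s)
           (upd2 (rarr s) a (ieval s d) (reval s e)))
  | ExecSeq c1 c2 s t1 s1 t2 s2 :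
      exec c1 s t1 s1 -> exec c2 s1 t2 s2 ->
      exec (Seq c1 c2) s (t1 + t2)%N.+1 s2
  | ExecIfTrue b c1 c2 s t s' :
      beval s b -> exec c1 s t s' ->
      exec (If b c1 c2) s (bcost b + t)%N.+1 s'
  | ExecIfFalse b c1 c2 s t s' :
      ~~ beval s b -> exec c2 s t s' ->
      exec (If b c1 c2) s (bcost b + t)%N.+1 s'
  | ExecWhileFalse b c s :
      ~~ beval s b -> exec (While b c) s (bcost b).+1 s
  | ExecWhileTrue b c s t1 s1 t2 s2 :
      beval s b -> exec c s t1 s1 -> exec (While b c) s1 t2 s2 ->
      exec (While b c) s (bcost b + t1 + t2)%N.+1 s2.

End Semantics.

(* The argument and the result are in index variable [0]; all other cells are
   initially zero.  Over [rat] every elementary step is effective. *)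
Definition computable (f : nat -> nat) : Prop :=
  exists c : cmd, forall N : nat, exists (t : nat) (s' : state rat),
    exec c (State (upd (fun=> 0%N) 0%N N) (fun=> 0) (fun=> fun=> 0%N)
              (fun=> fun=> 0)) t s'
    /\ ivar s' 0%N = f N.

(** * Input and output conventions *)

(* The number of jobs is in index variable [0], the accuracy in number
   variable [0] and the processing times, job after job, in number array [0]
   ([p i j] at position [i * k + j]); all other cells are zero. *)
Definition input_state (R : realFieldType) (k n : nat)
    (p : 'I_n -> 'I_k -> R) (eps : R) : state R :=
  State (upd (fun=> 0%N) 0%N n) (upd (fun=> 0) 0%N eps) (fun=> fun=> 0%N)
    (upd (fun=> fun=> 0) 0%N
       (nth 0 [seq p i j | i <- enum 'I_n, j <- enum 'I_k])).

(* The returned schedule is read in the arrays [0]: the shop of job [i] at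
   position [i], the starting time of operation [j] of job [i] at position
   [i * k + j]. *)
Definition output_is (R : realFieldType) (m k n : nat) (s : state R)
    (S : schedule R m k n) : Prop :=
  (forall i : 'I_n, iarr s 0%N i = shop S i) /\
  (forall (i : 'I_n) (j : 'I_k), rarr s 0%N (i * k + j)%N = start S i j).

(* Main.v *)
Require Import Defs.
From mathcomp Require Import all_boot all_order all_algebra.
From mathcomp Require Import zify ring lra.

(* The program tries a number of candidates that depends on the accuracy only
   and keeps the best schedule.  A candidate consists of a threshold [b] on the
   rank of the jobs by length, a shop for each of the [b] longest jobs, a
   priority for each of their operations, and a shop for each "chunk" of the
   other jobs: these are classified by the leading binary digits of the
   proportions of their operations, and each class is cut into chunks of almost
   equal volume.  The operations are then started greedily as early as possible,
   those of the long jobs in the order of their priorities.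

   A short operation starts no later than the work placed on its machine plus
   the work placed of its job; so it ends by the load of its machine plus the
   length of its job, and the loads are almost those of an optimal schedule if
   the chunks are distributed as in that schedule.  If the long jobs are given
   their optimal shops and the order of their optimal starting times, each of
   their operations adds at most the length of two short operations to the
   delay.  The threshold is chosen by the pigeonhole principle: between the long
   and the short jobs there is a group of jobs of small total volume, which come
   last among the jobs with a priority, and the short jobs are so short that all
   the delays together are negligible.  The same greedy schedules, with a
   priority for every operation, show that an optimal schedule exists. *)

Set Implicit Arguments.
Unset Strict Implicit.
Unset Printing Implicit Defensive.

Import Order.TTheory GRing.Theory Num.Theory.
Local Open Scope ring_scope.
#[local] Arguments upd : simpl never.
#[local] Notation "c1 ;; c2" := (Seq c1 c2) (at level 90, right associativity).

(** * Program logic with a syntactic time bound *)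

(** The number of candidates may depend on the accuracy alone, so nothing can be guessed about an
    individual short job; only the volume that each class puts on each shop is guessed. Jobs of one
    class divide their length among the stages in nearly the same proportions, so equal volumes give
    nearly equal loads on all machines of a shop. The rounding errors are fractions of the total
    volume [V], which is at most [m * k] times the optimum. The machine cannot multiply two stored
    values or round. This is why proportions and positions within a class are read as binary digits
    by repeated halving, and why the large parameters are powers of two. The thresholds [level t]
    grow by the factor [2 ^ Q]: at most [k * level t] operations are long, while a short job has
    length at most [V / (level t * 2 ^ Q)], so the delays together are of order [k * V / 2 ^ Q]. One
    of the first [Q] gaps between thresholds has volume at most [V / Q]. The factor [2 * m * k] in
    [Q] turns fractions of [V] into fractions of the optimum. *)

Fixpoint writes_ivar c x : bool :=
  match c with
  | ISetVar y _ => x == y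
  | Seq c1 c2 | If _ c1 c2 => writes_ivar c1 x || writes_ivar c2 x
  | While _ c => writes_ivar c x
  | _ => false
  end.

Fixpoint writes_rvar c x : bool :=
  match c with
  | RSetVar y _ => x == y
  | Seq c1 c2 | If _ c1 c2 => writes_rvar c1 x || writes_rvar c2 x
  | While _ c => writes_rvar c x
  | _ => false
  end.

Fixpoint writes_iarr c x : bool :=
  match c with
  | ISet y _ _ => x == y
  | Seq c1 c2 | If _ c1 c2 => writes_iarr c1 x || writes_iarr c2 x
  | While _ c => writes_iarr c x
  | _ => false
  end.

Fixpoint writes_rarr c x : bool :=
  match c with
  | RSet y _ _ => x == y
  | Seq c1 c2 | If _ c1 c2 => writes_rarr c1 x || writes_rarr c2 x
  | While _ c => writes_rarr c x
  | _ => false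
  end.

Fixpoint stable_iexp c e : bool :=
  match e with
  | IConst _ => true
  | IVar x => ~~ writes_ivar c x
  | IAdd e1 e2 | ISub e1 e2 => stable_iexp c e1 && stable_iexp c e2
  | IGet a e => ~~ writes_iarr c a && stable_iexp c e
  end.

Lemma stable_iexp_sub c c' e :
  (forall x, writes_ivar c' x -> writes_ivar c x) ->
  (forall a, writes_iarr c' a -> writes_iarr c a) ->
  stable_iexp c e -> stable_iexp c' e.
Proof.
move=> hv ha; elim: e => //= [x|e1 h1 e2 h2|e1 h1 e2 h2|a e h].
- by apply: contra; apply: hv.
- by case/andP=> /h1 -> /h2.
- by case/andP=> /h1 -> /h2.
- by case/andP=> na /h ->; rewrite (contra _ na) // => /ha.
Qed.

(* The running time of [c] if none of its loops iterates more than [Z] times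
   per execution. *)
Fixpoint tbound (Z : nat) (c : cmd) : nat :=
  match c with
  | Skip => 1
  | ISetVar _ e => (icost e).+1
  | RSetVar _ e => (rcost e).+1
  | ISet _ d e => (icost d + icost e).+1
  | RSet _ d e => (icost d + rcost e).+1
  | Seq c1 c2 => (tbound Z c1 + tbound Z c2).+1
  | If b c1 c2 => (bcost b + (tbound Z c1 + tbound Z c2)).+1
  | While b c => (bcost b).+1 + Z * (bcost b + tbound Z c).+1
  end%N.

(** A loop raises the degree by one and a composition adds the degrees, so [K] and [d] depend on the
    program text only. Polynomial running time then follows from a bound [Z] on the iterations. *)
Lemma tbound_poly c : exists K d, forall Z, (tbound Z c <= K * Z.+1 ^ d)%N.
Proof.
have two K1 d1 K2 d2 t1 t2 Z : (t1 <= K1 * Z.+1 ^ d1 -> t2 <= K2 * Z.+1 ^ d2 ->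
    t1 + t2 <= (K1 + K2) * Z.+1 ^ (d1 + d2))%N.
  move=> h1 h2; rewrite mulnDl; apply: leq_add.
    by apply: leq_trans h1 _; rewrite leq_mul2l leq_pexp2l ?orbT // leq_addr.
  by apply: leq_trans h2 _; rewrite leq_mul2l leq_pexp2l ?orbT // leq_addl.
have one K d a t Z : (t <= K * Z.+1 ^ d -> (a + t).+1 <= (a.+1 + K) * Z.+1 ^ (0 + d))%N.
  by move=> h; rewrite -addSn; apply: two => //; rewrite expn0 muln1.
elim: c => [|x e|x e|a d e|a d e|c1 [K1 [d1 h1]] c2 [K2 [d2 h2]]|b c1 [K1 [d1 h1]] c2 [K2 [d2 h2]]|b c [K [d h]]] /=.
- by exists 1%N, 0%N => Z; rewrite expn0.
- by exists (icost e).+1, 0%N => Z; rewrite expn0 muln1.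
- by exists (rcost e).+1, 0%N => Z; rewrite expn0 muln1.
- by exists (icost d + icost e).+1, 0%N => Z; rewrite expn0 muln1.
- by exists (icost d + rcost e).+1, 0%N => Z; rewrite expn0 muln1.
- by exists (1 + (K1 + K2))%N, (0 + (d1 + d2))%N => Z; apply: (one _ _ 0%N); apply: two.
- by exists ((bcost b).+1 + (K1 + K2))%N, (0 + (d1 + d2))%N => Z; apply: one; apply: two.
- exists ((bcost b).+1 + ((bcost b).+1 + K))%N, (0 + (0 + d).+1)%N => Z.
  apply: two; first by rewrite expn0 muln1.
  apply: leq_trans (leq_mul (leqnSn Z) (one _ _ (bcost b) _ _ (h Z))) _.
  by rewrite expnS mulnCA.
Qed.

Section Logic.
Variables (R : realFieldType) (Z : nat).
Implicit Types (s : state R) (c : cmd) (Q : state R -> Prop).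

Record frame c s s' : Prop := Frame {
  frame_ivar : forall x, ~~ writes_ivar c x -> ivar s' x = ivar s x;
  frame_rvar : forall x, ~~ writes_rvar c x -> rvar s' x = rvar s x;
  frame_iarr : forall a, ~~ writes_iarr c a -> iarr s' a = iarr s a;
  frame_rarr : forall a, ~~ writes_rarr c a -> rarr s' a = rarr s a }.

Lemma exec_frame c s t s' : exec c s t s' -> frame c s s'.
Proof.
elim=> {c s t s'} /=.
- by move=> s; split.
- by move=> x e s; split=> //= y ny; rewrite /upd (negPf ny).
- by move=> x e s; split=> //= y ny; rewrite /upd (negPf ny).
- by move=> x d e s; split=> //= y ny; rewrite /upd2 /upd (negPf ny).
- by move=> x d e s; split=> //= y ny; rewrite /upd2 /upd (negPf ny).
- move=> c1 c2 s t1 s1 t2 s2 _ [a1 b1 d1 e1] _ [a2 b2 d2 e2].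
  by split=> y /=; rewrite negb_or => /andP[n1 n2]; rewrite ?a2 ?b2 ?d2 ?e2 ?a1 ?b1 ?d1 ?e1.
- move=> b c1 c2 s t s' _ _ [a1 b1 d1 e1].
  by split=> y /=; rewrite negb_or => /andP[n1 n2]; rewrite ?a1 ?b1 ?d1 ?e1.
- move=> b c1 c2 s t s' _ _ [a1 b1 d1 e1].
  by split=> y /=; rewrite negb_or => /andP[n1 n2]; rewrite ?a1 ?b1 ?d1 ?e1.
- by [].
- move=> b c s t1 s1 t2 s2 _ _ [a1 b1 d1 e1] _ [a2 b2 d2 e2].
  by split=> y /= n1; rewrite ?a2 ?b2 ?d2 ?e2 ?a1 ?b1 ?d1 ?e1.
Qed.

Lemma frame_trans c s s1 s2 : frame c s s1 -> frame c s1 s2 -> frame c s s2.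
Proof.
move=> [a1 b1 d1 e1] [a2 b2 d2 e2].
by split=> y /= n1; rewrite ?a2 ?b2 ?d2 ?e2 ?a1 ?b1 ?d1 ?e1.
Qed.

Lemma frame_sub c c' s s' :
  (forall x, writes_ivar c x -> writes_ivar c' x) ->
  (forall x, writes_rvar c x -> writes_rvar c' x) ->
  (forall a, writes_iarr c a -> writes_iarr c' a) ->
  (forall a, writes_rarr c a -> writes_rarr c' a) ->
  frame c s s' -> frame c' s s'.
Proof.
move=> h1 h2 h3 h4 [f1 f2 f3 f4]; split=> x nx.
- by apply: f1; apply: contra nx; apply: h1.
- by apply: f2; apply: contra nx; apply: h2.
- by apply: f3; apply: contra nx; apply: h3.
- by apply: f4; apply: contra nx; apply: h4.
Qed.

Lemma frame_iexp c e s s' : frame c s s' -> stable_iexp c e -> ieval s' e = ieval s e.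
Proof.
move=> [fi _ fa _]; elim: e => [//|x|e1 h1 e2 h2|e1 h1 e2 h2|a e h] /=.
- exact: fi.
- by case/andP=> /h1 -> /h2 ->.
- by case/andP=> /h1 -> /h2 ->.
- by case/andP=> /fa -> /h ->.
Qed.

(** Total correctness together with the time bound. As the bound is syntactic, proofs about programs
    never count steps; they only keep the loops within [Z] iterations. *)
Definition wp c s Q := exists t s', [/\ exec c s t s', (t <= tbound Z c)%N & Q s'].

Lemma wp_conseq c s Q Q' :
  wp c s Q -> (forall s', frame c s s' -> Q s' -> Q' s') -> wp c s Q'.
Proof.
move=> [t [s' [ex tt q]]] qq; exists t, s'; split=> //.
by apply: qq => //; apply: exec_frame ex.
Qed.

Lemma wp_iset x e s Q :
  Q (State (upd (ivar s) x (ieval s e)) (rvar s) (iarr s) (rarr s)) ->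
  wp (ISetVar x e) s Q.
Proof. by move=> q; eexists _, _; split; [apply: ExecISetVar| |]. Qed.

Lemma wp_rset x e s Q :
  Q (State (ivar s) (upd (rvar s) x (reval s e)) (iarr s) (rarr s)) ->
  wp (RSetVar x e) s Q.
Proof. by move=> q; eexists _, _; split; [apply: ExecRSetVar| |]. Qed.

Lemma wp_iaset a d e s Q :
  Q (State (ivar s) (rvar s) (upd2 (iarr s) a (ieval s d) (ieval s e)) (rarr s)) ->
  wp (ISet a d e) s Q.
Proof. by move=> q; eexists _, _; split; [apply: ExecISet| |]. Qed.

Lemma wp_raset a d e s Q :
  Q (State (ivar s) (rvar s) (iarr s) (upd2 (rarr s) a (ieval s d) (reval s e))) ->
  wp (RSet a d e) s Q.
Proof. by move=> q; eexists _, _; split; [apply: ExecRSet| |]. Qed.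

Lemma wp_skip s Q : Q s -> wp Skip s Q.
Proof. by move=> q; eexists _, _; split; [apply: ExecSkip| |]. Qed.

Lemma wp_seq c1 c2 s Q : wp c1 s (fun s1 => wp c2 s1 Q) -> wp (Seq c1 c2) s Q.
Proof.
move=> [t1 [s1 [e1 l1 [t2 [s2 [e2 l2 q]]]]]].
exists (t1 + t2).+1, s2; split=> //=; first exact: ExecSeq e1 e2.
by rewrite ltnS leq_add.
Qed.

Lemma wp_step c1 c2 s Q1 Q : wp c1 s Q1 ->
  (forall s1, frame c1 s s1 -> Q1 s1 -> wp c2 s1 Q) -> wp (Seq c1 c2) s Q.
Proof. by move=> w1 w2; apply/wp_seq/(wp_conseq w1). Qed.

Lemma wp_if b c1 c2 s Q :
  (beval s b -> wp c1 s Q) -> (~~ beval s b -> wp c2 s Q) -> wp (If b c1 c2) s Q.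
Proof.
have [bs w _|bs _ w] := boolP (beval s b).
  have [t [s' [e l q]]] := w isT; exists (bcost b + t).+1, s'; split=> //=.
    exact: ExecIfTrue.
  by rewrite ltnS leq_add2l (leq_trans l) // leq_addr.
have [t [s' [e l q]]] := w isT; exists (bcost b + t).+1, s'; split=> //=.
  exact: ExecIfFalse.
by rewrite ltnS leq_add2l (leq_trans l) // leq_addl.
Qed.

(** The frame compares every iterate with the state before the loop, so an invariant has to mention
    only cells that the body changes. The proof is by induction on the number of remaining
    iterations. *)
Lemma wp_while b c s nb (I : nat -> state R -> Prop) Q :
  (nb <= Z)%N -> I 0%N s ->
  (forall i s', (i < nb)%N -> frame c s s' -> I i s' ->
     beval s' b /\ wp c s' (I i.+1)) ->
  (forall s', frame c s s' -> I nb s' -> ~~ beval s' b /\ Q s') ->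
  wp (While b c) s Q.
Proof.
move=> nbZ I0 IS Iend.
suff gen d s1 : (d <= nb)%N -> frame c s s1 -> I (nb - d)%N s1 ->
    exists t s', [/\ exec (While b c) s1 t s',
      (t <= (bcost b).+1 + d * (bcost b + tbound Z c).+1)%N & Q s'].
  have [|||t [s' [ex tt q]]] := gen nb s => //; first by rewrite subnn.
  by exists t, s'; split=> //=; apply: leq_trans tt _; rewrite leq_add2l leq_mul2r nbZ orbT.
elim: d s1 => [|d IH] s1 dn fr Is1.
  rewrite subn0 in Is1; have [nb1 q1] := Iend _ fr Is1.
  by exists (bcost b).+1, s1; split=> //; [apply: ExecWhileFalse|rewrite mul0n addn0].
have [|b1 [t2 [s2 [e2 l2 I2]]]] := IS (nb - d.+1)%N s1 _ fr Is1; first by lia.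
have fr2 := frame_trans fr (exec_frame e2).
have [|||t3 [s3 [e3 l3 q3]]] := IH s2 => //; first exact: ltnW.
  by rewrite (_ : nb - d = (nb - d.+1).+1)%N //; lia.
exists (bcost b + t2 + t3).+1, s3; split=> //; first exact: ExecWhileTrue e2 e3.
by rewrite mulSn; lia.
Qed.

End Logic.

Ltac sub_writes := by move=> ? /=; repeat (case: (_ == _) => //=).

Definition For x e c :=
  Seq (ISetVar x (IConst 0))
    (While (BNot (BILe e (IVar x))) (Seq c (ISetVar x (IAdd (IVar x) (IConst 1))))).

Definition ivar_set (R : realFieldType) (s : state R) x v :=
  State (upd (ivar s) x v) (rvar s) (iarr s) (rarr s).

(** The test evaluates [e] anew in each round; its stability makes the initial value the number of
    rounds. *)
Lemma wp_for (R : realFieldType) (Z : nat) x e c (s : state R)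
    (I : nat -> state R -> Prop) (Q : state R -> Prop) :
  (ieval s e <= Z)%N -> stable_iexp (For x e c) e -> ~~ writes_ivar c x ->
  I 0%N (ivar_set s x 0%N) ->
  (forall i s', (i < ieval s e)%N -> frame (For x e c) s s' -> ivar s' x = i ->
     I i s' -> wp Z c s' (fun s'' => I i.+1 (ivar_set s'' x i.+1))) ->
  (forall s', frame (For x e c) s s' -> I (ieval s e) s' -> Q s') ->
  wp Z (For x e c) s Q.
Proof.
move=> eZ st nx I0 IS Iend; apply/wp_seq/wp_iset => /=.
have fr0 : frame (For x e c) s (ivar_set s x 0%N).
  by split=> //= y; rewrite negb_or => /andP[ny _]; rewrite /upd (negPf ny).
have sub s1 : frame (Seq c (ISetVar x (IAdd (IVar x) (IConst 1)))) (ivar_set s x 0%N) s1 ->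
    frame (For x e c) s s1.
  move=> [f1 f2 f3 f4]; apply: (frame_trans fr0).
  by split=> y /= ny; [apply: f1; case/norP: ny|apply: f2|apply: f3|apply: f4].
apply: (wp_while (nb := ieval s e) (I := fun i s' => ivar s' x = i /\ I i s')) => //.
- by split; rewrite //= /upd eqxx.
- move=> i s1 ib /sub fr [xi Ii]; split.
    by rewrite /= (frame_iexp fr st) xi -ltnNge.
  apply: (wp_step (IS _ _ ib fr xi Ii)) => s2 fr2 I2; apply: wp_iset => /=.
  rewrite (frame_ivar fr2) // xi addn1; split=> //=.
  by rewrite /upd eqxx.
- move=> s1 /sub fr [xi Ii]; split; first by rewrite /= (frame_iexp fr st) xi leqnn.
  exact: Iend.
Qed.

(** * The greedy schedule *)

Lemma updE (T : Type) (g : nat -> T) x v y :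
  upd g x v y = if y == x then v else g y.
Proof. by []. Qed.

Section Greedy.
Variables (R : realFieldType) (N : nat) (p : nat -> R).
Variables (ma jb pr : nat -> nat) (fl : nat -> bool).

Record gstate := GState {
  placed : nat -> nat;
  mavail : nat -> R;
  javail : nat -> R;
  gstart : nat -> R }.

Implicit Type g : gstate.

Definition est g o := Num.max (mavail g (ma o)) (javail g (jb o)).

Definition place g o :=
  GState (upd (placed g) o 1%N)
         (upd (mavail g) (ma o) (est g o + p o))
         (upd (javail g) (jb o) (est g o + p o))
         (upd (gstart g) o (est g o)).

Definition waiting g o := (o < N)%N && (placed g o == 0%N).

Definition next_forced g r :=
  [/\ waiting g r, fl r &
      forall o, waiting g o -> fl o -> (pr r <= pr o)%N].

(* A small operation is taken only if it can start strictly before the next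
   forced operation; this is what bounds the delay of the forced ones. *)
Definition selected g o :=
  if fl o then
    next_forced g o /\ forall z, waiting g z -> ~~ fl z -> est g o <= est g z
  else
    [/\ waiting g o,
        (forall r, waiting g r -> ~~ fl r) \/
          (exists2 r, next_forced g r & est g o < est g r) &
        forall z, waiting g z -> ~~ fl z -> est g o <= est g z].

Definition psum g (F : nat -> R) := \sum_(o < N | placed g o != 0%N) F o.

Lemma selected_waiting g o : selected g o -> waiting g o.
Proof. by rewrite /selected; case: (fl o) => [[[]]|[]]. Qed.

Lemma selected_le g o z :
  selected g o -> waiting g z -> ~~ fl z -> est g o <= est g z.
Proof. by rewrite /selected; case: (fl o) => [[_]|[_ _]]; apply. Qed.

Lemma waiting_place g o z :
  waiting (place g o) z = waiting g z && (z != o).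
Proof.
by rewrite /waiting /= updE; case: (z == o); rewrite ?andbF ?andbT.
Qed.

Lemma psum_place g o F : waiting g o ->
  psum (place g o) F = F o + psum g F.
Proof.
case/andP=> oN /eqP po; rewrite /psum (bigD1 (Ordinal oN)) /=; last first.
  by rewrite updE eqxx.
congr (_ + _); apply: eq_bigl => z; rewrite updE -val_eqE /=.
by case: (nat_of_ord z =P o) => [->|]; rewrite ?po //= andbT.
Qed.

Lemma psum_le g F : (forall o, (o < N)%N -> 0 <= F o) ->
  psum g F <= \sum_(o < N) F o.
Proof.
move=> F0; rewrite [leRHS](bigID (fun o : 'I_N => placed g o != 0%N)) /=.
by rewrite lerDl sumr_ge0 // => o _; apply: F0.
Qed.

Lemma psum_ge0 g F : (forall o, (o < N)%N -> 0 <= F o) -> 0 <= psum g F.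
Proof. by move=> F0; apply: sumr_ge0 => o _; apply: F0. Qed.

Definition mwork g mu := psum g (fun o => if ma o == mu then p o else 0).
Definition jwork g i := psum g (fun o => if jb o == i then p o else 0).

(** These clauses hold for every candidate, good or not. [gi_excl] separates operations of length
    zero as well, which is more than feasibility asks for. *)
Record ginv (c : nat) g (mk : R) : Prop := GInv {
  gi_count : psum g (fun=> 1) = c%:R;
  gi_mavail : forall o, (o < N)%N -> 0 <= mavail g (ma o);
  gi_javail : forall o, (o < N)%N -> 0 <= javail g (jb o);
  gi_start : forall o, (o < N)%N -> placed g o != 0%N -> 0 <= gstart g o;
  gi_endm : forall o, (o < N)%N -> placed g o != 0%N ->
    gstart g o + p o <= mavail g (ma o);
  gi_endj : forall o, (o < N)%N -> placed g o != 0%N ->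
    gstart g o + p o <= javail g (jb o);
  gi_excl : forall o o', (o < N)%N -> (o' < N)%N ->
    placed g o != 0%N -> placed g o' != 0%N ->
    o <> o' -> ma o = ma o' \/ jb o = jb o' ->
    gstart g o + p o <= gstart g o' \/ gstart g o' + p o' <= gstart g o;
  gi_mk : forall o, (o < N)%N -> placed g o != 0%N -> gstart g o + p o <= mk;
  gi_small : forall z, waiting g z -> ~~ fl z ->
    est g z <= mwork g (ma z) + jwork g (jb z) }.

Hypothesis p0 : forall o, (o < N)%N -> 0 <= p o.

Lemma ginv_init g : (forall o, (o < N)%N -> placed g o = 0%N) ->
  (forall o, (o < N)%N -> mavail g (ma o) = 0) ->
  (forall o, (o < N)%N -> javail g (jb o) = 0) -> ginv 0 g 0.
Proof.
move=> pl0 m0 j0.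
have ps F : psum g F = 0 by rewrite /psum big1 // => o; rewrite pl0.
split=> //; try by move=> o oN; rewrite ?pl0 ?m0 ?j0.
- by move=> o o' oN o'N; rewrite pl0.
- move=> z /andP[zN _] _; rewrite /mwork /jwork !ps /est m0 // j0 //.
  by rewrite maxxx addr0.
Qed.

Lemma est_ge0 c g mk o : ginv c g mk -> (o < N)%N -> 0 <= est g o.
Proof. by move=> I oN; rewrite /est le_max (gi_mavail I). Qed.

Lemma work_ge0 o (b : bool) : (o < N)%N -> 0 <= (if b then p o else 0).
Proof. by move=> oN; case: b => //; apply: p0. Qed.

Lemma ginv_place c g mk o : ginv c g mk -> selected g o ->
  ginv c.+1 (place g o) (Num.max mk (est g o + p o)).
Proof.
move=> I so; have wo := selected_waiting so.
have [oN /eqP po] := andP wo; have po0 := p0 oN; have e0 := est_ge0 I oN.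
have eM : mavail g (ma o) <= est g o by rewrite le_max lexx.
have eJ : javail g (jb o) <= est g o by rewrite le_max lexx orbT.
split=> /=.
- by rewrite psum_place // (gi_count I) -natr1 addrC.
- by move=> z zN; rewrite updE; case: eqP => // _; [apply: addr_ge0|apply: (gi_mavail I)].
- by move=> z zN; rewrite updE; case: eqP => // _; [apply: addr_ge0|apply: (gi_javail I)].
- move=> z zN; rewrite !updE; case: (z =P o) => // _; exact: (gi_start I).
- move=> z zN; rewrite !updE; case: (z =P o) => [->|_ pz]; first by rewrite eqxx.
  have h := gi_endm I zN pz; case: eqP => [e|//]; rewrite e in h; lra.
- move=> z zN; rewrite !updE; case: (z =P o) => [->|_ pz]; first by rewrite eqxx.
  have h := gi_endj I zN pz; case: eqP => [e|//]; rewrite e in h; lra.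
- move=> z z' zN z'N; rewrite !updE.
  case: (z =P o) => [->|_]; case: (z' =P o) => [->|_] //.
  + move=> _ pz' _ h; right; case: h => h.
      by have := gi_endm I z'N pz'; rewrite -h; lra.
    by have := gi_endj I z'N pz'; rewrite -h; lra.
  + move=> pz _ _ h; left; case: h => h.
      by have := gi_endm I zN pz; rewrite h; lra.
    by have := gi_endj I zN pz; rewrite h; lra.
  + exact: (gi_excl I).
- move=> z zN; rewrite !updE le_max; case: (z =P o) => [->|_ pz]; first by rewrite lexx orbT.
  by rewrite (gi_mk I).
- move=> z; rewrite waiting_place => /andP[wz zo] fz.
  (* As [o] starts no later than [z] could, the end of [o] exceeds the old [est g z] by at most
     [p o]; the work on the shared machine or job grows by this amount. *)
  have le_oz := selected_le so wz fz.
  have h := gi_small I wz fz; rewrite /mwork /jwork in h *; rewrite !psum_place //.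
  rewrite {1}/est /= !updE ge_max.
  have zM : mavail g (ma z) <= est g z by rewrite le_max lexx.
  have zJ : javail g (jb z) <= est g z by rewrite le_max lexx orbT.
  rewrite (eq_sym (ma o)) (eq_sym (jb o)).
  case: (ma z =P ma o) => _; case: (jb z =P jb o) => _; apply/andP; split; lra.
Qed.

Lemma psum_card g : psum g (fun=> 1) = #|[pred o : 'I_N | placed g o != 0%N]|%:R.
Proof. by rewrite /psum sumr_const. Qed.

Lemma ginv_all c g mk o : ginv c g mk -> (N <= c)%N -> (o < N)%N ->
  placed g o != 0%N.
Proof.
move=> I Nc oN; apply/negP => po.
have := gi_count I; rewrite psum_card => /eqP; rewrite eqr_nat => /eqP e.
suff : (#|[pred o : 'I_N | placed g o != 0%N]| < N)%N by lia.
rewrite -[X in (_ < X)%N]card_ord; apply/proper_card/properP.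
by split; [apply/subsetP|exists (Ordinal oN); rewrite // !inE /= po].
Qed.

Lemma ginv_waiting c g mk : ginv c g mk -> (c < N)%N -> exists o, waiting g o.
Proof.
move=> I cN; have [/existsP[o wo]|/existsPn w] := boolP [exists o : 'I_N, waiting g o].
  by exists o.
have := gi_count I; rewrite psum_card (eq_card (B := predT)) => [|o]; last first.
  by have := w o; rewrite /waiting ltn_ord /= !inE => ->.
by rewrite card_ord => /eqP; rewrite eqr_nat => /eqP; lia.
Qed.

(** What makes a candidate good. [H] marks the long operations and [s] gives their starts in a
    reference schedule; operations with [fl] outside [H] are medium, and those without [fl] are
    short. By [q_jb] short operations can delay long ones through machines only. *)
Record quality (H : pred nat) (s : nat -> R) (delta Z : R) : Prop := Quality {
  q_forced : forall o, H o -> fl o;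
  q_delta : 0 <= delta;
  q_s : forall o, H o -> 0 <= s o;
  q_small : forall z, (z < N)%N -> ~~ fl z -> p z <= delta;
  q_pr : forall o o', H o -> (o' < N)%N -> fl o' -> ~~ H o' -> (pr o < pr o')%N;
  q_pr_inj : forall o o', H o -> H o' -> pr o = pr o' -> o = o';
  q_pr_s : forall o o', H o -> H o' -> (pr o <= pr o')%N -> s o <= s o';
  q_conflict : forall o o', H o -> H o' -> o != o' -> (pr o <= pr o')%N ->
    ma o = ma o' \/ jb o = jb o' -> s o + p o <= s o';
  q_jb : forall o z, H o -> (z < N)%N -> ~~ fl z -> jb o != jb z;
  q_Z : 0 <= Z;
  q_Z_H : forall o, (o < N)%N -> H o ->
    s o + p o + 2 * (\sum_(o < N) (H o)%:R) * delta <= Z;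
  q_Z_small : forall z, (z < N)%N -> ~~ fl z ->
    \sum_(o < N) (if ma o == ma z then p o else 0)
    + \sum_(o < N) (if jb o == jb z then p o else 0) <= Z }.

(** * Makespan of a greedy run for a good candidate *)

Section Quality.
Variables (H : pred nat) (s : nat -> R) (delta Z : R).
Hypothesis QH : quality H s delta Z.

Definition nH g := psum g (fun o => (H o)%:R).
Definition nHtot : R := \sum_(o < N) (H o)%:R.
Definition medwork g := psum g (fun o => if fl o && ~~ H o then p o else 0).

(** Each placed long operation pays for two delays by [delta]. Before the next one is placed, a
    short operation may delay the next forced operation [r] by one [delta] ([qi_next]), and another
    short one, starting before the delayed [r], may end one [delta] later still on the machine of
    another long operation ([qi_m]). Jobs need no such slack ([qi_j]). *)
Record qinv g (mk : R) : Prop := QInv {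
  qi_j : forall o, waiting g o -> H o ->
    javail g (jb o) <= s o + 2 * nH g * delta;
  qi_m : forall o, waiting g o -> H o ->
    mavail g (ma o) <= s o + (2 * nH g + 2) * delta;
  qi_next : forall o, next_forced g o -> H o ->
    mavail g (ma o) <= s o + (2 * nH g + 1) * delta;
  qi_mZ : forall o, (o < N)%N -> mavail g (ma o) <= Z + medwork g;
  qi_jZ : forall o, (o < N)%N -> javail g (jb o) <= Z + medwork g;
  qi_mk : mk <= Z + medwork g }.

Lemma nH_ge0 g : 0 <= nH g. Proof. by apply: psum_ge0 => o _; case: (H o). Qed.

Lemma med_ge0 g : 0 <= medwork g.
Proof. by apply: psum_ge0 => o oN; apply: work_ge0. Qed.

(** Long operations precede the medium ones in priority, so a medium one can be next only when no
    long one is left. *)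
Lemma next_forced_H g r o : next_forced g r -> waiting g o -> H o -> H r.
Proof.
move=> [/andP[rN _] fr le_r] wo Ho; apply/negPn/negP => /(q_pr QH Ho rN fr).
by rewrite ltnNge le_r // (q_forced QH).
Qed.

Lemma next_forced_uniq g r o : next_forced g r -> next_forced g o -> H o -> o = r.
Proof.
move=> nr no Ho; have [wo fo le_o] := no; have Hr := next_forced_H nr wo Ho.
have [wr fr le_r] := nr; apply: (q_pr_inj QH) => //.
by apply/eqP; rewrite eqn_leq le_r ?le_o.
Qed.

Lemma qinv_place c g mk o : ginv c g mk -> qinv g mk -> selected g o ->
  qinv (place g o) (Num.max mk (est g o + p o)).
Proof.
move=> I Q so; have wo := selected_waiting so; have [oN /eqP po] := andP wo.
have p_o := p0 oN; have nHg := nH_ge0 g; have d0 := (q_delta QH).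
have d1 : 0 <= nH g * delta by apply: mulr_ge0.
have med' : medwork (place g o) = (if fl o && ~~ H o then p o else 0) + medwork g.
  by rewrite /medwork psum_place.
have nH' : nH (place g o) = (H o)%:R + nH g by rewrite /nH psum_place.
(* A medium operation waits at most until all machines and jobs are free and pays for its own length
   in [medwork]; a long one is bounded by its slack, a short one by [gi_small]. *)
have eZ : est g o + p o <= Z + medwork (place g o).
  have med0 := med_ge0 g.
  have [/andP[fo Ho]|nm] := boolP (fl o && ~~ H o).
    rewrite med' fo Ho /=; suff : est g o <= Z + medwork g by lra.
    by rewrite ge_max (qi_mZ Q oN) (qi_jZ Q oN).
  rewrite med' (negPf nm) add0r; move: nm; rewrite negb_and.
  have [fo /= /negPn Ho|fo _] := boolP (fl o).
    have [no _] : next_forced g o /\ forall z, waiting g z -> ~~ fl z -> est g o <= est g z.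
      by move: so; rewrite /selected fo.
    (* The operation [o] is not yet counted in [nH g], so its slack [2 * nH g + 1] fits below
       [2 * nHtot]. *)
    have tot : nH g + 1 <= nHtot.
      have : nH (place g o) <= nHtot by apply: psum_le => z _; apply: ler0n.
      by rewrite nH' Ho addrC.
    have : (nH g + 1) * delta <= nHtot * delta by rewrite ler_wpM2r.
    have := q_Z_H QH oN Ho; rewrite -/nHtot; have := qi_next Q no Ho; have := qi_j Q wo Ho => h1 h2 h3 h4.
    suff : est g o <= s o + (2 * nH g + 1) * delta by lra.
    by rewrite ge_max h2 /=; lra.
  have h := gi_small I wo fo; have := q_Z_small QH oN fo.
  have W F := psum_le (place g o) (F := fun x => if F x then p x else 0)
     (fun z zN => work_ge0 (F z) zN).
  have := W (fun x => ma x == ma o); have := W (fun x => jb x == jb o).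
  rewrite !psum_place // !eqxx; move: h; rewrite /mwork /jwork; lra.
have medle : medwork g <= medwork (place g o).
  by rewrite med' lerDr work_ge0.
have qm z : (z < N)%N -> mavail (place g o) (ma z) <= Z + medwork (place g o).
  by move=> zN; rewrite /= updE; case: eqP => // _; have := qi_mZ Q zN; lra.
have qj z : (z < N)%N -> javail (place g o) (jb z) <= Z + medwork (place g o).
  by move=> zN; rewrite /= updE; case: eqP => // _; have := qi_jZ Q zN; lra.
have qk : Num.max mk (est g o + p o) <= Z + medwork (place g o).
  by rewrite ge_max eZ andbT; have := qi_mk Q; lra.
have [Ho|Ho] := boolP (H o).
  have [no _] : next_forced g o /\ forall z, waiting g z -> ~~ fl z -> est g o <= est g z.
    by move: so; rewrite /selected (q_forced QH).
  have Eo : est g o <= s o + (2 * nH g + 1) * delta.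
    by have := qi_next Q no Ho; have := qi_j Q wo Ho => ? ?; rewrite ge_max; apply/andP; split; lra.
  have conf o' : waiting g o' -> o' != o -> H o' -> ma o' = ma o \/ jb o' = jb o ->
      est g o + p o <= s o' + (2 * nH g + 1) * delta.
    move=> wo' oo' Ho' cf; have [_ _ le_o] := no.
    suff : s o + p o <= s o' by lra.
    apply: (q_conflict QH) => //; [by rewrite eq_sym|by apply: le_o => //; exact: (q_forced QH)|].
    by case: cf; auto.
  (* Placing [o] raises [nH] by one, which absorbs the extra slack [2] in [qi_m]: both [qi_m] and
     [qi_next] start afresh. *)
  have M o' : waiting (place g o) o' -> H o' ->
      mavail (place g o) (ma o') <= s o' + 2 * (nH g + 1) * delta.
    rewrite waiting_place /= updE => /andP[w' o'o] Ho'; case: eqP => [e|_].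
      by have := conf o' w' o'o Ho' (or_introl e); lra.
    by have := qi_m Q w' Ho'; lra.
  split=> //.
  - move=> o'; rewrite waiting_place nH' Ho mulr1n /= updE => /andP[w' o'o] Ho'; case: eqP => [e|_].
      by have := conf o' w' o'o Ho' (or_intror e); lra.
    by have := qi_j Q w' Ho'; lra.
  - by move=> o' w' Ho'; have := M o' w' Ho'; rewrite nH' Ho mulr1n; lra.
  - by move=> o' [w' _ _] Ho'; have := M o' w' Ho'; rewrite nH' Ho mulr1n; lra.
(* If a medium operation is placed, no long one is waiting, and the first three clauses are void. *)
have [fo|fo] := boolP (fl o).
  have [no _] : next_forced g o /\ forall z, waiting g z -> ~~ fl z -> est g o <= est g z.
    by move: so; rewrite /selected fo.
  have noH o' : waiting (place g o) o' -> ~~ H o'.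
    rewrite waiting_place => /andP[w' _]; apply: contra Ho.
    exact: next_forced_H no w'.
  split=> //; first by move=> o' /noH /negPf ->.
    by move=> o' /noH /negPf ->.
  by move=> o' [/noH /negPf ->].
have nHe : nH (place g o) = nH g by rewrite nH' (negPf Ho) add0r.
have [_ alt _] : [/\ waiting g o,
        (forall r, waiting g r -> ~~ fl r) \/
          (exists2 r, next_forced g r & est g o < est g r) &
        forall z, waiting g z -> ~~ fl z -> est g o <= est g z].
  by move: so; rewrite /selected (negPf fo).
have pd := q_small QH oN fo.
case: alt => [nof|[r nr ltr]].
  have noH o' : waiting (place g o) o' -> ~~ H o'.
    rewrite waiting_place => /andP[w' _]; apply: contra (nof _ w'); exact: (q_forced QH).
  split=> //; first by move=> o' /noH /negPf ->.
    by move=> o' /noH /negPf ->.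
  by move=> o' [/noH /negPf ->].
split=> //.
- move=> o'; rewrite waiting_place nHe /= updE => /andP[w' o'o] Ho'.
  by rewrite (negPf (q_jb QH Ho' oN fo)); apply: (qi_j Q).
- move=> o'; rewrite waiting_place nHe /= updE => /andP[w' o'o] Ho'; case: eqP => [e|_]; last exact: (qi_m Q).
  (* The short [o] starts before the delayed start of [r], and [s r <= s o']; the length of [o] is
     the second [delta]. *)
  have Hr := next_forced_H nr w' Ho'; have [wr fr le_r] := nr.
  have := qi_next Q nr Hr; have := qi_j Q wr Hr => h1 h2.
  have : est g r <= s r + (2 * nH g + 1) * delta by rewrite ge_max h2 /=; lra.
  have := q_pr_s QH Hr Ho' (le_r _ w' (q_forced QH Ho')); lra.
- move=> o' no' Ho'; have no : next_forced g o'.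
    have [w' f' le'] := no'; move: w'; rewrite waiting_place => /andP[w' o'o]; split=> // z wz fz.
    apply: le' => //; rewrite waiting_place wz /=; apply: contraNneq fo => <-; exact: fz.
  have e := next_forced_uniq nr no Ho'; subst o'.
  rewrite nHe /= updE; case: eqP => [e|_]; last exact: (qi_next Q).
  (* Now [o] uses the machine of [r] itself. That machine is free by [est g o], hence before
     [est g r]; so [r] was held up by its job, for which [qi_j] has no slack, and only the length of
     [o] is added. *)
  have eM : mavail g (ma o) <= est g o by rewrite le_max lexx.
  have [wr _ _] := nr; have := qi_j Q wr Ho'.
  have : est g o < javail g (jb r) by move: ltr; rewrite {2}/est lt_max e; case/orP => //; lra.
  lra.
Qed.

Lemma qinv_init g : (forall o, (o < N)%N -> placed g o = 0%N) ->
  (forall o, (o < N)%N -> mavail g (ma o) = 0) ->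
  (forall o, (o < N)%N -> javail g (jb o) = 0) -> qinv g 0.
Proof.
move=> pl0 m0 j0.
have ps F : psum g F = 0 by rewrite /psum big1 // => o; rewrite pl0.
have d0 := q_delta QH; have Z0 := q_Z QH; split; rewrite /medwork /nH ?ps ?addr0 //.
- by move=> o /andP[oN _] Ho; rewrite j0 //; have := q_s QH Ho; lra.
- by move=> o /andP[oN _] Ho; rewrite m0 //; have := q_s QH Ho; lra.
- by move=> o [/andP[oN _] _ _] Ho; rewrite m0 //; have := q_s QH Ho; lra.
- by move=> o oN; rewrite m0.
- by move=> o oN; rewrite j0.
Qed.

Lemma qinv_le g mk : qinv g mk ->
  mk <= Z + \sum_(o < N) (if fl o && ~~ H o then p o else 0).
Proof.
move=> Q; apply: le_trans (qi_mk Q) _; rewrite lerD2l.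
by apply: psum_le => o oN; apply: work_ge0.
Qed.

End Quality.
End Greedy.

(** * The program *)

(** Index expressions have no product; a constant factor is unfolded into additions. *)
Fixpoint imulc (a : nat) (e : iexp) : iexp :=
  if a is a'.+1 then IAdd e (imulc a' e) else IConst 0.

Lemma ieval_imulc (R : realFieldType) (s : state R) a e :
  ieval s (imulc a e) = (a * ieval s e)%N.
Proof. by elim: a => //= a ->; rewrite mulSn. Qed.

Lemma stable_imulc c a e : stable_iexp c e -> stable_iexp c (imulc a e).
Proof. by move=> h; elim: a => //= a ->; rewrite h. Qed.

Definition BLt e1 e2 := BILe (IAdd e1 (IConst 1)) e2.

Section Params.
Variables m k : nat.

(* Index variables: 0 the number [n] of jobs, 1 the inverse accuracy [E], 2-4
   and 22 the parameters [Q], [M], [N] and [L = (k + 2) * Q], 7 the number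
   [n * k] of operations, 8-10 operation, job and stage, 11 class and chunk, 12
   the number of the candidate, 13-15 its decoding, 16 the threshold, 17 and 18
   shop and kind of a job, 20 the selected operation.
   Number variables: 0 the accuracy, 2 the total volume, 7 and 8 the current
   and the best makespan.
   Index arrays: 0 the shops of the best schedule, 1 the jobs of the
   operations, 2 and 3 the ranks and classes of the jobs, 4 the digits of the
   candidate, 5 the shops of the jobs, 6-9 machine, kind, priority and status
   of the operations.
   Number arrays: 0 the input, then the starting times of the best schedule, 1
   the processing times, 2 the lengths of the jobs, 3 the volumes of the
   classes, 4 and 5 the times when machines and jobs become available, 6 the
   starting times.
   The [M]-ary digits of a candidate are the shops of the long jobs (by rank),
   the shops of the chunks, the priorities of the operations of the long jobs,
   each in a block of length [M], and the threshold at position [3 * M]. *)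
Definition vn := IVar 0.
Definition vE := IVar 1.
Definition vQ := IVar 2.
Definition vM := IVar 3.
Definition vN := IVar 4.
Definition vnk := IVar 7.
Definition vo := IVar 8.
Definition vi := IVar 9.
Definition vj := IVar 10.
Definition vkey := IVar 11.
Definition vx := IVar 12.
Definition vy := IVar 13.
Definition vpos := IVar 14.
Definition vqd := IVar 15.
Definition vb := IVar 16.
Definition vsh := IVar 17.
Definition vfl := IVar 18.
Definition vbest := IVar 20.
Definition vL := IVar 22.

Definition incr x := ISetVar x (IAdd (IVar x) (IConst 1)).

(** Rounds [1 / eps] up without division, by adding up [eps] until the sum reaches [1]. *)
Definition prog_E :=
  While (BNot (BRLe (RConst 1) (RVar 1)))
    (RSetVar 1 (RAdd (RVar 1) (RVar 0)) ;; incr 1).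

(** Nested loops of doublings produce the exponent [e1 * e2], a product that index expressions
    cannot form. *)
Definition pow2 z e1 e2 :=
  ISetVar z (IConst 1) ;;
  For 5 e1 (For 6 e2 (ISetVar z (IAdd (IVar z) (IVar z)))).

(* The error is at most [(2 k + 4) m k / Q] times the optimum; [M] exceeds all
   digits and the length of their blocks, and [N >= M ^ (4 M)]. *)
Definition cQ := (2 * m * k * (2 * k + 3))%N.
Definition paramQ E := (cQ * E)%N.
Definition paramM E := (2 ^ (paramQ E * (paramQ E + (k + 4))))%N.
Definition paramN E := (2 ^ (4 * paramM E * paramM E))%N.

Definition prog_params :=
  ISetVar 2 (imulc cQ vE) ;;
  pow2 3 vQ (IAdd vQ (IConst (k + 4))) ;;
  ISetVar 22 (imulc (k + 2) vQ) ;;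
  pow2 4 (imulc 4 vM) vM.

(** The processing times are copied because array [0] is overwritten by the starting times of the
    first candidate. *)
Definition prog_data :=
  ISetVar 7 (imulc k vn) ;;
  ISetVar 8 (IConst 0) ;;
  RSetVar 2 (RConst 0) ;;
  For 9 vn (
    RSet 2 vi (RConst 0) ;;
    For 10 (IConst k) (
      RSet 1 vo (RGet 0 vo) ;;
      ISet 1 vo vi ;;
      RSet 2 vi (RAdd (RGet 2 vi) (RGet 0 vo)) ;;
      incr 8) ;;
    RSetVar 2 (RAdd (RVar 2) (RGet 2 vi))).

Definition prog_rank :=
  For 9 vn (
    ISet 2 vi (IConst 0) ;;
    For 10 vn (
      If (BAnd (BRLe (RGet 2 vi) (RGet 2 vj))
            (BNot (BAnd (BRLe (RGet 2 vj) (RGet 2 vi)) (BILe vi vj))))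
        (ISet 2 vi (IAdd (IGet 2 vi) (IConst 1)))
        Skip)).

(* Appends to [vkey] the first [e] binary digits of the ratio of [x] to [y]. *)
Definition prog_bits x y e :=
  RSetVar 4 x ;;
  RSetVar 3 y ;;
  For 26 e (
    RSetVar 3 (RScale (1 / 2%:R) (RVar 3)) ;;
    ISetVar 11 (IAdd vkey vkey) ;;
    If (BRLe (RVar 3) (RVar 4))
      (RSetVar 4 (RSub (RVar 4) (RVar 3)) ;; incr 11)
      Skip).

Definition prog_class :=
  ISetVar 8 (IConst 0) ;;
  For 9 vn (
    ISetVar 11 (IConst 0) ;;
    For 10 (IConst k) (
      prog_bits (RGet 1 vo) (RGet 2 vi) vQ ;;
      incr 8) ;;
    ISet 3 vi vkey).

(** Division by [M] is repeated subtraction; this is affordable since a candidate is below [paramN],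
    which depends on the accuracy only. *)
Definition prog_decode :=
  ISetVar 13 vx ;;
  For 14 (imulc 4 vM) (
    ISetVar 15 (IConst 0) ;;
    While (BILe vM vy) (ISetVar 13 (ISub vy vM) ;; incr 15) ;;
    ISet 4 vpos vy ;;
    ISetVar 13 vqd).

(** The chunk is determined by the volume of the class before the current job, so the volume is
    updated after its use. Replacing a digit that names no shop by [0] makes every candidate
    feasible. *)
Definition prog_shop :=
  If (BLt (IGet 2 vi) vb)
    (ISetVar 17 (IGet 4 (IGet 2 vi)) ;; ISetVar 18 (IConst 1))
    (ISetVar 11 (IGet 3 vi) ;;
     prog_bits (RGet 3 (IGet 3 vi)) (RVar 2) vL ;;
     ISetVar 17 (IGet 4 (IAdd vM vkey)) ;;
     RSet 3 (IGet 3 vi) (RAdd (RGet 3 (IGet 3 vi)) (RGet 2 vi)) ;;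
     ISetVar 18 (IConst 0)) ;;
  If (BILe (IConst m) vsh) (ISetVar 17 (IConst 0)) Skip.

Definition prog_assign :=
  For 9 vn (RSet 3 (IGet 3 vi) (RConst 0)) ;;
  ISetVar 8 (IConst 0) ;;
  For 9 vn (
    prog_shop ;;
    ISet 5 vi vsh ;;
    For 10 (IConst k) (
      ISet 6 vo (IAdd (imulc k vsh) vj) ;;
      ISet 7 vo vfl ;;
      ISet 8 vo (IGet 4 (IAdd (IAdd vM vM) (IAdd (imulc k (IGet 2 vi)) vj))) ;;
      ISet 9 vo (IConst 0) ;;
      RSet 4 (IGet 6 vo) (RConst 0) ;;
      RSet 5 vi (RConst 0) ;;
      incr 8)).

Definition prog_est x o :=
  RSetVar x (RGet 4 (IGet 6 o)) ;;
  If (BRLe (RVar x) (RGet 5 (IGet 1 o))) (RSetVar x (RGet 5 (IGet 1 o))) Skip.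

(** The position [n * k], which is no operation, stands for an empty selection. *)
Definition prog_forced :=
  For 8 vnk (
    If (BAnd (BAnd (BILe (IConst 1) (IGet 7 vo)) (BILe (IGet 9 vo) (IConst 0)))
          (BNot (BAnd (BLt vbest vnk) (BILe (IGet 8 vbest) (IGet 8 vo)))))
      (ISetVar 20 vo)
      Skip).

(** Ties go to the current selection, which gives the strict inequality against the forced operation
    in [selected]. *)
Definition prog_small :=
  For 8 vnk (
    If (BAnd (BILe (IGet 7 vo) (IConst 0)) (BILe (IGet 9 vo) (IConst 0)))
      (prog_est 6 vo ;;
       If (BAnd (BLt vbest vnk) (BRLe (RVar 5) (RVar 6)))
         Skip
         (ISetVar 20 vo ;; RSetVar 5 (RVar 6)))
      Skip).

(** Without a forced operation the estimate is read at position [n * k]; this value is never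
    compared, as the guard on [vbest] lets the first short operation replace it. *)
Definition prog_select :=
  ISetVar 20 vnk ;; prog_forced ;; prog_est 5 vbest ;; prog_small.

Definition prog_place :=
  RSetVar 6 (RAdd (RVar 5) (RGet 1 vbest)) ;;
  RSet 4 (IGet 6 vbest) (RVar 6) ;;
  RSet 5 (IGet 1 vbest) (RVar 6) ;;
  RSet 6 vbest (RVar 5) ;;
  ISet 9 vbest (IConst 1) ;;
  If (BRLe (RVar 7) (RVar 6)) (RSetVar 7 (RVar 6)) Skip.

Definition prog_greedy :=
  RSetVar 7 (RConst 0) ;;
  For 19 vnk (prog_select ;; prog_place).

Definition prog_keep :=
  If (BAnd (BILe (IConst 1) vx) (BRLe (RVar 8) (RVar 7)))
    Skip
    (RSetVar 8 (RVar 7) ;;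
     For 9 vn (ISet 0 vi (IGet 5 vi)) ;;
     For 8 vnk (RSet 0 vo (RGet 6 vo))).

Definition prog_main :=
  For 12 vN (
    prog_decode ;;
    ISetVar 16 (IGet 4 (imulc 3 vM)) ;;
    prog_assign ;;
    prog_greedy ;;
    prog_keep).

Definition prog_init :=
  prog_E ;; prog_params ;; prog_data ;; prog_rank ;; prog_class.

Definition prog := prog_init ;; prog_main.

(** * Correctness of the greedy phase *)

Section Specs.
Variables (R : realFieldType) (Z : nat).
Implicit Type s : state R.
Local Notation wp := (@wp R Z).

Lemma wp_pow2 z e1 e2 s
    (c2 := For 6 e2 (ISetVar z (IAdd (IVar z) (IVar z)))) (c1 := For 5 e1 c2) :
  (ieval s e1 <= Z)%N -> (ieval s e2 <= Z)%N -> z != 5%N -> z != 6%N ->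
  [&& stable_iexp (ISetVar z (IConst 1)) e1, stable_iexp (ISetVar z (IConst 1)) e2,
      stable_iexp c1 e1, stable_iexp c1 e2 & stable_iexp c2 e2] ->
  wp (pow2 z e1 e2) s (fun s' => ivar s' z = (2 ^ (ieval s e1 * ieval s e2))%N).
Proof.
move=> le1 le2 z5 z6 /and5P[st1 st2 st3 st4 st5].
apply: (wp_step (Q1 := fun s' => ivar s' z = 1%N)).
  by apply: wp_iset; rewrite /= updE eqxx.
move=> s1 fr1 z1.
have e11 := frame_iexp fr1 st1; have e12 := frame_iexp fr1 st2.
apply: (wp_for (I := fun i s' => ivar s' z = (2 ^ (i * ieval s e2))%N)) => //=.
- by rewrite e11.
- by rewrite orbF eq_sym.
- by rewrite updE (negPf z5) z1.
- move=> i s2 ib fr2 si vi.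
  have e22 := frame_iexp fr2 st4.
  apply: (wp_for (I := fun j s' => ivar s' z = (2 ^ (i * ieval s e2 + j))%N)) => //=.
  + by rewrite e22 e12.
  + by rewrite eq_sym.
  + by rewrite updE (negPf z6) vi addn0.
  + move=> j s3 jb fr3 sj vj; apply: wp_iset => /=.
    by rewrite !updE (negPf z6) eqxx vj addnS expnS mul2n addnn.
  + by move=> s3 fr3; rewrite updE (negPf z5) e22 e12 => ->; rewrite mulSn addnC.
- by move=> s2 fr2; rewrite e11.
Qed.

Definition gof s := GState (iarr s 9) (rarr s 4) (rarr s 5) (rarr s 6).

Lemma wp_est x o (op : nat) s (g := gof s) :
  ieval s o = op -> stable_iexp (prog_est x o) o ->
  wp (prog_est x o) s (fun s' => rvar s' x = est (iarr s 6) (iarr s 1) g op).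
Proof.
move=> eo so; apply/wp_seq/wp_rset/wp_if => /= h.
  apply: wp_rset => /=; rewrite /est /= updE eqxx.
  move: h; rewrite updE eqxx !(@frame_iexp _ (prog_est x o) o s) //; last by split=> //= y /norP[ny _]; rewrite updE (negPf ny).
  rewrite eo; by case: ltP; lra.
apply: wp_skip => /=; rewrite /est /= updE eqxx.
move: h; rewrite updE eqxx !(@frame_iexp _ (prog_est x o) o s) //; last by split=> //= y /norP[ny _]; rewrite updE (negPf ny).
by rewrite eo; case: ltP => //; lra.
Qed.

Lemma wp_forced s (g := gof s)
    (NK := ivar s 7) (fl := fun o => iarr s 7 o != 0%N) :
  (NK <= Z)%N -> ivar s 20 = NK ->
  wp prog_forced s (fun s' =>
    (ivar s' 20 = NK /\ forall o, waiting NK g o -> ~~ fl o) \/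
    next_forced NK (iarr s 8) fl g (ivar s' 20)).
Proof.
move=> nkZ b0.
pose nf i r := [/\ (r < i)%N, waiting NK g r, fl r &
  forall o, (o < i)%N -> waiting NK g o -> fl o -> (iarr s 8 r <= iarr s 8 o)%N].
apply: (wp_for (I := fun i s' =>
   (ivar s' 20 = NK /\ forall o, (o < i)%N -> waiting NK g o -> ~~ fl o) \/
    nf i (ivar s' 20))) => //=.
- by left.
- move=> i s' iN fr si Ii.
  have e7 := frame_ivar fr (x := 7%N) isT; have e8 := frame_iarr fr (a := 8%N) isT.
  have e9 := frame_iarr fr (a := 9%N) isT; have e7a := frame_iarr fr (a := 7%N) isT.
  have wi : waiting NK g i = (iarr s 9 i == 0)%N by rewrite /waiting iN.
  have le_i o : (o < i.+1)%N -> o = i \/ (o < i)%N.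
    by rewrite ltnS leq_eqVlt => /orP[/eqP|]; auto.
  apply: wp_if => /=; rewrite si e7 e8 e9 e7a -/NK addn1 => h.
    apply: wp_iset => /=; rewrite updE /= si; right.
    case/andP: h => /andP[fi pi] h.
    split; rewrite ?wi //; [by rewrite -leqn0|by rewrite /fl -lt0n|].
    move=> o /le_i[->|oi wo fo]; first by rewrite leqnn.
    case: Ii => [[_ /(_ _ oi wo)]|[_ wr _ le_r]]; first by rewrite fo.
    move: h; rewrite negb_and -!ltnNge => /orP[|lt].
      by have [rN _] := andP wr; rewrite ltnNge rN.
    by apply: leq_trans (ltnW lt) (le_r _ oi wo fo).
  apply: wp_skip => /=; case: Ii => [[e no]|[ri wr fr' le_r]].
    left; split=> // o /le_i[->|oi wo]; last exact: no.
    rewrite wi => pi; apply/negP; rewrite /fl -lt0n => fi; move: h.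
    by rewrite fi e ltnn (eqP pi).
  right; split=> //; first exact: leq_trans ri (leqnSn _).
  move=> o /le_i[->|oi]; last exact: le_r.
  rewrite wi => pi fi; move: h; rewrite /fl in fi; rewrite lt0n fi (eqP pi) leqnn /=.
  by have [rN _] := andP wr; rewrite rN /= negbK.
- move=> s' fr [[-> no]|[_ wr fr' le_r]].
    by left; split=> // o wo; apply: no => //; case/andP: wo.
  by right; split=> // o wo fo; apply: le_r => //; case/andP: wo.
Qed.

Definition noforced NK g fl := forall o, waiting (R := R) NK g o -> ~~ fl o.

Lemma wp_small s (g := gof s) (NK := ivar s 7) (fl := fun o => iarr s 7 o != 0%N)
    (nxt := next_forced NK (iarr s 8) fl g) (es := est (iarr s 6) (iarr s 1) g) :
  (NK <= Z)%N ->
  (ivar s 20 = NK /\ noforced NK g fl) \/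
    (nxt (ivar s 20) /\ rvar s 5 = es (ivar s 20)) ->
  (exists o, waiting NK g o) ->
  wp prog_small s (fun s' => rvar s' 5 = es (ivar s' 20) /\
    selected NK (iarr s 6) (iarr s 1) (iarr s 8) fl g (ivar s' 20)).
Proof.
move=> nkZ b0 [w ww].
(* An admissible selection during the scan. The alternative of an empty selection is excluded at the
   end by the waiting operation [w]. *)
pose cand b := nxt b \/ [/\ waiting NK g b, ~~ fl b &
   noforced NK g fl \/ exists2 r, nxt r & es b < es r].
have candN b : cand b -> (b < NK)%N by case=> [[/andP[]]|[/andP[]]].
apply: (wp_for (I := fun i s' =>
   [/\ ivar s' 20 = NK, noforced NK g fl & forall z, (z < i)%N -> waiting NK g z -> fl z]
   \/ [/\ rvar s' 5 = es (ivar s' 20), cand (ivar s' 20) &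
        forall z, (z < i)%N -> waiting NK g z -> ~~ fl z -> es (ivar s' 20) <= es z])) => //=.
- by case: b0 => [[? ?]|[? ?]]; [left|right]; split=> //; left.
- move=> i s' iN fr si Ii.
  have [[[e7 e8] e9] e7a] := (frame_ivar fr (x := 7%N) isT, frame_iarr fr (a := 8%N) isT,
    frame_iarr fr (a := 9%N) isT, frame_iarr fr (a := 7%N) isT).
  have eg : gof s' = g.
    rewrite /g /gof e9 (frame_rarr fr (a := 4%N)) // (frame_rarr fr (a := 5%N)) //.
    by rewrite (frame_rarr fr (a := 6%N)).
  have wi : waiting NK g i = (iarr s 9 i == 0)%N by rewrite /waiting iN.
  have le_i o : (o < i.+1)%N -> o = i \/ (o < i)%N.
    by rewrite ltnS leq_eqVlt => /orP[/eqP|]; auto.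
  apply: wp_if => /=; rewrite si e9 e7a => h; last first.
    apply: wp_skip => /=.
    have ni : waiting NK g i -> ~~ fl i -> False.
      by rewrite wi /fl negbK => /eqP pi /eqP fi; move: h; rewrite pi fi.
    case: Ii => [[bN nof sm]|[r5 cb sm]]; [left|right]; split=> // z /le_i[->|zi] wz; auto.
  have [fi pi] : ~~ fl i /\ waiting NK g i.
    by case/andP: h; rewrite wi /fl negbK !leqn0.
  apply: (wp_step (wp_est (op := i) _ _)) => [//|//|s2 fr2].
  have f20 := frame_ivar fr2 (x := 20%N) isT; have f7 := frame_ivar fr2 (x := 7%N) isT.
  have f8 := frame_ivar fr2 (x := 8%N) isT; have f5 := frame_rvar fr2 (x := 5%N) isT.
  rewrite eg (frame_iarr fr (a := 6%N)) // (frame_iarr fr (a := 1%N)) // -/(es i) => r6.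
  apply: wp_if => /=; rewrite f20 f7 f5 r6 e7 addn1 => h2.
    apply: wp_skip => /=; rewrite !updE /= f20 f5; case: Ii => [[bN _ _]|[r5 cb sm]].
      by move: h2; rewrite bN -/NK ltnn.
    right; split=> // z /le_i[->|zi] wz fz; last exact: sm.
    by rewrite -r5; case/andP: h2.
  apply/wp_seq/wp_iset/wp_rset => /=; rewrite !updE /= r6 f8 si; right.
  case: Ii => [[bN nof sm]|[r5 cb sm]].
    split=> //; first by right; split=> //; left.
    by move=> z /le_i[->|zi] wz fz //; rewrite sm in fz.
  have lt_ib : es i < es (ivar s' 20).
    by move: h2; rewrite -r5 negb_and (candN _ cb) /= -ltNge.
  split=> //.
    right; split=> //; case: cb => [nb|[wb fb [nof|[r nr ltr]]]]; first by right; exists (ivar s' 20).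
      by left.
    by right; exists r => //; apply: lt_trans ltr.
  move=> z /le_i[->|zi] wz fz //; apply: le_trans (ltW lt_ib) _; exact: sm.
- move=> s' fr [[bN nof sm]|[r5 cb sm]].
    have [wN _] := andP ww.
    by have := nof _ ww; rewrite sm.
  split=> //; rewrite /selected; case: cb => [nb|[wb fb alt]].
    have [_ fb _] := nb; rewrite fb; split=> // z wz; apply: sm => //; by case/andP: wz.
  by rewrite (negPf fb); split=> // z wz; apply: sm => //; case/andP: wz.
Qed.

Lemma wp_select s (g := gof s) (NK := ivar s 7) (fl := fun o => iarr s 7 o != 0%N) :
  (NK <= Z)%N -> (exists o, waiting NK g o) ->
  wp prog_select s (fun s' =>
    rvar s' 5 = est (iarr s 6) (iarr s 1) g (ivar s' 20) /\
    selected NK (iarr s 6) (iarr s 1) (iarr s 8) fl g (ivar s' 20)).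
Proof.
move=> nkZ ww; apply/wp_seq/wp_iset.
set s0 := State _ _ _ _.
apply: (wp_step (wp_forced (s := s0) _ _)) => // s1 fr1 h1.
apply: (wp_step (wp_est (op := ivar s1 20) _ _)) => // s2 fr2 r5.
have e a : ~~ writes_iarr prog_forced a -> ~~ writes_iarr (prog_est 5 vbest) a ->
  iarr s2 a = iarr s a by move=> h h'; rewrite (frame_iarr fr2) // (frame_iarr fr1).
have er a : ~~ writes_rarr prog_forced a -> ~~ writes_rarr (prog_est 5 vbest) a ->
  rarr s2 a = rarr s a by move=> h h'; rewrite (frame_rarr fr2) // (frame_rarr fr1).
have eg : gof s2 = g by rewrite /g /gof e // !er.
have e7 : ivar s2 7 = NK by rewrite (frame_ivar fr2) // (frame_ivar fr1).
have e20 : ivar s2 20 = ivar s1 20 by rewrite (frame_ivar fr2).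
have eg1 : gof s1 = g.
  rewrite /g /gof (frame_iarr fr1 (a := 9%N)) // (frame_rarr fr1 (a := 4%N)) //.
  by rewrite (frame_rarr fr1 (a := 5%N)) // (frame_rarr fr1 (a := 6%N)).
have := @wp_small s2; rewrite eg e7 e20 !e //; apply=> //.
case: h1 => [[h nof]|nx]; [left|right]; split=> //.
by rewrite r5 eg1 (frame_iarr fr1 (a := 6%N)) // (frame_iarr fr1 (a := 1%N)).
Qed.

Lemma wp_place s (g := gof s) (b := ivar s 20) (NK := ivar s 7) :
  rvar s 5 = est (iarr s 6) (iarr s 1) g b ->
  wp prog_place s (fun s' =>
    gof s' = place (rarr s 1) (iarr s 6) (iarr s 1) g b /\
    rvar s' 7 = Num.max (rvar s 7) (est (iarr s 6) (iarr s 1) g b + rarr s 1 b)).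
Proof.
move=> r5; apply/wp_seq/wp_rset/wp_seq/wp_raset/wp_seq/wp_raset/wp_seq/wp_raset/wp_seq/wp_iaset/wp_if => /= h.
  apply: wp_rset; split; first by rewrite /gof /= !updE /= /upd2 !updE /= r5.
  move: h; rewrite /= !updE /= r5 => h; rewrite maxC; case: ltP => //; lra.
apply: wp_skip; split; first by rewrite /gof /= !updE /= /upd2 !updE /= r5.
by move: h; rewrite /= !updE /= r5 => h; case: ltP => //; lra.
Qed.

(** The invariant [P] is a parameter, so one run carries both feasibility and the makespan bound
    that is known for one candidate only. *)
Lemma wp_greedy s (NK := ivar s 7) (fl := fun o => iarr s 7 o != 0%N)
    (P : nat -> gstate R -> R -> Prop) :
  (NK <= Z)%N -> P 0%N (gof s) 0 ->
  (forall c g mk, (c < NK)%N -> P c g mk -> exists o, waiting NK g o) ->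
  (forall c g mk o, (c < NK)%N -> P c g mk ->
     selected NK (iarr s 6) (iarr s 1) (iarr s 8) fl g o ->
     P c.+1 (place (rarr s 1) (iarr s 6) (iarr s 1) g o)
       (Num.max mk (est (iarr s 6) (iarr s 1) g o + rarr s 1 o))) ->
  wp prog_greedy s (fun s' => P NK (gof s') (rvar s' 7)).
Proof.
move=> nkZ P0 Pw PS; apply/wp_seq/wp_rset.
set s0 := State _ _ _ _.
apply: (wp_for (I := fun i s' => P i (gof s') (rvar s' 7))) => //=.
  by rewrite updE /= rmorph0.
move=> c s1 cN fr sc Pc.
have [e7 e7a] := (frame_ivar fr (x := 7%N) isT, frame_iarr fr (a := 7%N) isT).
have e8 := frame_iarr fr (a := 8%N) isT; have e6 := frame_iarr fr (a := 6%N) isT.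
have e1 := frame_iarr fr (a := 1%N) isT; have r1 := frame_rarr fr (a := 1%N) isT.
apply: (wp_step (wp_select (s := s1) _ _)); rewrite ?e7 //; first exact: Pw Pc.
rewrite e7a e8 e6 e1 /= -/NK -/fl => s2 fr2 [r5 sel].
have eg : gof s2 = gof s1.
  rewrite /gof (frame_iarr fr2 (a := 9%N)) // (frame_rarr fr2 (a := 4%N)) //.
  by rewrite (frame_rarr fr2 (a := 5%N)) // (frame_rarr fr2 (a := 6%N)).
have e := frame_iarr fr2; have er := frame_rarr fr2.
apply: wp_conseq (wp_place _) _; rewrite eg (e 6%N) // (e 1%N) // ?(er 1%N) // ?e6 ?e1 //.
move=> s3 fr3 [eg3 em]; rewrite -[gof _]/(gof s3) [X in P _ _ X]em eg3 (frame_rvar fr2 (x := 7%N)) // r1.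
exact: PS.
Qed.

End Specs.
End Params.

Lemma wp_E (R : archiRealFieldType) Z (s : state R)
    (E := `|Num.ceil (rvar s 0)^-1|%N) :
  0 < rvar s 0 -> (E <= Z)%N -> ivar s 1 = 0%N -> rvar s 1 = 0 ->
  wp Z prog_E s (fun s' => ivar s' 1 = E).
Proof.
move=> eps0 EZ i1 r1.
have ceil0 : 0 <= Num.ceil (rvar s 0)^-1.
  by rewrite ltW // ceil_gt0 invr_gt0.
(* Translates the loop guard, a comparison of multiples of [eps] with [1], into the count of
   iterations. *)
have Elt i : (i < E)%N = (i%:R * rvar s 0 < 1).
  by rewrite -ltr_pdivlMr // div1r pmulrn -ceil_gt_int -ltz_nat /E gez0_abs.
apply: (wp_while (nb := E) (I := fun i s' => ivar s' 1 = i /\ rvar s' 1 = i%:R * rvar s 0)) => //.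
- by rewrite mul0r.
- move=> i s' iE fr [ei er]; split; first by rewrite /= rmorph1 er -ltNge -Elt.
  apply/wp_seq/wp_rset/wp_iset => /=; rewrite !updE /= ei er addn1.
  by rewrite (frame_rvar fr (x := 0%N)) // -natr1 mulrDl mul1r.
- by move=> s' fr [ei er]; split; rewrite //= rmorph1 er -ltNge -Elt ltnn.
Qed.

(** * Correctness of parameters, ranks, classes and decoding *)

Section Specs.
Variables m k : nat.
Variables (R : realFieldType) (Z : nat).
Implicit Type s : state R.
Local Notation wp := (@wp R Z).

Lemma wp_params s (E := ivar s 1) :
  (paramN m k E <= Z)%N -> (0 < paramQ m k E)%N ->
  wp (prog_params m k) s (fun s' => [/\ ivar s' 2 = paramQ m k E, ivar s' 3 = paramM m k E,
     ivar s' 22 = ((k + 2) * paramQ m k E)%N & ivar s' 4 = paramN m k E]).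
Proof.
move=> NZ Q0; set Q := paramQ m k E; set M := paramM m k E.
have exlt x : (x < 2 ^ x)%N by apply: ltn_expl.
have M0 : (0 < M)%N by rewrite expn_gt0.
have eM : (Q * (Q + (k + 4)) < M)%N by apply: exlt.
have eN : (4 * M * M < paramN m k E)%N by apply: exlt.
have MM : (4 * M <= 4 * M * M)%N by rewrite leq_pmulr.
have QM : (Q + (k + 4) <= Q * (Q + (k + 4)))%N by rewrite leq_pmull.
apply: (wp_step (Q1 := fun s' => ivar s' 2 = Q)).
  by apply: wp_iset; rewrite /= updE /= ieval_imulc.
move=> s1 fr1 q1; apply: (wp_step (wp_pow2 _ _ _ _ _)) => //=; try by rewrite q1; lia.
rewrite q1 -/M => s2 fr2 M2.
have q2 : ivar s2 2 = Q by rewrite (frame_ivar fr2).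
apply: (wp_step (Q1 := fun s' => ivar s' 22 = (k + 2) * Q)%N).
  by apply: wp_iset; rewrite /= updE /= ieval_imulc /= q2.
move=> s3 fr3 L3; have M3 : ivar s3 3 = M by rewrite (frame_ivar fr3).
apply: wp_conseq (wp_pow2 _ _ _ _ _) _ => //=; try by rewrite M3; lia.
rewrite M3 => s4 fr4 ->.
rewrite (frame_ivar fr4 (x := 2%N)) // (frame_ivar fr4 (x := 3%N)) //.
rewrite (frame_ivar fr4 (x := 22%N)) // (frame_ivar fr3 (x := 2%N)) //; split=> //.
Qed.

Lemma wp_data s (n := ivar s 0) (p := rarr s 0)
    (P := fun i => \sum_(j < k) p (i * k + j)%N) :
  (n <= Z)%N -> (k <= Z)%N ->
  wp (prog_data k) s (fun s' => [/\ ivar s' 7 = (n * k)%N,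
     rvar s' 2 = \sum_(i < n) P i,
     forall i, (i < n)%N -> rarr s' 2 i = P i,
     forall o, (o < n * k)%N -> rarr s' 1 o = p o &
     forall o, (o < n * k)%N -> iarr s' 1 o = (o %/ k)%N]).
Proof.
move=> nZ kZ.
apply: (wp_step (Q1 := fun s' => ivar s' 7 = n * k)%N).
  by apply: wp_iset; rewrite /= updE /= ieval_imulc mulnC.
move=> s1 fr1 e7.
apply/wp_seq/wp_iset/wp_seq/wp_rset => /=.
set s2 := State _ _ _ _.
apply: (wp_for (I := fun i s' => [/\ ivar s' 8 = (i * k)%N,
     rvar s' 2 = \sum_(i' < i) P i',
     forall i', (i' < i)%N -> rarr s' 2 i' = P i',
     forall o, (o < i * k)%N -> rarr s' 1 o = p o &
     forall o, (o < i * k)%N -> iarr s' 1 o = (o %/ k)%N])) => //=.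
- by rewrite updE /= (frame_ivar fr1).
- by rewrite !updE /= big_ord0 rmorph0; split.
- rewrite updE /= (frame_ivar fr1) // -/n => i s3 ib fr3 si [I8 IV IP Ip Ij].
  have e0 : rarr s3 0 = p by rewrite (frame_rarr fr3) // /s2 /= (frame_rarr fr1).
  apply/wp_seq/wp_raset; rewrite /= si rmorph0.
  set s4 := State _ _ _ _.
  apply: (wp_step (Q1 := fun s' => [/\ ivar s' 8 = (i * k + k)%N,
     rarr s' 2 i = P i, forall i', (i' < i)%N -> rarr s' 2 i' = P i',
     forall o, (o < i * k + k)%N -> rarr s' 1 o = p o &
     forall o, (o < i * k + k)%N -> iarr s' 1 o = (o %/ k)%N])).
    apply: (wp_for (I := fun j s' => [/\ ivar s' 8 = (i * k + j)%N,
     rarr s' 2 i = \sum_(j' < j) p (i * k + j')%N,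
     forall i', (i' < i)%N -> rarr s' 2 i' = P i',
     forall o, (o < i * k + j)%N -> rarr s' 1 o = p o &
     forall o, (o < i * k + j)%N -> iarr s' 1 o = (o %/ k)%N])) => //=.
    + rewrite addn0 /upd2 !updE /= big_ord0 updE eqxx; split=> // i' i'i.
      by rewrite updE ltn_eqF // IP.
    + move=> j s5 jk fr5 sj [J8 JP JP' Jp Jj].
      have f0 : rarr s5 0 = p by rewrite (frame_rarr fr5) //= /upd2 updE /= e0.
      have f9 : ivar s5 9 = i by rewrite (frame_ivar fr5) //= /upd2 updE.
      apply/wp_seq/wp_raset/wp_seq/wp_iaset/wp_seq/wp_raset/wp_iset => /=.
      rewrite /upd2 !updE /= f0 J8 f9 !updE /= addn1 addnS; split=> //.
      * by rewrite eqxx JP big_ord_recr.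
      * by move=> i' i'i; rewrite updE ltn_eqF // JP'.
      * move=> o; rewrite ltnS updE; case: eqP => [->//|/eqP oe le]; apply: Jp.
        by rewrite ltn_neqAle oe.
      * move=> o; rewrite ltnS updE; case: eqP => [-> _|/eqP oe le].
          by rewrite divnMDl ?divn_small ?addn0 //; lia.
        by apply: Jj; rewrite ltn_neqAle oe.
  move=> s5 fr5 [J8 JP JP' Jp Jj]; apply: wp_rset.
  rewrite /= !updE /= J8 (frame_ivar fr5 (x := 9%N)) //= si JP.
  rewrite (frame_rvar fr5 (x := 2%N)) //= IV big_ord_recr mulSn (addnC k); split=> //.
  by move=> i'; rewrite ltnS leq_eqVlt => /orP[/eqP->|]; auto.
- move=> s3 fr3; rewrite updE /= (frame_ivar fr1) // -/n => -[I8 IV IP Ip Ij].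
  by split=> //; rewrite (frame_ivar fr3) //= updE.
Qed.

(** Longer jobs come first, and the smaller index breaks ties, so ranks are distinct. *)
Definition prec (P : nat -> R) i' i := (P i <= P i') && ~~ ((P i' <= P i) && (i <= i')%N).

Lemma wp_rank s (n := ivar s 0) (P := rarr s 2) :
  (n <= Z)%N ->
  wp prog_rank s (fun s' => forall i, (i < n)%N ->
    iarr s' 2 i = \sum_(i' < n) prec P i' i)%N.
Proof.
move=> nZ.
apply: (wp_for (I := fun i s' => forall i', (i' < i)%N ->
   iarr s' 2 i' = \sum_(j < n) prec P j i')%N) => //=.
move=> i s1 ib fr si I1; apply/wp_seq/wp_iaset => /=; rewrite si.
set s2 := State _ _ _ _.
have e0 : ivar s1 0 = n by rewrite (frame_ivar fr).
have e2 : rarr s1 2 = P by rewrite (frame_rarr fr).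
apply: (wp_for (I := fun j s' => iarr s' 2 i = \sum_(j' < j) prec P j' i /\ forall i', (i' < i)%N ->
   iarr s' 2 i' = \sum_(j < n) prec P j i')%N) => //=.
- by rewrite e0.
- by rewrite /upd2 updE /= updE eqxx big_ord0; split=> // i' i'i; rewrite updE ltn_eqF // I1.
- move=> j s3 jb fr3 sj [J1 J2].
  have f9 : ivar s3 9 = i by rewrite (frame_ivar fr3).
  have f2 : rarr s3 2 = P by rewrite (frame_rarr fr3).
  apply: wp_if => /=; rewrite f9 sj f2 -/(prec P j i) => h.
    apply: wp_iaset; rewrite /= f9 /upd2 updE /= updE eqxx big_ord_recr /= h J1.
    by split=> // i' i'i; rewrite updE ltn_eqF // J2.
  by apply: wp_skip; rewrite /= big_ord_recr /= (negPf h) addn0.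
- move=> s3 fr3; rewrite e0 => -[J1 J2] i'.
  by rewrite ltnS leq_eqVlt => /orP[/eqP->|]; auto.
Qed.

(** A division-free form of [c] being the first [e] binary digits of [x / y]. Both inequalities are
    weak, which admits [x = y] (all digits one) and [y = 0]. *)
Definition bitsval e (x y : R) (c : nat) :=
  (c < 2 ^ e)%N /\ c%:R * y <= 2%:R ^+ e * x <= c.+1%:R * y.

Lemma wp_bits x y e s (rx := reval s x) (ry := reval s y) (ee := ieval s e) :
  0 <= rx <= ry -> (ee <= Z)%N ->
  (forall v, reval (State (ivar s) (upd (rvar s) 4 v) (iarr s) (rarr s)) y = ry) ->
  stable_iexp (prog_bits x y e) e ->
  wp (prog_bits x y e) s (fun s' => exists2 c, bitsval ee rx ry c &
    ivar s' 11 = (ivar s 11 * 2 ^ ee + c)%N).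
Proof.
move=> /andP[x0 xy] eZ yv st; apply/wp_seq/wp_rset/wp_seq/wp_rset => /=.
rewrite yv.
set s0 := State _ _ _ _.
have ev : ieval s0 e = ee.
  apply: (frame_iexp (c := prog_bits x y e)) => //; split=> //= r.
  by rewrite negb_or negb_or !updE => /and3P[/negPf -> /negPf ->].
have half : ratr (1 / 2%:R) = 2^-1 :> R by rewrite div1r fmorphV /= ratr_nat.
(* Number variable [3] holds [y] halved [i] times, and variable [4] the remainder of [x] after the
   digits found so far. *)
apply: (wp_for (I := fun i s' => exists c, [/\ (c < 2 ^ i)%N,
   ivar s' 11 = (ivar s 11 * 2 ^ i + c)%N, 2%:R ^+ i * rvar s' 3 = ry,
   rvar s' 4 = rx - c%:R * rvar s' 3 & 0 <= rvar s' 4 <= rvar s' 3])) => //.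
- by rewrite ev.
- by apply: stable_iexp_sub st.
- by exists 0%N; rewrite /= !updE /= muln1 addn0 mul1r mul0r subr0 x0.
- move=> i s1 ib fr si [c [ci I11 Iy Ix /andP[I0 I1]]].
  apply/wp_seq/wp_rset/wp_seq/wp_iset/wp_if => /=; rewrite !updE /=.
    move=> h; apply/wp_seq/wp_rset/wp_iset => /=; exists (2 * c).+1; rewrite !updE /= ?updE /=.
    move: h; rewrite !half => h; split=> //.
    + by rewrite expnS; lia.
    + by rewrite I11 expnS; lia.
    + by rewrite exprS -Iy; field.
    + by rewrite Ix -[(2 * c).+1%:R]natr1 natrM; field.
    + apply/andP; split; lra.
  move=> h; apply/wp_skip => /=; exists (2 * c)%N; rewrite !updE /= ?updE /=.
  move: h; rewrite -ltNge !half => h; split=> //.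
  + by rewrite expnS; lia.
  + by rewrite I11 expnS; lia.
  + by rewrite exprS -Iy; field.
  + by rewrite Ix natrM; field.
  + apply/andP; split; lra.
- move=> s1 fr; rewrite ev => -[c [ci I11 Iy Ix /andP[I0 I1]]].
  exists c => //; split=> //.
  have p2 : (0 : R) < 2%:R ^+ ee by rewrite exprn_gt0 // ltr0n.
  have -> : 2%:R ^+ ee * rx = 2%:R ^+ ee * rvar s1 4 + c%:R * ry by rewrite Ix -Iy; ring.
  have := ler_wpM2l (ltW p2) I1; have := mulr_ge0 (ltW p2) I0; rewrite Iy -natr1.
  by move=> a1 a2; apply/andP; split; lra.
Qed.

Fixpoint pack Q (f : nat -> nat) j : nat :=
  if j is j'.+1 then (pack Q f j' * 2 ^ Q + f j')%N else 0%N.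

Lemma pack_ext Q f f' j : (forall i, (i < j)%N -> f i = f' i) -> pack Q f j = pack Q f' j.
Proof.
by elim: j => //= j IH h; rewrite IH ?h // => i ij; apply: h; rewrite ltnW.
Qed.

Lemma pack_lt Q f j : (forall i, (i < j)%N -> (f i < 2 ^ Q)%N) -> (pack Q f j < 2 ^ (j * Q))%N.
Proof.
elim: j => //= j IH h; have := IH (fun i ij => h i (ltnW ij)); have := h j (ltnSn j).
rewrite mulSn expnD; move: (pack _ _ _) (2 ^ Q)%N (2 ^ _)%N (f j) => a b c d; nia.
Qed.

(** Uniqueness of digits in base [2 ^ Q]: jobs with the same class number have the same leading
    digits at every stage. *)
Lemma pack_inj Q f f' j :
  (forall i, (i < j)%N -> (f i < 2 ^ Q)%N) -> (forall i, (i < j)%N -> (f' i < 2 ^ Q)%N) ->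
  pack Q f j = pack Q f' j -> forall i, (i < j)%N -> f i = f' i.
Proof.
elim: j => //= j IH h h' e.
have e2 : f j = f' j.
  have := congr1 (modn^~ (2 ^ Q)%N) e; rewrite !modnMDl !modn_small //; [exact: h'|exact: h].
have e1 : pack Q f j = pack Q f' j.
  by apply/eqP; rewrite -(eqn_pmul2r (m := 2 ^ Q)) ?expn_gt0 //; apply/eqP; lia.
move=> i; rewrite ltnS leq_eqVlt => /orP[/eqP->//|ij].
by apply: IH => // l lj; [apply: h|apply: h']; rewrite ltnW.
Qed.

Lemma wp_class s (n := ivar s 0) (p := rarr s 1) (P := rarr s 2) (Q := ivar s 2) :
  (n <= Z)%N -> (k <= Z)%N -> (Q <= Z)%N ->
  (forall i j, (i < n)%N -> (j < k)%N -> 0 <= p (i * k + j)%N <= P i) ->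
  wp (prog_class k) s (fun s' => forall i, (i < n)%N -> exists2 f,
    forall j, (j < k)%N -> bitsval Q (p (i * k + j)%N) (P i) (f j) &
    iarr s' 3 i = pack Q f k).
Proof.
move=> nZ kZ QZ pP; apply/wp_seq/wp_iset.
pose good i v := exists2 f, forall j, (j < k)%N -> bitsval Q (p (i * k + j)%N) (P i) (f j) &
    v = pack Q f k.
apply: (wp_for (I := fun i s' => ivar s' 8 = (i * k)%N /\ forall i', (i' < i)%N ->
    good i' (iarr s' 3 i'))) => //=.
- rewrite updE /= -/n => i s1 ib fr si [I8 I3].
  have e1 : rarr s1 1 = p by rewrite (frame_rarr fr).
  have e2 : rarr s1 2 = P by rewrite (frame_rarr fr).
  have e2i : ivar s1 2 = Q by rewrite (frame_ivar fr).
  apply/wp_seq/wp_iset; set s2 := State _ _ _ _.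
  apply: (wp_step (Q1 := fun s' => ivar s' 8 = (i * k + k)%N /\ good i (ivar s' 11))).
    apply: (wp_for (I := fun j s' => ivar s' 8 = (i * k + j)%N /\
      exists2 f, forall l, (l < j)%N -> bitsval Q (p (i * k + l)%N) (P i) (f l) &
        ivar s' 11 = pack Q f j)) => //=.
    + by rewrite !updE /= addn0; split=> //; exists id.
    + move=> j s3 jb fr3 sj [J8 [f Jf J11]].
      have f1 : rarr s3 1 = p by rewrite (frame_rarr fr3).
      have f2 : rarr s3 2 = P by rewrite (frame_rarr fr3).
      have f2i : ivar s3 2 = Q by rewrite (frame_ivar fr3) //= updE.
      have f9 : ivar s3 9 = i by rewrite (frame_ivar fr3) //= updE.
      apply: (wp_step (wp_bits _ _ _ _)) => //=.
      * by rewrite f1 f2 J8 f9; apply: pP.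
      * by rewrite f2i.
      * move=> s4 fr4; rewrite f1 f2 f2i J8 f9 J11 => -[c cb c11].
        apply: wp_iset; rewrite /= !updE /= (frame_ivar fr4) // J8 addn1 addnS; split=> //.
        exists (fun l => if l == j then c else f l).
          move=> l; rewrite ltnS leq_eqVlt => /orP[/eqP->|lj]; first by rewrite eqxx.
          by rewrite ltn_eqF //; apply: Jf.
        rewrite c11 eqxx (@pack_ext Q (fun l => if l == j then c else f l) f j) //.
        by move=> l lj; rewrite ltn_eqF.
  move=> s3 fr3 [J8 J11]; apply: wp_iaset; rewrite /= (frame_ivar fr3 (x := 9%N)) //= !updE /= si J8.
  split; first by rewrite mulSn addnC.
  move=> i'; rewrite /upd2 !updE /= updE ltnS leq_eqVlt => /orP[/eqP->|lt].
    by rewrite eqxx.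
  by rewrite ltn_eqF // (frame_iarr fr3) //; apply: I3.
- by move=> s1 fr [].
Qed.

Lemma wp_decode s (M := ivar s 3) (x := ivar s 12) :
  (4 * M <= Z)%N -> (x <= Z)%N -> (0 < M)%N ->
  wp prog_decode s (fun s' => forall pos, (pos < 4 * M)%N ->
    iarr s' 4 pos = (x %/ M ^ pos) %% M)%N.
Proof.
move=> MZ xZ M0; apply/wp_seq/wp_iset.
apply: (wp_for (I := fun i s' => ivar s' 13 = (x %/ M ^ i)%N /\ forall pos, (pos < i)%N ->
    iarr s' 4 pos = (x %/ M ^ pos) %% M)%N) => //=.
- by rewrite divn1.
- move=> i s1 ib fr si [I13 I4].
  have e3 : ivar s1 3 = M by rewrite (frame_ivar fr).
  apply/wp_seq/wp_iset; set s2 := State _ _ _ _; set y := (x %/ M ^ i)%N in I13.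
  apply: (wp_step (Q1 := fun s' => ivar s' 13 = y %% M /\ ivar s' 15 = y %/ M)%N).
    apply: (wp_while (nb := (y %/ M)%N) (I := fun q s' =>
       ivar s' 13 = (y - q * M)%N /\ ivar s' 15 = q)).
    + by apply: leq_trans (leq_div _ _) _; apply: leq_trans (leq_div _ _) _.
    + by rewrite /= !updE /= subn0.
    + move=> q s3 qy fr3 [J13 J15].
      have f3 : ivar s3 3 = M by rewrite (frame_ivar fr3).
      have : (q.+1 * M <= y)%N by rewrite -leq_divRL.
      rewrite /= J13 f3 => le; split; first by nia.
      by apply/wp_seq/wp_iset/wp_iset; rewrite /= !updE /= J13 J15 f3 addn1; split=> //; nia.
    + move=> s3 fr3 [J13 J15]; have f3 : ivar s3 3 = M by rewrite (frame_ivar fr3).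
      rewrite /= f3 J13 J15; have := divn_eq y M; have := ltn_pmod y M0 => h1 h2.
      by split; [rewrite -ltnNge; nia|split=> //; nia].
  move=> s3 fr3 [J13 J15].
  apply/wp_seq/wp_iaset/wp_iset; rewrite /= !updE /= J13 J15; split.
    by rewrite /y -divnMA expnSr.
  move=> pos; rewrite /upd2 !updE /= updE (frame_ivar fr3 (x := 14%N)) //= updE /= si.
  rewrite ltnS leq_eqVlt => /orP[/eqP->|lt]; first by rewrite eqxx.
  by rewrite ltn_eqF // (frame_iarr fr3) //; apply: I4.
- by move=> s1 fr [_] h pos ?; apply: h; rewrite updE /= -/M; lia.
Qed.
End Specs.

(** * Correctness of the assignment and of the choice of the best schedule *)

Section Assign.
Variables m k : nat.
Variables (R : realFieldType) (Z : nat).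
Implicit Type s : state R.
Local Notation wp := (@wp R Z).

Definition clamp d := if (m <= d)%N then 0%N else d.

Definition volume s i kap :=
  \sum_(i' < i | (ivar s 16 <= iarr s 2 i')%N && (iarr s 3 i' == kap)) rarr s 2 i'.

Definition shop_ok s i sh :=
  if (iarr s 2 i < ivar s 16)%N then sh = clamp (iarr s 4 (iarr s 2 i))
  else exists2 c, bitsval (ivar s 22) (volume s i (iarr s 3 i)) (rvar s 2) c &
    sh = clamp (iarr s 4 (ivar s 3 + (iarr s 3 i * 2 ^ ivar s 22 + c))).

Definition op_ok s s' i j (o := (i * k + j)%N) :=
  [/\ iarr s' 6 o = (k * iarr s' 5 i + j)%N,
      iarr s' 7 o = (iarr s 2 i < ivar s 16)%N,
      iarr s' 8 o = iarr s 4 (ivar s 3 + ivar s 3 + (k * iarr s 2 i + j)) &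
      [/\ iarr s' 9 o = 0%N, rarr s' 4 (iarr s' 6 o) = 0 & rarr s' 5 i = 0]].

Lemma shop_ok_lt s i sh : (0 < m)%N -> shop_ok s i sh -> (sh < m)%N.
Proof.
move=> m0; have cl d : (clamp d < m)%N by rewrite /clamp; case: (leqP m d).
by rewrite /shop_ok; case: ifP => _; [move=> ->|case=> c _ ->].
Qed.

Lemma volume_bounds s n i kap : (i <= n)%N -> (forall i, (i < n)%N -> 0 <= rarr s 2 i) ->
  0 <= volume s i kap <= \sum_(i < n) rarr s 2 i.
Proof.
move=> ni P0; rewrite /volume sumr_ge0 /=; last first.
  by move=> j _; apply: P0; apply: leq_trans (ltn_ord j) ni.
rewrite (big_ord_widen_cond n (fun j => (ivar s 16 <= iarr s 2 j)%N && (iarr s 3 j == kap)) (rarr s 2)) //.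
by rewrite [leRHS](bigID (fun j : 'I_n => (ivar s 16 <= iarr s 2 j)%N && (iarr s 3 j == kap) && (j < i)%N)) /=
  lerDl sumr_ge0 // => j _; apply: P0.
Qed.

Lemma wp_shop s s1 i (n := ivar s 0) :
  frame (prog_assign m k) s s1 -> ivar s1 9 = i -> (i < n)%N ->
  (ivar s 22 <= Z)%N ->
  (forall i, (i < n)%N -> 0 <= rarr s 2 i) -> rvar s 2 = \sum_(i < n) rarr s 2 i ->
  (forall i', (i' < n)%N -> rarr s1 3 (iarr s 3 i') = volume s i (iarr s 3 i')) ->
  wp (prog_shop m) s1 (fun s' => [/\ shop_ok s i (ivar s' 17),
    ivar s' 18 = (iarr s 2 i < ivar s 16)%N &
    forall i', (i' < n)%N -> rarr s' 3 (iarr s 3 i') = volume s i.+1 (iarr s 3 i')]).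
Proof.
move=> fr si iN LZ P0 VE vi.
have e2 := frame_iarr fr (a := 2%N) isT; have e3 := frame_iarr fr (a := 3%N) isT.
have e4 := frame_iarr fr (a := 4%N) isT; have r2 := frame_rarr fr (a := 2%N) isT.
have e16 := frame_ivar fr (x := 16%N) isT; have e22 := frame_ivar fr (x := 22%N) isT.
have v3 := frame_ivar fr (x := 3%N) isT; have v2 := frame_rvar fr (x := 2%N) isT.
have volS kap : volume s i.+1 kap =
    (if (ivar s 16 <= iarr s 2 i)%N && (iarr s 3 i == kap) then rarr s 2 i else 0) + volume s i kap.
  by rewrite /volume big_mkcond big_ord_recr /= addrC -big_mkcond.
pose D := iarr s 4.
apply: (wp_step (Q1 := fun s' => exists d, [/\ ivar s' 17 = d, shop_ok s i (clamp d),
    ivar s' 18 = (iarr s 2 i < ivar s 16)%N &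
    forall i', (i' < n)%N -> rarr s' 3 (iarr s 3 i') = volume s i.+1 (iarr s 3 i')])).
  apply: wp_if => /=; rewrite si e2 e16 addn1 => h.
    apply/wp_seq/wp_iset/wp_iset => /=; exists (D (iarr s 2 i)).
    rewrite !updE /= si e2 e4 h; split=> //; first by rewrite /shop_ok h.
    by move=> i' i'n; rewrite vi // volS leqNgt h add0r.
  apply/wp_seq/wp_iset; set s2 := State _ _ _ _.
  have bI : 0 <= volume s i (iarr s 3 i) <= \sum_(i < n) rarr s 2 i.
    by apply: volume_bounds => //; apply: ltnW.
  apply: (wp_step (wp_bits _ _ _ _)) => //=.
  - by rewrite updE /= si e3 vi // v2 VE.
  - by rewrite updE /= e22.
  rewrite !updE /= si e3 vi // v2 e22 => s3 fr3 [c cb c11].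
  apply/wp_seq/wp_iset/wp_seq/wp_raset/wp_iset => /=.
  exists (D (ivar s 3 + (iarr s 3 i * 2 ^ ivar s 22 + c))%N).
  rewrite !updE /= ?updE /= !(frame_ivar fr3 (x := 3%N)) //= !(frame_iarr fr3) //= updE /= v3 c11 e4.
  rewrite (negPf h); split=> //.
    by rewrite /shop_ok (negPf h); exists c.
  move=> i' i'n; rewrite /upd2 !updE /= e3 (frame_ivar fr3 (x := 9%N)) //= !updE /= si.
  rewrite !(frame_rarr fr3) //= r2 volS leqNgt h /= (eq_sym (iarr s 3 i)).
  case: eqP => [->|_]; first by rewrite vi // addrC.
  by rewrite add0r vi.
move=> s2 fr2 [d [v17 so v18 vv]].
apply: wp_if => /=; rewrite v17 => h.
  by apply: wp_iset; rewrite /= !updE /=; split=> //; move: so; rewrite /clamp h.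
by apply: wp_skip; rewrite v17; split=> //; move: so; rewrite /clamp (negPf h).
Qed.

Lemma wp_assign s (n := ivar s 0) : (0 < k)%N ->
  (n <= Z)%N -> (k <= Z)%N -> (ivar s 22 <= Z)%N ->
  (forall i, (i < n)%N -> 0 <= rarr s 2 i) -> rvar s 2 = \sum_(i < n) rarr s 2 i ->
  wp (prog_assign m k) s (fun s' => forall i, (i < n)%N ->
     shop_ok s i (iarr s' 5 i) /\ forall j, (j < k)%N -> op_ok s s' i j).
Proof.
move=> k0 nZ kZ LZ P0 VE.
apply: (wp_step (Q1 := fun s' => forall i, (i < n)%N -> rarr s' 3 (iarr s 3 i) = 0)).
  apply: (wp_for (I := fun i s' => forall i', (i' < i)%N -> rarr s' 3 (iarr s 3 i') = 0)) => //=.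
  move=> i s1 ib fr si I1; apply/wp_raset => /= i'.
  rewrite /upd2 !updE /= updE si (frame_iarr fr) //.
  case: eqP => [_ _|ne]; first by rewrite rmorph0.
  by rewrite ltnS leq_eqVlt => /orP[/eqP e|]; [case: ne; rewrite e|exact: I1].
move=> s0 fr0 z0; apply/wp_seq/wp_iset; set s1 := State _ _ _ _.
have frA1 : frame (prog_assign m k) s s1.
  apply: (@frame_trans _ _ _ s0); first by apply: frame_sub fr0; sub_writes.
  by split=> //= y; rewrite !negb_or updE => /and3P[_ /negPf->].
apply: (wp_for (I := fun i s' => [/\ ivar s' 8 = (i * k)%N,
  forall i', (i' < n)%N -> rarr s' 3 (iarr s 3 i') = volume s i (iarr s 3 i') &
  forall i', (i' < i)%N -> shop_ok s i' (iarr s' 5 i') /\ forall j, (j < k)%N -> op_ok s s' i' j])) => //=.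
- by rewrite updE /= (frame_ivar fr0).
- split=> // i' i'n; first by rewrite z0 // /volume big_ord0.
- move=> i s2 + fr2 si [I8 Iv Io]; rewrite updE /= (frame_ivar fr0) // -/n => iN.
  have frA2 : frame (prog_assign m k) s s2.
    by apply: (frame_trans frA1); apply: frame_sub fr2; sub_writes.
  apply: (wp_step (wp_shop frA2 si iN LZ P0 VE Iv)) => s3 fr3 [so v18 vS].
  have c16 := frame_ivar frA2 (x := 16%N) isT.
  apply/wp_seq/wp_iaset; rewrite /= (frame_ivar fr3 (x := 9%N)) // si.
  set s4 := State _ _ _ _.
  have frA4 : frame (prog_assign m k) s s4.
    apply: (frame_trans frA2); apply: (@frame_trans _ _ _ s3); first by apply: frame_sub fr3; sub_writes.
    by split=> //= a na; rewrite /upd2 updE; case: eqP na => // ->.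
  have s45 i' : (i' < i)%N -> iarr s4 5 i' = iarr s2 5 i'.
    by move=> lt; rewrite /s4 /= /upd2 updE /= updE ltn_eqF // (frame_iarr fr3).
  have op4 i' j' : (i' < i)%N -> (j' < k)%N -> op_ok s s4 i' j'.
    move=> lt jk; have [_ /(_ _ jk) [a1 a2 a3 [a4 a5 a6]]] := Io _ lt.
    by rewrite /op_ok s45 //; split=> //; rewrite /s4 /= /upd2 !updE /= ?(frame_iarr fr3) ?(frame_rarr fr3).
  have s45i : iarr s4 5 i = ivar s3 17 by rewrite /s4 /= /upd2 updE /= updE eqxx.
  apply: (wp_for (I := fun j s' => [/\ ivar s' 8 = (i * k + j)%N,
    forall i' j', (i' < i)%N -> (j' < k)%N -> op_ok s s' i' j' &
    forall j', (j' < j)%N -> op_ok s s' i j'])) => //=.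
  + by rewrite updE /= (frame_ivar fr3) // addn0.
  + move=> j s5 jk fr5 sj [J8 Jo Jj].
    have f5 := frame_iarr fr5 (a := 5%N) isT; have f17 := frame_ivar fr5 (x := 17%N) isT.
    have f9 := frame_ivar fr5 (x := 9%N) isT; have f18 := frame_ivar fr5 (x := 18%N) isT.
    have frA5 : frame (prog_assign m k) s s5.
      by apply: (frame_trans frA4); apply: frame_sub fr5; sub_writes.
    have h2 := frame_iarr frA5 (a := 2%N) isT; have h4 := frame_iarr frA5 (a := 4%N) isT.
    have h3 := frame_ivar frA5 (x := 3%N) isT.
    apply/wp_seq/wp_iaset/wp_seq/wp_iaset/wp_seq/wp_iaset/wp_seq/wp_iaset.
    apply/wp_seq/wp_raset/wp_seq/wp_raset/wp_iset => /=.
    set s6 := ivar_set _ _ _; set o := (i * k + j)%N in J8 *.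
    have g5 : iarr s6 5 = iarr s5 5 by rewrite /s6 /= /upd2 !updE.
    have g6 : iarr s6 6 = upd (iarr s5 6) o (k * iarr s5 5 i + j)%N.
      by rewrite /s6 /= /upd2 !updE /= ieval_imulc /= J8 sj f17 f5 s45i.
    have g7 : iarr s6 7 = upd (iarr s5 7) o (iarr s 2 i < ivar s 16)%N.
      by rewrite /s6 /= /upd2 !updE /= J8 f18 v18.
    have g8 : iarr s6 8 = upd (iarr s5 8) o (iarr s 4 (ivar s 3 + ivar s 3 + (k * iarr s 2 i + j))).
      rewrite /s6 /= /upd2 !updE /= ieval_imulc /= /upd2 ?updE /= ?updE /= J8 sj f9 h2 h3 h4.
      by rewrite (frame_ivar fr3) // si.
    have g9 : iarr s6 9 = upd (iarr s5 9) o 0%N by rewrite /s6 /= /upd2 !updE /= J8.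
    have r4 : rarr s6 4 = upd (rarr s5 4) (iarr s6 6 o) 0.
      by rewrite g6 updE eqxx /s6 /= /upd2 !updE /= ?updE /= ieval_imulc /= J8 eqxx sj f17 f5 s45i rmorph0.
    have r5 : rarr s6 5 = upd (rarr s5 5) i 0.
      by rewrite /s6 /= /upd2 !updE /= f9 rmorph0 (frame_ivar fr3) // si.
    (* Another operation has another position, and a machine or job shared with it is only reset to
       zero once more. *)
    have old i' j' : i' * k + j' != o -> op_ok s s5 i' j' -> op_ok s s6 i' j'.
      move=> /negPf ne [a1 a2 a3 [a4 a5 a6]]; rewrite /op_ok g5 {1}g6 g7 g8 g9 !updE ne.
      split=> //; split=> //; last by rewrite r5 updE; case: eqP.
      by rewrite r4 updE; case: eqP => // _; rewrite g6 updE ne.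
    split; first by rewrite /s6 /= !updE /= J8 addn1 addnS.
      move=> i' j' i'i j'k; apply: old (Jo _ _ i'i j'k); apply/eqP; rewrite /o; nia.
    move=> j'; rewrite ltnS leq_eqVlt => /orP[/eqP->|j'j].
      rewrite /op_ok g5 {1}g6 g7 g8 g9 r4 r5 -/o !updE eqxx.
      by do ?split; rewrite ?eqxx.
    by apply: old (Jj _ j'j); apply/eqP; rewrite /o; lia.
  + move=> s5 fr5 [J8 Jo Jj].
    have f5 := frame_iarr fr5 (a := 5%N) isT.
    split; first by rewrite updE /= J8 mulSn addnC.
      by move=> i' i'n; rewrite (frame_rarr fr5) //= vS.
    move=> i'; rewrite ltnS leq_eqVlt => /orP[/eqP->|i'i].
      by rewrite f5 s45i; split.
    rewrite f5 s45 //; split; first by have [] := Io _ i'i.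
    by move=> j jk; apply: Jo.
- move=> s2 fr2; rewrite updE /= (frame_ivar fr0) // -/n => -[_ _ h] i iN.
  exact: h.
Qed.

(** The first candidate is always kept. A copied schedule is known at the relevant positions only,
    hence the quantification over all arrays that agree there. *)
Lemma wp_keep s (n := ivar s 0) (nk := ivar s 7)
    (Q : (nat -> nat) -> (nat -> R) -> R -> Prop) :
  (n <= Z)%N -> (nk <= Z)%N ->
  (forall sh st, ((0 < ivar s 12)%N -> rvar s 7 <= rvar s 8) ->
     (forall i, (i < n)%N -> sh i = iarr s 5 i) ->
     (forall o, (o < nk)%N -> st o = rarr s 6 o) -> Q sh st (rvar s 7)) ->
  ((0 < ivar s 12)%N -> rvar s 8 <= rvar s 7 -> Q (iarr s 0) (rarr s 0) (rvar s 8)) ->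
  wp prog_keep s (fun s' => Q (iarr s' 0) (rarr s' 0) (rvar s' 8)).
Proof.
move=> nZ nkZ new old; apply: wp_if => /= h.
  by apply: wp_skip; case/andP: h => ? ?; apply: old.
apply/wp_seq/wp_rset; set s0 := State _ _ _ _.
apply: (wp_step (Q1 := fun s' => forall i, (i < n)%N -> iarr s' 0 i = iarr s 5 i)).
  apply: (wp_for (I := fun i s' => forall i', (i' < i)%N -> iarr s' 0 i' = iarr s 5 i')) => //=.
  move=> i s1 ib fr si I1; apply: wp_iaset => /= i'.
  rewrite /upd2 !updE /= updE si (frame_iarr fr) //= ltnS leq_eqVlt => /orP[/eqP->|lt].
    by rewrite eqxx.
  by rewrite ltn_eqF //; apply: I1.
move=> s1 fr1 h1.
apply: (wp_for (I := fun o s' => forall o', (o' < o)%N -> rarr s' 0 o' = rarr s 6 o')) => //=.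
- by rewrite (frame_ivar fr1).
- move=> o s2 ob fr2 so I2; apply: wp_raset => /= o'.
  rewrite /upd2 !updE /= updE so (frame_rarr fr2) //= (frame_rarr fr1) //=.
  rewrite ltnS leq_eqVlt => /orP[/eqP->|lt]; first by rewrite eqxx.
  by rewrite ltn_eqF //; apply: I2.
- move=> s2 fr2; rewrite (frame_ivar fr1) // => h2.
  rewrite (frame_rvar fr2) // (frame_rvar fr1) //= updE /=; apply: new => //.
    by move=> x0; move: h; rewrite x0 /= -ltNge => /ltW.
  by move=> i iN; rewrite (frame_iarr fr2) // h1.
Qed.

End Assign.

(** * Sums, digits and ranks *)

Lemma sum_ops (V : nmodType) n k (F : nat -> V) :
  \sum_(o < n * k) F o = \sum_(i < n) \sum_(j < k) F (i * k + j)%N.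
Proof.
elim: n => [|n IH]; first by rewrite mul0n !big_ord0.
by rewrite big_ord_recr /= -IH mulSn addnC big_split_ord.
Qed.

Lemma ler_sum_sub (R : numDomainType) (I : finType) (A B : pred I) (F : I -> R) :
  (forall i, B i -> 0 <= F i) -> (forall i, A i -> B i) ->
  \sum_(i | A i) F i <= \sum_(i | B i) F i.
Proof.
move=> F0 AB; rewrite [leRHS](bigID A) /=.
rewrite [X in _ <= X + _](eq_bigl A) => [|i]; last by case: (boolP (A i)) => [/AB ->|]; rewrite ?andbF.
by rewrite lerDl sumr_ge0 // => i /andP[/F0].
Qed.

Section Digits.
Variables (M : nat) (M0 : (0 < M)%N).

(** Ensures that counting through the numbers below [M ^ Lam] meets every combination of guesses. *)
Lemma digits_ex Lam (d : nat -> nat) :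
  (forall i, (i < Lam)%N -> (d i < M)%N) ->
  exists2 x, (x < M ^ Lam)%N & forall i, (i < Lam)%N -> ((x %/ M ^ i) %% M = d i)%N.
Proof.
elim: Lam d => [|Lam IH] d dM; first by exists 0%N.
have [x xM xd] := IH (fun i => d i.+1) (fun i h => dM i.+1 h).
have d0 := dM 0%N isT; exists (x * M + d 0%N)%N.
  by rewrite expnSr; nia.
case=> [_|i iL]; first by rewrite divn1 modnMDl modn_small.
by rewrite expnS divnMA divnMDl // (divn_small d0) addn0 xd.
Qed.
End Digits.

Section Rank.
Variables (R : realFieldType) (n : nat) (P : nat -> R).
Hypothesis P0 : forall i, (i < n)%N -> 0 <= P i.

Definition rank i := (\sum_(i' < n) prec P i' i)%N.

Lemma prec_trans x y z : prec P x y -> prec P y z -> prec P x z.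
Proof.
rewrite /prec => /andP[yx h1] /andP[zy h2]; rewrite (le_trans zy yx) /=.
apply/negP => /andP[xz zx]; move: h1 h2.
by rewrite (le_trans xz zy) (le_trans yx xz) /= -!ltnNge; lia.
Qed.

Lemma prec_irr x : prec P x x = false.
Proof. by rewrite /prec lexx leqnn. Qed.

Lemma prec_total x y : x <> y -> prec P x y || prec P y x.
Proof. by rewrite /prec => ne; case: (ltgtP (P y) (P x)) => //= _; case: (ltngtP x y) ne. Qed.

Lemma rank_card i : rank i = #|[pred i' : 'I_n | prec P i' i]|.
Proof. by rewrite /rank -sum1_card [RHS]big_mkcond; apply: eq_bigr => j _ /=; rewrite inE; case: prec. Qed.

Lemma prec_rank i i' : (i < n)%N -> prec P i i' -> (rank i < rank i')%N.
Proof.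
move=> iN h; rewrite !rank_card; apply/proper_card/properP; split.
  by apply/subsetP => j; rewrite !inE => /prec_trans; apply.
by exists (Ordinal iN); rewrite !inE // prec_irr.
Qed.

Lemma rank_inj i i' : (i < n)%N -> (i' < n)%N -> rank i = rank i' -> i = i'.
Proof.
move=> iN i'N e; apply/eqP/negPn/negP => /eqP /prec_total /orP[] /prec_rank.
  by move=> /(_ iN); rewrite e ltnn.
by move=> /(_ i'N); rewrite e ltnn.
Qed.

(** All jobs that precede [i] are at least as long as [i]; so a job of high rank is short compared
    with the total volume. *)
Lemma rank_le_sum i : (i < n)%N -> (rank i).+1%:R * P i <= \sum_(i < n) P i.
Proof.
move=> iN; rewrite -natr1 mulrDl mul1r (bigD1 (Ordinal iN)) //= [leLHS]addrC lerD2l.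
rewrite /rank natr_sum mulr_suml [leRHS]big_mkcond /=; apply: ler_sum => j _.
case: (boolP (prec P j i)) => [h|_]; last first.
  by rewrite mul0r; case: ifP => // _; apply: P0.
rewrite ifT ?mul1r; first by case/andP: h.
by apply: contraTneq h => ->; rewrite prec_irr.
Qed.

Lemma rank_count b : (\sum_(i < n | rank i < b) 1 <= b)%N.
Proof.
case: b => [|b]; first by rewrite big_pred0.
rewrite sum1_card -[X in (_ <= X)%N]card_ord.
rewrite -(card_in_imset (f := fun i : 'I_n => inord (rank i) : 'I_b.+1)); first exact: max_card.
move=> i i'; rewrite !unfold_in => h h' /(congr1 val); rewrite /= !inordK // => e.
exact: val_inj (rank_inj (ltn_ord i) (ltn_ord i') e).
Qed.

(** The pigeonhole step: the [q] blocks of ranks are disjoint, so not all of them can exceed the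
    average. *)
Lemma rank_block (b : nat -> nat) q : (0 < q)%N ->
  (forall t, (b t <= b t.+1)%N) ->
  exists2 t, (t < q)%N &
    q%:R * \sum_(i < n | (b t <= rank i < b t.+1)%N) P i <= \sum_(i < n) P i.
Proof.
move=> q0 bS; pose G t := \sum_(i < n | (rank i < b t)%N) P i.
have PG t : G t + \sum_(i < n | (b t <= rank i < b t.+1)%N) P i = G t.+1.
  rewrite [RHS](bigID (fun i : 'I_n => (rank i < b t)%N)) /=; congr (_ + _).
    by apply: eq_bigl => i; have := bS t; case: (ltnP _ (b t)); case: (ltnP _ (b t.+1)) => //; lia.
  by apply: eq_bigl => i; rewrite -leqNgt andbC.
have Gq : \sum_(t < q) \sum_(i < n | (b t <= rank i < b t.+1)%N) P i <= \sum_(i < n) P i.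
  apply: (@le_trans _ _ (G q)); last by apply: ler_sum_sub => // i _; apply: P0.
  elim: q {q0} => [|q IH]; first by rewrite big_ord0; apply: sumr_ge0 => i _; apply: P0.
  by rewrite big_ord_recr /= -PG lerD2r.
have [/existsP[t ht]|/existsPn no] := boolP [exists t : 'I_q,
    q%:R * \sum_(i < n | (b t <= rank i < b t.+1)%N) P i <= \sum_(i < n) P i].
  by exists t.
exfalso; move: Gq no; set V := \sum_(i < n) P i => Gq no.
suff : q%:R * V < q%:R * V by rewrite ltxx.
apply: (@lt_le_trans _ _ (q%:R * \sum_(t < q) \sum_(i < n | (b t <= rank i < b t.+1)%N) P i)).
  rewrite [ltRHS]mulr_sumr [ltLHS]mulr_natl (_ : V *+ q = \sum_(t < q) V); last first.
    by rewrite sumr_const card_ord.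
  apply: ltr_sum => [|t _]; last by rewrite ltNge no.
  by apply/hasP; exists (Ordinal q0); rewrite ?mem_index_enum.
by rewrite ler_wpM2l // ler0n.
Qed.
End Rank.

(* The intervals [[pre i, pre i + w i)] are consecutive; those that start in
   [[lo, hi]] lie in [[lo, hi + delta]]. *)
Lemma sum_window (R : realFieldType) n (w : nat -> R) (X : pred nat) (lo hi delta : R) :
  (forall i, (i < n)%N -> 0 <= w i <= delta) -> lo <= hi + delta ->
  (forall i, (i < n)%N -> X i -> lo <= \sum_(i' < i) w i' <= hi) ->
  \sum_(i < n | X i) w i <= hi + delta - lo.
Proof.
move=> w0 lohi Xlh.
(* [phi] truncates a position to the window. An interval counted by [X] lies in the window and adds
   its full length to [phi]; the others do not decrease it, so the sum telescopes. *)
pose phi t := if t < lo then lo else if hi + delta < t then hi + delta else t.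
have phi_mon t e : 0 <= e -> phi t <= phi (t + e).
  move=> e0; rewrite /phi.
  by case: (ltP t lo); case: (ltP (hi + delta) t); case: (ltP (t + e) lo); case: (ltP (hi + delta) (t + e)); lra.
have phi_le t : phi t <= hi + delta by rewrite /phi; case: (ltP t lo); case: (ltP (hi + delta) t); lra.
have phi_ge t : lo <= phi t by rewrite /phi; case: (ltP t lo); case: (ltP (hi + delta) t); lra.
suff : \sum_(i < n | X i) w i <= phi (\sum_(i < n) w i) - phi 0.
  by have := phi_le (\sum_(i < n) w i); have := phi_ge 0; lra.
elim: n w0 Xlh => [|n IH] w0 Xlh; first by rewrite !big_ord0 subrr.
have {IH} := IH (fun i h => w0 i (ltnW h)) (fun i h => Xlh i (ltnW h)).
rewrite big_mkcond [X in _ -> X <= _]big_mkcond !big_ord_recr /=.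
set t := \sum_(i < n) w i; have /andP[wn0 wnd] := w0 n (ltnSn n).
have := phi_mon t (w n) wn0; case: ifP => [/(Xlh n (ltnSn n))|_]; last by lra.
rewrite -/t => /andP[l h]; have e1 : phi t = t.
  by rewrite /phi; case: (ltP t lo); case: (ltP (hi + delta) t); lra.
have e2 : phi (t + w n) = t + w n.
  by rewrite /phi; case: (ltP (t + w n) lo); case: (ltP (hi + delta) (t + w n)); lra.
by rewrite e1 e2; lra.
Qed.

Lemma sum_by_class (R : nmodType) n K (CL : nat -> nat) (A : pred nat) (g : nat -> R) :
  (forall i, (i < n)%N -> (CL i < K)%N) ->
  \sum_(kap < K) \sum_(i < n | A i && (CL i == kap)) g i = \sum_(i < n | A i) g i.
Proof.
move=> CLK; rewrite (exchange_big_dep (fun i : 'I_n => A i)) /=; last by move=> kap i _ /andP[].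
apply: eq_bigr => i Ai; rewrite (big_pred1 (Ordinal (CLK i (ltn_ord i)))) // => kap.
by rewrite Ai /= eq_sym -val_eqE.
Qed.

(** * Schedules and optimal makespans *)

Lemma ord_ext n (T : Type) (x0 : T) (F : 'I_n -> T) :
  exists f : nat -> T, forall i : 'I_n, f i = F i.
Proof. by exists (fun i => oapp F x0 (insub i)) => i; rewrite valK. Qed.

Lemma machine_inj k a a' c c' : (c < k)%N -> (c' < k)%N ->
  (k * a + c = k * a' + c')%N -> a = a' /\ c = c'.
Proof.
move=> ck ck' e; have e2 : c = c'.
  by have := congr1 (modn^~ k) e; rewrite /= !(mulnC k) !modnMDl !modn_small.
by split=> //; move: e; rewrite e2; nia.
Qed.

Section Schedules.
Variables (R : realFieldType) (m k n : nat) (pt : nat -> R).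
Hypothesis k0 : (0 < k)%N.
Local Notation NK := (n * k)%N.
Hypothesis pt0 : forall o, (o < NK)%N -> 0 <= pt o.

Definition conflict (so : nat -> nat) o o' :=
  (so (o %/ k) = so (o' %/ k) /\ o %% k = o' %% k)%N \/ (o %/ k = o' %/ k)%N.

(* Schedules with operation [j] of job [i] numbered [i * k + j]; operations of
   length zero are moved to time zero, so that they come first in any order
   compatible with the starting times. *)
Record nsched (so : nat -> nat) (s : nat -> R) (T : R) : Prop := NSched {
  ns_shop : forall i, (i < n)%N -> (so i < m)%N;
  ns_ge0 : forall o, (o < NK)%N -> 0 <= s o;
  ns_zero : forall o, (o < NK)%N -> pt o = 0 -> s o = 0;
  ns_excl : forall o o', (o < NK)%N -> (o' < NK)%N -> o <> o' ->
    0 < pt o -> 0 < pt o' -> conflict so o o' ->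
    s o + pt o <= s o' \/ s o' + pt o' <= s o;
  ns_le : forall o, (o < NK)%N -> s o + pt o <= T;
  ns_T : 0 <= T }.

Lemma op_split o : (o < NK)%N ->
  exists (i : 'I_n) (j : 'I_k), [/\ o = (i * k + j)%N, (o %/ k)%N = i & (o %% k)%N = j].
Proof.
move=> oN; have i0 : (o %/ k < n)%N by rewrite ltn_divLR.
by exists (Ordinal i0), (Ordinal (ltn_pmod o k0)); split=> //=; rewrite -divn_eq.
Qed.

Lemma op_lt i j : (i < n)%N -> (j < k)%N -> (i * k + j < NK)%N.
Proof. nia. Qed.

Lemma op_div i j : (j < k)%N -> ((i * k + j) %/ k = i)%N.
Proof. by move=> jk; rewrite divnMDl // divn_small // addn0. Qed.

Lemma op_mod i j : (j < k)%N -> ((i * k + j) %% k = j)%N.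
Proof. by move=> jk; rewrite modnMDl modn_small. Qed.

Section FromFeasible.
Variable p : 'I_n -> 'I_k -> R.
Hypothesis pE : forall (i : 'I_n) (j : 'I_k), p i j = pt (i * k + j)%N.

Lemma makespan_le (S : schedule R m k n) T : 0 <= T ->
  (forall i j, completion p S i j <= T) -> makespan p S <= T.
Proof. by move=> T0 h; apply/bigmax_leP; split=> // i _; apply/bigmax_leP. Qed.

Lemma makespan_ge0 (S : schedule R m k n) : 0 <= makespan p S.
Proof. exact: bigmax_ge_id. Qed.

Lemma completion_le (S : schedule R m k n) i j : completion p S i j <= makespan p S.
Proof.
apply: le_trans (le_bigmax _ (fun i => \big[Num.max/0]_(j < k) completion p S i j) i).
exact: (le_bigmax _ (completion p S i) j).
Qed.

Lemma nsched_of_feasible (S : schedule R m k n) : feasible p S ->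
  exists so s, nsched so s (makespan p S) /\ forall i : 'I_n, so i = shop S i.
Proof.
move=> FS; have [so soE] := ord_ext 0%N (fun i => nat_of_ord (shop S i)).
pose s o := if pt o == 0 then 0 else
  oapp (fun i => oapp (start S i) 0 (insub (o %% k)%N)) 0 (insub (o %/ k)%N).
have sE (i : 'I_n) (j : 'I_k) : s (i * k + j)%N = if p i j == 0 then 0 else start S i j.
  by rewrite /s -pE op_div // op_mod // !valK.
exists so, s; split=> //; split.
- by move=> i iN; rewrite (soE (Ordinal iN)).
- move=> o /op_split[i [j [-> _ _]]]; rewrite sE; case: ifP => // _.
  exact: start_ge0 FS _ _.
- by move=> o /op_split[i [j [-> _ _]]]; rewrite sE -pE => ->; rewrite eqxx.
- move=> o o' /op_split[i [j [-> di mj]]] /op_split[i' [j' [-> di' mj']]] ne.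
  rewrite !sE -!pE /conflict => p0 p0'.
  rewrite !op_div // !op_mod // !soE => cf.
  rewrite !gt_eqF //.
  (* Overlapping operations of positive length would both run at the later of their starting
     times. *)
  have key (t : R) : running p S i j t -> running p S i' j' t -> False.
    move=> r1 r2; apply: ne; case: cf => [[/val_inj es /val_inj ej]|/val_inj ei].
      by subst j'; rewrite (machine_exclusive FS es r1 r2).
    by subst i'; rewrite (job_exclusive FS r1 r2).
  case: (leP (start S i j) (start S i' j')) => h; [left|right]; rewrite leNgt; apply/negP => lt.
    by apply: (key (start S i' j')); rewrite /running /completion ?h ?lt ?lexx ?ltrDl.
  by apply: (key (start S i j)); rewrite /running /completion ?(ltW h) ?lt ?lexx ?ltrDl.
- move=> o /op_split[i [j [-> _ _]]]; rewrite sE -pE; case: eqP => [->|_].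
    by rewrite addr0 makespan_ge0.
  exact: completion_le.
- exact: makespan_ge0.
Qed.

Lemma feasible_of_starts (sh : nat -> nat) (st : nat -> R) mk :
  (forall i, (i < n)%N -> (sh i < m)%N) ->
  (forall o, (o < NK)%N -> 0 <= st o) ->
  (forall o o', (o < NK)%N -> (o' < NK)%N -> o <> o' -> conflict sh o o' ->
     st o + pt o <= st o' \/ st o' + pt o' <= st o) ->
  (forall o, (o < NK)%N -> st o + pt o <= mk) -> 0 <= mk ->
  exists S : schedule R m k n,
    [/\ forall i : 'I_n, sh i = shop S i,
        forall (i : 'I_n) (j : 'I_k), st (i * k + j)%N = start S i j,
        feasible p S & makespan p S <= mk].
Proof.
move=> shm st0 ex le_mk mk0.
exists (Schedule (fun i : 'I_n => Ordinal (shm i (ltn_ord i)))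
  (fun i j => st (i * k + j)%N)); split=> //.
  have key o o' t : (o < NK)%N -> (o' < NK)%N -> o <> o' -> conflict sh o o' ->
      st o <= t < st o + pt o -> st o' <= t < st o' + pt o' -> False.
    by move=> oN o'N ne cf /andP[a b] /andP[c d]; case: (ex o o') => // h; lra.
  split=> /=.
  - by move=> i j; apply/st0/op_lt.
  - move=> i i' j t [es]; rewrite /running /completion /= !pE => r1 r2.
    apply/val_inj/eqP/negPn/negP => /eqP ne.
    apply: (key _ _ _ (op_lt (ltn_ord i) (ltn_ord j)) (op_lt (ltn_ord i') (ltn_ord j)) _ _ r1 r2).
      by move/(congr1 (divn^~ k)); rewrite /= !op_div.
    by left; rewrite !op_div // !op_mod.
  - move=> i j j' t; rewrite /running /completion /= !pE => r1 r2.
    apply/val_inj/eqP/negPn/negP => /eqP ne.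
    apply: (key _ _ _ (op_lt (ltn_ord i) (ltn_ord j)) (op_lt (ltn_ord i) (ltn_ord j')) _ _ r1 r2).
      by move/(congr1 (modn^~ k)); rewrite /= !op_mod.
    by right; rewrite !op_div.
by apply: makespan_le => // i j; rewrite /completion /= pE; apply/le_mk/op_lt.
Qed.
End FromFeasible.

(** Pairwise conflicting operations run one after another. All others end before the last one
    starts, so its starting time serves as the bound for them in the induction. *)
Lemma load_le so s T (X : pred nat) : nsched so s T ->
  (forall o o', (o < NK)%N -> (o' < NK)%N -> X o -> X o' -> conflict so o o') ->
  \sum_(o < NK | X o) pt o <= T.
Proof.
move=> NS Xcf.
rewrite (bigID (fun o : 'I_NK => 0 < pt o)) /= [X in _ + X]big1 ?addr0; last first.
  by move=> o /andP[_]; rewrite -leNgt => h; apply/eqP; rewrite eq_le h pt0.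
rewrite -big_set.
set A := [set o | _].
have AX o : o \in A -> X o /\ 0 < pt o by rewrite inE => /andP.
suff gen c (B : {set 'I_NK}) T' : (#|B| < c)%N -> B \subset A -> 0 <= T' ->
    (forall o, o \in B -> s o + pt o <= T') -> \sum_(o in B) pt o <= T'.
  apply: (gen _ A T (ltnSn _)) => //; first exact: (ns_T NS).
  by move=> o _; apply: (ns_le NS).
elim: c B T' => // c IH B T' Bc /subsetP BA T0 BT.
have [->|[o0 o0B]] := set_0Vmem B; first by rewrite big_set0.
pose o := [arg max_(o > o0 in B) s o]%O.
have [oB omax] : o \in B /\ forall o', o' \in B -> s o' <= s o.
  by rewrite /o; case: arg_maxP => //.
rewrite (big_setD1 o) //=.
suff : \sum_(i in B :\ o) pt i <= s o by have := BT _ oB; lra.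
apply: IH => [|||o'].
- by move: Bc; rewrite (cardsD1 o B) oB.
- by apply/subsetP => o'; rewrite !inE => /andP[_] /BA; rewrite inE.
- exact: (ns_ge0 NS).
- rewrite !inE => /andP[ne o'B]; have [Xo po] := AX _ (BA _ oB); have [Xo' po'] := AX _ (BA _ o'B).
  have neq : nat_of_ord o' <> o by move=> /val_inj e; rewrite e eqxx in ne.
  have := ns_excl NS (ltn_ord o') (ltn_ord o) neq po' po (Xcf _ _ (ltn_ord o') (ltn_ord o) Xo' Xo).
  by move=> [//|h]; have := omax _ o'B; lra.
Qed.

(** * Priorities from starting times *)

Section Order.
Variables (so : nat -> nat) (s : nat -> R) (T : R).
Hypothesis NS : nsched so s T.

Definition lexle o o' := (s o < s o') || ((s o == s o') && (pt o <= pt o')).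

Lemma lexle_refl : reflexive lexle.
Proof. by move=> o; rewrite /lexle eqxx lexx orbT. Qed.

Lemma lexle_total : total lexle.
Proof. by move=> o o'; rewrite /lexle; case: (ltgtP (s o)) => //= _; apply: le_total. Qed.

Lemma lexle_trans : transitive lexle.
Proof.
move=> b a c; rewrite /lexle => /orP[h1|/andP[/eqP h1 q1]] /orP[h2|/andP[/eqP h2 q2]].
- by rewrite (lt_trans h1 h2).
- by rewrite -h2 h1.
- by rewrite h1 h2.
- by rewrite h1 h2 eqxx (le_trans q1 q2) orbT.
Qed.

Lemma lexle_le o o' : lexle o o' -> s o <= s o'.
Proof. by case/orP=> [/ltW//|/andP[/eqP->]]. Qed.

(** The delicate case is [pt o' = 0]: then [s o' = 0], and the tie-break by length lets only
    operations of length zero come before [o']. *)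
Lemma lexle_conflict o o' : (o < NK)%N -> (o' < NK)%N -> o <> o' ->
  conflict so o o' -> lexle o o' -> s o + pt o <= s o'.
Proof.
move=> oN o'N ne cf le; have := lexle_le le; have := pt0 oN; have := pt0 o'N.
have := ns_ge0 NS oN; have := ns_ge0 NS o'N => s0 s0' p0 p0' ss.
have [e|] := eqVneq (pt o) 0; first by rewrite e addr0.
have [e'|] := eqVneq (pt o') 0.
  move=> ne0; have z' := ns_zero NS o'N e'; move: le; rewrite /lexle e' z'.
  by move=> /orP[|/andP[/eqP->]]; [lra|]; move=> le0; case/eqP: ne0; lra.
move=> n1 n2.
have g1 : 0 < pt o' by rewrite lt_def n1.
have g2 : 0 < pt o by rewrite lt_def n2.
by case: (ns_excl NS oN o'N ne g2 g1 cf) => //; lra.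
Qed.

(** Positions in the sorted list are distinct priorities, although [lexle] is only a preorder. *)
Definition order_of (l : seq nat) := sort lexle l.

Lemma order_of_index l o o' : o \in l -> o' \in l ->
  (index o (order_of l) <= index o' (order_of l))%N -> lexle o o'.
Proof.
move=> ol o'l; apply: (sorted_leq_index lexle_trans lexle_refl).
- exact: sort_sorted lexle_total _.
- by rewrite mem_sort.
- by rewrite mem_sort.
Qed.

Lemma order_of_inj l o o' : o \in l -> o' \in l ->
  index o (order_of l) = index o' (order_of l) -> o = o'.
Proof. by move=> ol o'l; apply: (index_inj 0%N); rewrite mem_sort. Qed.
End Order.

(** * Existence of an optimal schedule *)

Section Optimum.
Hypothesis m0 : (0 < m)%N.
Variable p : 'I_n -> 'I_k -> R.
Hypothesis pE : forall (i : 'I_n) (j : 'I_k), p i j = pt (i * k + j)%N.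

(** The case where every operation is long and [delta] is [0], so that nothing is delayed. One
    schedule, depending on shops and priorities only, must serve all compatible [s] and [T]. *)
Lemma greedy_schedule (sh pr : nat -> nat) : (forall i, (i < n)%N -> (sh i < m)%N) ->
  exists S : schedule R m k n, feasible p S /\
    forall s T, nsched sh s T ->
      (forall o o', (o < NK)%N -> (o' < NK)%N -> pr o = pr o' -> o = o') ->
      (forall o o', (o < NK)%N -> (o' < NK)%N -> (pr o <= pr o')%N -> lexle s o o') ->
      makespan p S <= T.
Proof.
move=> shm.
pose ma o := (k * sh (o %/ k) + o %% k)%N; pose jb o := (o %/ k)%N.
pose fl := fun o : nat => true; pose H := fun o => (o < NK)%N.
have maE o o' : ma o = ma o' <-> sh (o %/ k)%N = sh (o' %/ k)%N /\ (o %% k = o' %% k)%N.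
  split=> [|[e1 e2]]; last by rewrite /ma e1 e2.
  exact: machine_inj (ltn_pmod o k0) (ltn_pmod o' k0).
pose good s T := [/\ nsched sh s T,
  forall o o', (o < NK)%N -> (o' < NK)%N -> pr o = pr o' -> o = o' &
  forall o o', (o < NK)%N -> (o' < NK)%N -> (pr o <= pr o')%N -> lexle s o o'].
have qual s T : good s T -> quality NK pt ma jb pr fl H s 0 T.
  case=> NS inj lex; split=> //.
  - exact: (ns_ge0 NS).
  - by move=> o o' _ o'N _; rewrite /H o'N.
  - by move=> o o' oN o'N /(lex _ _ oN o'N); apply: lexle_le.
  - move=> o o' oN o'N /eqP ne le cf; apply: (lexle_conflict NS) => //; last exact: lex.
    by case: cf => [/maE|]; [left|right].
  - exact: (ns_T NS).
  - by move=> o oN Ho; rewrite mulr0 addr0; apply: (ns_le NS).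
have run c : (c <= NK)%N -> exists g mk, [/\ ginv NK pt ma jb fl c g mk, 0 <= mk &
    forall s T, good s T -> qinv NK pt ma jb pr fl H s 0 T g mk].
  elim: c => [_|c IH cN].
    exists (GState (fun=> 0%N) (fun=> 0) (fun=> 0) (fun=> 0)), 0; split=> //.
      exact: ginv_init.
    by move=> s T /qual qu; apply: qinv_init.
  have [g [mk [I mk0 Q]]] := IH (ltnW cN).
  have [w0 ww0] := ginv_waiting I cN; have [w0N _] := andP ww0.
  pose W := fun o : 'I_NK => waiting NK g o.
  pose r := [arg min_(o < Ordinal w0N | W o) pr o].
  have [wr le_r] : W r /\ forall o, W o -> (pr r <= pr o)%N.
    by rewrite /r; case: arg_minnP.
  have sr : selected NK ma jb pr fl g r.
    rewrite /selected /=; split=> //; split=> // o wo _.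
    by have [oN _] := andP wo; apply: (le_r (Ordinal oN)).
  exists (place pt ma jb g r), (Num.max mk (est ma jb g r + pt r)); split.
  - by have := ginv_place pt0 I sr; apply.
  - by rewrite le_max mk0.
  - by move=> s T gd; have := qinv_place pt0 (qual _ _ gd) I (Q s T gd) sr; apply.
have [g [mk [I mk0 Q]]] := run NK (leqnn _).
have pl o : (o < NK)%N -> placed g o != 0%N by move=> oN; apply: ginv_all I _ oN.
have [S [_ _ FS le_mk]] : exists S : schedule R m k n,
    [/\ forall i : 'I_n, sh i = shop S i,
        forall (i : 'I_n) (j : 'I_k), gstart g (i * k + j)%N = start S i j,
        feasible p S & makespan p S <= mk].
  apply: feasible_of_starts => //.
  - by move=> o oN; apply: (gi_start I) => //; apply: pl.
  - move=> o o' oN o'N ne cf; apply: (gi_excl I) => //; try exact: pl.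
    by case: cf => [/maE|]; [left|right].
  - by move=> o oN; apply: (gi_mk I) => //; apply: pl.
exists S; split=> // s T NS inj lex; apply: le_trans le_mk _.
apply: le_trans (qinv_le pt0 (Q s T _)) _ => //.
by rewrite big1 ?addr0 // => o _; rewrite /H ltn_ord.
Qed.

(** An ordered field offers no compactness. Instead, every feasible schedule is dominated by the
    greedy one with its shops and its order of starts, and there are finitely many of these. *)
Lemma opt_exists : exists opt, is_min_makespan m p opt.
Proof.
pose X := ({ffun 'I_n -> 'I_m} * {ffun 'I_NK -> 'I_NK.+1})%type.
pose dom (x : X) (S : schedule R m k n) := feasible p S /\
   forall (s : nat -> R) (T : R) (sh pr : nat -> nat),
   (forall i : 'I_n, sh i = x.1 i :> nat) -> (forall o : 'I_NK, pr o = x.2 o :> nat) ->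
   nsched sh s T ->
   (forall o o', (o < NK)%N -> (o' < NK)%N -> pr o = pr o' -> o = o') ->
   (forall o o', (o < NK)%N -> (o' < NK)%N -> (pr o <= pr o')%N -> lexle s o o') ->
   makespan p S <= T.
have [F FP] : exists F, forall x, dom x (F x).
  apply: fin_all_exists => x.
  have [sh shE] := ord_ext 0%N (fun i => nat_of_ord (x.1 i)).
  have [pr prE] := ord_ext 0%N (fun i => nat_of_ord (x.2 i)).
  have [|S [FS SP]] := @greedy_schedule sh pr.
    by move=> i iN; rewrite (shE (Ordinal iN)).
  exists S; split=> // s T sh' pr' shE' prE' NS inj lex.
  have eqp o : (o < NK)%N -> pr' o = pr o.
    by move=> oN; rewrite (prE' (Ordinal oN)) (prE (Ordinal oN)).
  have eqs i : (i < n)%N -> sh' i = sh i.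
    by move=> iN; rewrite (shE' (Ordinal iN)) (shE (Ordinal iN)).
  apply: (SP s).
  - case: NS => h1 h2 h3 h4 h5 h6; split=> //; first by move=> i iN; rewrite -eqs ?h1.
    move=> o o' oN o'N ne po po' cf; apply: h4 => //; move: cf; rewrite /conflict !eqs //;
      by rewrite ltn_divLR.
  - by move=> o o' oN o'N; rewrite -!eqp //; apply: inj.
  - by move=> o o' oN o'N; rewrite -!eqp //; apply: lex.
have x0 : X by split; apply: finfun => _; [exact: Ordinal m0|exact: ord0].
pose x := [arg min_(x < x0) makespan p (F x)]%O.
have xmin y : makespan p (F x) <= makespan p (F y).
  by rewrite /x; case: arg_minP => // z _; apply.
exists (makespan p (F x)); split; first by exists (F x) => //; case: (FP x).
move=> S FS; have [so [s [NS soE]]] := nsched_of_feasible pE FS.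
pose l := iota 0 NK; pose pr o := index o (order_of s l).
have inl o : (o < NK)%N -> o \in l by rewrite mem_iota.
pose y : X := ([ffun i => shop S i], [ffun o : 'I_NK => inord (pr o)]).
apply: le_trans (xmin y) _; have [_ FPy] := FP y; apply: (FPy s _ so pr) NS _ _.
- by move=> i; rewrite soE ffunE.
- move=> o; rewrite ffunE inordK // ltnS /pr.
  by apply: leq_trans (index_size _ _) _; rewrite size_sort size_iota.
- by move=> o o' /inl ol /inl o'l; apply: order_of_inj.
- by move=> o o' /inl ol /inl o'l; apply: order_of_index.
Qed.
End Optimum.
End Schedules.

(** * Quality of the best candidate *)

Section Analysis.
Variables (R : realFieldType) (m k n E : nat) (pt P : nat -> R) (RK CL : nat -> nat).
Hypotheses (m0 : (0 < m)%N) (k0 : (0 < k)%N) (E0 : (0 < E)%N).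
Local Notation NK := (n * k)%N.
Local Notation Q := (paramQ m k E).
Local Notation M := (paramM m k E).
Local Notation L := ((k + 2) * Q)%N.
Local Notation V := (\sum_(i < n) P i).
Hypothesis pt0 : forall o, (o < NK)%N -> 0 <= pt o.
Hypothesis PE : forall i, (i < n)%N -> P i = \sum_(j < k) pt (i * k + j)%N.
Hypothesis RKE : forall i, (i < n)%N -> RK i = rank n P i.
Hypothesis CLE : forall i, (i < n)%N -> exists2 f,
  forall j, (j < k)%N -> bitsval Q (pt (i * k + j)%N) (P i) (f j) & CL i = pack Q f k.
Variables (so : nat -> nat) (s : nat -> R) (T : R).
Hypothesis NS : nsched m k n pt so s T.

Lemma P_ge0 i : (i < n)%N -> 0 <= P i.
Proof. by move=> iN; rewrite PE //; apply: sumr_ge0 => j _; apply/pt0/op_lt. Qed.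

Lemma sum_machine (A : pred nat) (F : nat -> R) j : (j < k)%N ->
  \sum_(o < NK) (if A (o %/ k)%N && (o %% k == j)%N then F o else 0) =
  \sum_(i < n | A i) F (i * k + j)%N.
Proof.
move=> jk; rewrite (sum_ops n k (fun o => if A (o %/ k)%N && (o %% k == j)%N then F o else 0)).
rewrite [RHS]big_mkcond; apply: eq_bigr => i _.
rewrite (bigD1 (Ordinal jk)) //= op_div // op_mod // eqxx andbT big1 ?addr0 // => j' ne.
by rewrite op_div // op_mod // andbC ifF //; apply/negbTE; apply: contra ne => /andP[/eqP e _]; apply/eqP/val_inj.
Qed.

Lemma load_opt l j : (j < k)%N -> \sum_(i < n | so i == l) pt (i * k + j)%N <= T.
Proof.
move=> jk; rewrite -(sum_machine (fun i => so i == l) pt jk) -big_mkcond /=.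
apply: (load_le pt0 (X := fun o => (so (o %/ k)%N == l) && (o %% k == j)%N) NS).
move=> o o' _ _ /andP[/eqP a /eqP b] /andP[/eqP c /eqP d].
by left; rewrite a b c d.
Qed.

(** Each of the [m * k] machines carries at most [T]. *)
Lemma V_le : V <= (m * k)%:R * T.
Proof.
have -> : V = \sum_(j < k) \sum_(i < n) pt (i * k + j)%N.
  by rewrite exchange_big /=; apply: eq_bigr => i _; apply: PE.
have -> : (m * k)%:R * T = \sum_(j < k) (m%:R * T).
  by rewrite sumr_const card_ord mulnC natrM -mulrA mulr_natl.
apply: ler_sum => j _.
have <- := @sum_by_class R n m so xpredT (fun i => pt (i * k + j)%N) (ns_shop NS).
have -> : m%:R * T = \sum_(l < m) T by rewrite sumr_const card_ord mulr_natl.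
by apply: ler_sum => l _; apply: load_opt.
Qed.

Lemma V_ge0 : 0 <= V. Proof. by apply: sumr_ge0 => i _; apply: P_ge0. Qed.

Lemma CL_lt i : (i < n)%N -> (CL i < 2 ^ (k * Q))%N.
Proof. by move=> /CLE[f fP ->]; apply: pack_lt => j /fP[]. Qed.

(** * Machine loads when short jobs are distributed in chunks *)

Section Loads.
Variables (b : nat) (delta : R) (SH : nat -> nat).
Let small i := (b <= RK i)%N.
Hypothesis delta0 : 0 <= delta.
Hypothesis small_delta : forall i, (i < n)%N -> small i -> P i <= delta.

(** The reference schedule cuts the volume of class [kap] into consecutive segments, one per shop;
    that of shop [l] begins here. *)
Definition cum (kap l : nat) := \sum_(i < n | small i && (CL i == kap) && (so i < l)%N) P i.

(* The shop of the jobs of class [kap] in the chunk [c] of volume [V / 2 ^ L]. *)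
Definition chunk_shop (kap c : nat) :=
  find (fun l : nat => c%:R * V < 2%:R ^+ L * cum kap l.+1) (iota 0 m.-1).

Definition small_volume (i kap : nat) := \sum_(i' < i | small i' && (CL i' == kap)) P i'.

Hypothesis SH_forced : forall i, (i < n)%N -> ~~ small i -> SH i = so i.
Hypothesis SH_small : forall i, (i < n)%N -> small i ->
  exists2 c, bitsval L (small_volume i (CL i)) V c & SH i = chunk_shop (CL i) c.

Local Notation u := (V / 2%:R ^+ L).

Lemma p2_gt0 e : 0 < 2%:R ^+ e :> R.
Proof. by rewrite exprn_gt0 // ltr0n. Qed.

(** A job sent to shop [l] begins in a chunk whose left end lies in the segment of [l]. Only the
    width [u] of a chunk and the length of the last job can stick out. *)
Lemma class_window kap l : (l < m)%N ->
  \sum_(i < n | small i && (CL i == kap) && (SH i == l)) P i <=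
  \sum_(i < n | small i && (CL i == kap) && (so i == l)) P i + u + delta.
Proof.
move=> lm; pose A i := small i && (CL i == kap).
pose w i := if A i then P i else 0.
have cumS : cum kap l.+1 = cum kap l + \sum_(i < n | A i && (so i == l)) P i.
  rewrite /cum [LHS](bigID (fun i : 'I_n => (so i < l)%N)) /=; congr (_ + _).
    by apply: eq_bigl => i; rewrite -/(A i); case: (A i) => //=; lia.
  by apply: eq_bigl => i; rewrite -/(A i); case: (A i) => //=; lia.
have P0 := P_ge0; have u0 : 0 <= u by rewrite divr_ge0 ?V_ge0 // ltW // p2_gt0.
have sl0 : 0 <= \sum_(i < n | A i && (so i == l)) P i by apply: sumr_ge0 => i _; apply: P0.
have -> : \sum_(i < n | A i && (SH i == l)) P i = \sum_(i < n | A i && (SH i == l)) w i.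
  by apply: eq_bigr => i /andP[Ai _]; rewrite /w Ai.
have vw i : \sum_(i' < i) w i' = small_volume i kap by rewrite /small_volume [RHS]big_mkcond.
have := @sum_window R n w (fun i => A i && (SH i == l)) (cum kap l) (cum kap l.+1 + u) delta.
suff [h1 [h2 h3]] : [/\ forall i, (i < n)%N -> 0 <= w i <= delta,
   cum kap l <= cum kap l.+1 + u + delta &
   forall i, (i < n)%N -> A i && (SH i == l) ->
     cum kap l <= \sum_(i' < i) w i' <= cum kap l.+1 + u].
  by move=> /(_ h1 h2 h3); rewrite cumS; lra.
have d0 := delta0; split.
- move=> i iN; rewrite /w; case: ifP => [/andP[si _]|_]; last by rewrite lexx.
  by rewrite P0 // small_delta.
- by rewrite cumS; lra.
move=> i iN /andP[/andP[si /eqP ki] /eqP SHi]; rewrite vw.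
have [c [_ /andP[c1 c2]] e] := SH_small iN si; rewrite ki in c1 c2 e.
rewrite SHi /chunk_shop in e; have p2 := p2_gt0 L.
have uV : 2%:R ^+ L * u = V by rewrite mulrC divfK // gt_eqF.
apply/andP; split; rewrite -(ler_pM2l p2).
  apply: le_trans c1; case: l lm e {SHi cumS sl0} => [|l] lm e.
    by rewrite /cum big1 ?mulr0 ?mulr_ge0 ?V_ge0 // => j; rewrite ltn0 andbF.
  have lt_l := leqnn l.+1; rewrite {2}e in lt_l.
  have := before_find 0%N lt_l; rewrite nth_iota; last by lia.
  by rewrite add0n => /negbT; rewrite -leNgt.
apply: le_trans c2 _; rewrite mulrDr uV -natr1 mulrDl mul1r lerD2r.
(* The search stops before the last shop, which is its default; there the bound is the total volume
   of the class. *)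
have [lt|ge] := ltnP l m.-1.
  have hf : has (fun l : nat => c%:R * V < 2%:R ^+ L * cum kap l.+1) (iota 0 m.-1).
    by rewrite has_find -e size_iota.
  by have := nth_find 0%N hf; rewrite -e nth_iota // add0n => /ltW.
apply: le_trans c1 _; rewrite ler_pM2l // /small_volume /cum.
rewrite (big_ord_widen_cond n (fun i => small i && (CL i == kap)) P) ?(ltnW iN) //.
apply: ler_sum_sub => [j _|j /andP[-> _] /=]; first exact: P0.
by have := ns_shop NS (ltn_ord j); lia.
Qed.

(** Volumes are turned into loads by the leading digits, rounding up for the shops chosen and down
    for the reference schedule. Each of the [2 ^ (k * Q)] classes costs at most [u + delta], and the
    rounding costs [V / 2 ^ Q] in all; everything is scaled by [2 ^ Q]. *)
Lemma machine_load l j : (l < m)%N -> (j < k)%N ->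
  2%:R ^+ Q * \sum_(i < n | SH i == l) pt (i * k + j)%N <=
  2%:R ^+ Q * T + 2%:R ^+ Q * 2%:R ^+ (k * Q) * (u + delta) + V.
Proof.
move=> lm jk; have P0 := P_ge0; have d0 := delta0.
have u0 : 0 <= u by rewrite divr_ge0 ?V_ge0 // ltW // p2_gt0.
(* The digits at stage [j] are a function of the class number, since [pack] is injective on digit
   strings. *)
have [F [F_lt FP]] : exists F : nat -> nat, (forall kap, (F kap < 2 ^ Q)%N) /\
    forall i, (i < n)%N -> bitsval Q (pt (i * k + j)%N) (P i) (F (CL i)).
  pose code (i : 'I_n) (f : nat -> nat) :=
    (forall j, (j < k)%N -> bitsval Q (pt (i * k + j)%N) (P i) (f j)) /\ CL i = pack Q f k.
  have [f fP] : exists f, forall i, code i (f i).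
    by apply: fin_all_exists => i; have [f fP e] := CLE (ltn_ord i); exists f.
  exists (fun kap => oapp (fun i => f i j) 0%N [pick i : 'I_n | CL i == kap]); split.
    by move=> kap; case: pickP => [i _|_] /=; [case: (fP i) => /(_ _ jk)[]|rewrite expn_gt0].
  move=> i iN; case: pickP => [i0 /eqP e|/(_ (Ordinal iN))]; last by rewrite eqxx.
  have [h1 e1] := fP i0; have [h2 e2] := fP (Ordinal iN); rewrite /= in h2 e2.
  rewrite /= (@pack_inj Q (f i0) (f (Ordinal iN)) k) //.
  - exact: h2.
  - by move=> j' /h1[].
  - by move=> j' /h2[].
  - by rewrite -e1 -e2.
have p2 := p2_gt0 Q.
have CLlt := CL_lt.
rewrite [X in _ * X](bigID (fun i : 'I_n => small i)) /=.
have split_opt : \sum_(i < n | so i == l) pt (i * k + j)%N =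
  \sum_(i < n | small i && (so i == l)) pt (i * k + j)%N +
  \sum_(i < n | (SH i == l) && ~~ small i) pt (i * k + j)%N.
  rewrite (bigID (fun i : 'I_n => small i)) /=; congr (_ + _); first by apply: eq_bigl => i; rewrite andbC.
  by apply: eq_bigl => i; case: (boolP (small i)) => si; rewrite ?andbF // SH_forced.
have main : 2%:R ^+ Q * \sum_(i < n | small i && (SH i == l)) pt (i * k + j)%N <=
    2%:R ^+ Q * \sum_(i < n | small i && (so i == l)) pt (i * k + j)%N +
    2%:R ^+ Q * 2%:R ^+ (k * Q) * (u + delta) + V.
  have e1 (B : nat -> bool) (g : nat -> R) : \sum_(i < n | small i && B i) g i =
      \sum_(kap < 2 ^ (k * Q)) \sum_(i < n | small i && (CL i == kap) && B i) g i.
    rewrite -(@sum_by_class R n (2 ^ (k * Q)) CL (fun i => small i && B i)) //.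
    by apply: eq_bigr => kap _; apply: eq_bigl => i; rewrite -!andbA (andbC (B i)).
  have h1 := e1 (fun i => SH i == l) (fun i => pt (i * k + j)%N).
  have h2 := e1 (fun i => so i == l) (fun i => pt (i * k + j)%N).
  have h3 := e1 (fun i => SH i == l) P.
  rewrite /= in h1 h2 h3; rewrite h1 h2 !mulr_sumr.
  have -> : 2%:R ^+ Q * 2%:R ^+ (k * Q) * (u + delta) =
     \sum_(kap < 2 ^ (k * Q)) 2%:R ^+ Q * (u + delta).
    by rewrite sumr_const card_ord -[RHS]mulr_natl natrX mulrA [X in _ = X * _]mulrC.
  have Vle : \sum_(kap < 2 ^ (k * Q)) \sum_(i < n | small i && (CL i == kap) && (SH i == l)) P i <= V.
    by rewrite -h3; apply: ler_sum_sub => // i _; apply: P0.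
  apply: le_trans (_ : \sum_(kap < 2 ^ (k * Q)) (
     2%:R ^+ Q * \sum_(i < n | small i && (CL i == kap) && (so i == l)) pt (i * k + j)%N +
     2%:R ^+ Q * (u + delta) +
     \sum_(i < n | small i && (CL i == kap) && (SH i == l)) P i) <= _); last first.
    by rewrite !big_split /= lerD2l.
  apply: ler_sum => kap _.
  have up : 2%:R ^+ Q * \sum_(i < n | small i && (CL i == kap) && (SH i == l)) pt (i * k + j)%N <=
     (F kap).+1%:R * \sum_(i < n | small i && (CL i == kap) && (SH i == l)) P i.
    rewrite !mulr_sumr; apply: ler_sum => i /andP[/andP[_ /eqP e] _].
    by have [_ /andP[_]] := FP i (ltn_ord i); rewrite e.
  have lo : (F kap)%:R * \sum_(i < n | small i && (CL i == kap) && (so i == l)) P i <=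
     2%:R ^+ Q * \sum_(i < n | small i && (CL i == kap) && (so i == l)) pt (i * k + j)%N.
    rewrite !mulr_sumr; apply: ler_sum => i /andP[/andP[_ /eqP e] _].
    by have [_ /andP[h _]] := FP i (ltn_ord i); rewrite e in h.
  have win := class_window kap lm.
  have F0 : 0 <= (F kap)%:R :> R by rewrite ler0n.
  have := ler_wpM2l F0 win; rewrite !mulrDr => win'.
  have ud : (F kap)%:R * (u + delta) <= 2%:R ^+ Q * (u + delta).
    by apply: ler_wpM2r; [lra|rewrite -natrX ler_nat ltnW].
  move: up lo win' ud; rewrite -[(F kap).+1%:R]natr1 => *.
  lra.
have := load_opt l jk; rewrite -(ler_pM2l p2) split_opt !mulrDr.
have -> : \sum_(i < n | (SH i == l) && small i) pt (i * k + j)%N =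
  \sum_(i < n | small i && (SH i == l)) pt (i * k + j)%N by apply: eq_bigl => i; rewrite andbC.
by move: main; rewrite !mulrDr; lra.
Qed.
End Loads.

Lemma Q_gt0 : (0 < Q)%N.
Proof. by rewrite /paramQ /cQ !muln_gt0 m0 k0 E0 addnS. Qed.

Lemma k_leQ : (k <= Q)%N.
Proof.
rewrite (_ : Q = k * (2 * m * (2 * k + 3) * E))%N; last by rewrite /paramQ /cQ; ring.
by rewrite leq_pmulr // !muln_gt0 m0 E0 addnS.
Qed.

Lemma m_leQ : (m <= Q)%N.
Proof.
rewrite (_ : Q = m * (2 * k * (2 * k + 3) * E))%N; last by rewrite /paramQ /cQ; ring.
by rewrite leq_pmulr // !muln_gt0 k0 E0 addnS.
Qed.

Lemma Q_lt2 : (Q < 2 ^ Q)%N. Proof. exact: ltn_expl. Qed.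

(** Starting at [2 ^ L] keeps a short job no longer than a chunk; the ratio [2 ^ Q] beats the number
    of long operations. *)
Definition level t := (2 ^ (Q * (k + 2 + t)))%N.

Lemma levelS t : level t.+1 = (level t * 2 ^ Q)%N.
Proof. by rewrite /level addnS mulnS addnC expnD. Qed.

Lemma level0 : level 0 = (2 ^ L)%N. Proof. by rewrite /level addn0 mulnC. Qed.

Lemma level_mono t : (level 0 <= level t)%N.
Proof. by rewrite leq_pexp2l // leq_mul2l; apply/orP; right; lia. Qed.

Lemma levelM t : (t <= Q)%N -> (level t * k < M)%N.
Proof.
move=> tQ; have kQ : (k < 2 ^ Q)%N.
  exact: leq_ltn_trans k_leQ Q_lt2.
apply: (@leq_trans (2 ^ (Q * (k + 2 + t)) * 2 ^ Q)); first by rewrite ltn_pmul2l ?expn_gt0.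
by rewrite -expnD leq_pexp2l // -mulnSr leq_mul2l; apply/orP; right; lia.
Qed.

(** * The candidate that follows the reference schedule *)

Section Target.
Variables (t : nat) (tQ : (t < Q)%N).
Local Notation b0 := (level t).
Local Notation b1 := (level t.+1).
Local Notation delta := (V / b1%:R).
Hypothesis med_small : Q%:R * \sum_(i < n | (b0 <= RK i < b1)%N) P i <= V.

Definition long o := (o < NK)%N && (RK (o %/ k) < b0)%N.
Definition long_order := order_of pt s [seq o <- iota 0 NK | long o].

(** In the third block an operation of a medium job, or the default [NK], is missing from
    [long_order]; [index] then returns the size of the list, a priority after all long
    operations. *)
Definition digit pos :=
  if (pos < M)%N then oapp (fun i : 'I_n => so i) 0%N [pick i : 'I_n | RK i == pos]
  else if (pos < 2 * M)%N then
    chunk_shop b1 ((pos - M) %/ 2 ^ L) ((pos - M) %% 2 ^ L)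
  else if (pos < 3 * M)%N then
    let r := (pos - 2 * M)%N in
    index (oapp (fun i : 'I_n => i * k + r %% k)%N NK [pick i : 'I_n | RK i == r %/ k])%N long_order
  else b1.

Lemma long_count : (\sum_(o < NK | long o) 1 <= b0 * k)%N.
Proof.
rewrite big_mkcond (sum_ops n k (fun o => if long o then 1 else 0)%N) /=.
apply: leq_trans (_ : \sum_(i < n | (rank n P i < b0)%N) k <= _)%N.
  rewrite [leqRHS]big_mkcond leq_sum // => i _.
  rewrite (eq_bigr (fun=> if (rank n P i < b0)%N then 1 else 0)%N).
    by rewrite sum_nat_const card_ord; case: ifP; lia.
  by move=> j _; rewrite /long op_lt //= op_div // RKE.
rewrite sum_nat_const; have := rank_count n P b0; rewrite sum1_card => h.
by rewrite leq_mul2r h orbT.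
Qed.

Lemma size_long_order : (size long_order <= b0 * k)%N.
Proof.
rewrite size_sort; apply: leq_trans long_count.
by rewrite -sum1_size big_filter -{1}[NK]subn0 -/(index_iota 0 NK) big_mkord.
Qed.

Lemma mem_long_order o : (o \in long_order) = long o.
Proof. by rewrite mem_sort mem_filter mem_iota /= add0n /long; case: (_ < NK)%N; rewrite ?andbT ?andbF. Qed.

Lemma m_ltM : (m < M)%N.
Proof.
apply: (@leq_trans (2 ^ Q)); last by rewrite leq_pexp2l // leq_pmulr // addnA addnS.
exact: leq_ltn_trans m_leQ Q_lt2.
Qed.

Lemma digit_lt pos : (digit pos < M)%N.
Proof.
have b1M := levelM tQ; have b0M := levelM (ltnW tQ).
rewrite /digit; case: ifP => _.
  case: pickP => [i _|_] /=; last by rewrite expn_gt0.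
  by apply: ltn_trans m_ltM; apply: (ns_shop NS).
case: ifP => _.
  apply: leq_ltn_trans m_ltM; apply: leq_trans (find_size _ _) _.
  by rewrite size_iota leq_pred.
case: ifP => _.
  by apply: leq_ltn_trans b0M; apply: leq_trans (index_size _ _) size_long_order.
by apply: leq_ltn_trans b1M; rewrite leq_pmulr.
Qed.

Lemma rank_pick i : (i < n)%N ->
  oapp (fun i' : 'I_n => nat_of_ord i') n [pick i' : 'I_n | RK i' == RK i] = i.
Proof.
move=> iN; case: pickP => [i' /eqP e|/(_ (Ordinal iN))]; last by rewrite eqxx.
by move: e; rewrite /= !RKE //; apply: rank_inj.
Qed.

Lemma small_bound i : (i < n)%N -> (b1 <= RK i)%N -> P i <= delta.
Proof.
move=> iN bi; have b1p : 0 < b1%:R :> R by rewrite ltr0n expn_gt0.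
rewrite ler_pdivlMr // mulrC; apply: le_trans (rank_le_sum P_ge0 iN).
apply: ler_wpM2r; first exact: P_ge0.
by rewrite ler_nat; rewrite RKE in bi; lia.
Qed.

Variables (st st' : state R).
Hypotheses (eP : rarr st 2 = P) (eRK : iarr st 2 = RK) (eCL : iarr st 3 = CL).
Hypotheses (eV : rvar st 2 = V) (eL : ivar st 22 = L) (eM : ivar st 3 = M).
Hypothesis eb : ivar st 16 = digit (3 * M).
Hypothesis eD : forall pos, (pos < 4 * M)%N -> iarr st 4 pos = digit pos.
Hypothesis shops : forall i, (i < n)%N ->
  shop_ok m st i (iarr st' 5 i) /\ forall j, (j < k)%N -> op_ok k st st' i j.

Local Notation SH := (iarr st' 5).

Lemma ebE : ivar st 16 = b1.
Proof. by rewrite eb /digit ifF ?ifF ?ltnn //; apply/negbTE; lia. Qed.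

Lemma forced_shop i : (i < n)%N -> ~~ (b1 <= RK i)%N -> SH i = so i.
Proof.
move=> iN; rewrite -ltnNge => fi; have [+ _] := shops iN.
have RKM : (RK i < M)%N by apply: ltn_trans fi _; apply: leq_ltn_trans (levelM tQ); rewrite leq_pmulr.
rewrite /shop_ok eRK ebE fi eD; last by lia.
rewrite /digit RKM; have := rank_pick iN; case: pickP => [i' _ /= e|_ /= e]; last by lia.
by rewrite e /clamp leqNgt (ns_shop NS).
Qed.

Lemma small_shop i : (i < n)%N -> (b1 <= RK i)%N ->
  exists2 c, bitsval L (small_volume b1 i (CL i)) V c & SH i = chunk_shop b1 (CL i) c.
Proof.
move=> iN si; have [+ _] := shops iN.
rewrite /shop_ok eRK ebE ltnNge si /= eCL eM eL eV => -[c cb ->].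
exists c; first by move: cb; rewrite /volume ebE eRK eCL eP.
have [cL _] := cb; have CLi := CL_lt iN.
have key : (CL i * 2 ^ L + c < M)%N.
  apply: (@leq_trans (2 ^ (k * Q) * 2 ^ L)).
    apply: (@leq_trans ((CL i).+1 * 2 ^ L)); first by rewrite mulSn addnC ltn_add2r.
    by rewrite leq_mul2r CLi orbT.
  rewrite -expnD leq_pexp2l // -mulnDl mulnC leq_mul2l.
  by have := k_leQ => kQ; apply/orP; right; lia.
rewrite eD; last by lia.
rewrite /digit ifF; last by lia.
rewrite ifT; last by lia.
rewrite addKn divnMDl ?expn_gt0 // divn_small // addn0 modnMDl modn_small //.
rewrite /clamp leqNgt.
suff -> : (chunk_shop b1 (CL i) c < m)%N by [].
by apply: leq_ltn_trans (find_size _ _) _; rewrite size_iota prednK.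
Qed.

Lemma shop_lt i : (i < n)%N -> (SH i < m)%N.
Proof. by move=> iN; have [h _] := shops iN; apply: shop_ok_lt h. Qed.

Lemma target_quality (jb : nat -> nat) : (forall o, (o < NK)%N -> jb o = (o %/ k)%N) ->
  exists Z, quality NK pt (iarr st' 6) jb (iarr st' 8) (fun o => iarr st' 7 o != 0%N)
      long s delta Z /\
    Z + \sum_(o < NK) (if (iarr st' 7 o != 0%N) && ~~ long o then pt o else 0) <=
      (1 + E%:R^-1) * T.
Proof.

move=> jbE; have Q0 := Q_gt0; have V0 := V_ge0.
have b1p : 0 < b1%:R :> R by rewrite ltr0n expn_gt0.
have d0 : 0 <= delta by rewrite divr_ge0 // ltW.
have p2 e : 0 < 2%:R ^+ e :> R by apply: p2_gt0.
(* The common unit of all errors except the medium volume. *)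
pose X := V / 2%:R ^+ Q; have X0 : 0 <= X by rewrite divr_ge0 // ltW.
have op i j : (i < n)%N -> (j < k)%N -> [/\ iarr st' 6 (i * k + j)%N = (k * SH i + j)%N,
    (iarr st' 7 (i * k + j)%N != 0%N) = (RK i < b1)%N &
    (RK i < b1)%N -> iarr st' 8 (i * k + j)%N =
      if (RK i < b0)%N then index (i * k + j)%N long_order else size long_order].
  move=> iN jk; have [_ /(_ _ jk) [a1 a2 a3 _]] := shops iN; split=> //.
    by rewrite a2 eRK ebE; case: ltnP.
  move=> fi; have b1k : (k * RK i + j < M)%N by have := levelM tQ; nia.
  rewrite a3 eM eRK eD; last by lia.
  rewrite /digit ifF; last by lia.
  rewrite ifF; last by lia.
  rewrite ifT; last by lia.
  rewrite (_ : M + M + (k * RK i + j) - 2 * M = RK i * k + j)%N; last by lia.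
  rewrite op_div // op_mod //; have := rank_pick iN.
  case: pickP => [i' _ /= ->|_ /= e]; last by lia.
  case: ifP => // /negbT h; apply/memNindex; rewrite mem_long_order /long op_div //.
  by rewrite (negPf h) andbF.
have opo o : (o < NK)%N -> [/\ iarr st' 6 o = (k * SH (o %/ k) + o %% k)%N,
    (iarr st' 7 o != 0%N) = (RK (o %/ k) < b1)%N &
    (RK (o %/ k) < b1)%N -> iarr st' 8 o =
      if (RK (o %/ k) < b0)%N then index o long_order else size long_order].
  move=> oN; have i0 : (o %/ k < n)%N by rewrite ltn_divLR.
  by have := op _ _ i0 (ltn_pmod o k0); rewrite -divn_eq.
have b01 : (b0 <= b1)%N by rewrite levelS leq_pmulr // expn_gt0.
have longN o : long o -> [/\ (o < NK)%N, (RK (o %/ k) < b0)%N & (RK (o %/ k) < b1)%N].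
  by case/andP=> oN h; split=> //; apply: leq_trans h b01.
have prl o : long o -> iarr st' 8 o = index o long_order.
  by case/longN=> oN h0 h1; have [_ _ /(_ h1)] := opo _ oN; rewrite h0.
have pQ1 : 2 <= 2%:R ^+ Q :> R.
  by rewrite -natrX ler_nat -[X in (X <= _)%N]expn1 leq_pexp2l.
have b1E : b1%:R = b0%:R * 2%:R ^+ Q :> R by rewrite levelS natrM natrX.
have b1L : 2%:R ^+ L * 2%:R ^+ Q <= b1%:R :> R.
  by rewrite b1E ler_pM2r // -natrX -level0 ler_nat level_mono.
have p2L1 : 1 <= 2%:R ^+ L :> R by rewrite exprn_ege1 // ler1n.
set D := delta in d0 *; have dV : D * b1%:R = V by rewrite divfK // gt_eqF.
have XV : X * 2%:R ^+ Q = V by rewrite divfK // gt_eqF.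
pose u := V / 2%:R ^+ L; have u0 : 0 <= u by rewrite divr_ge0 // ltW.
have uV : u * 2%:R ^+ L = V by rewrite divfK // gt_eqF.
have dX : D <= X.
  rewrite -(ler_pM2r (p2 Q)) XV -dV; apply: ler_wpM2l => //.
  by apply: le_trans b1L; rewrite ler_peMl // ltW.
have du : D <= u.
  rewrite -(ler_pM2r (p2 L)) uV -dV; apply: ler_wpM2l => //.
  by apply: le_trans b1L; rewrite ler_peMr //; lra.
(* In [L = (k + 2) * Q], the part [k * Q] pays for the number of classes, one [Q] for the accuracy,
   and one [Q] for the factor two from [D <= u]. *)
have uX : 2%:R ^+ (k * Q) * (u + D) <= X.
  have LE : 2%:R ^+ L = 2%:R ^+ (k * Q) * 2%:R ^+ Q * 2%:R ^+ Q :> R.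
    by rewrite -!exprD; congr (_ ^+ _); lia.
  have e1 : 2%:R ^+ (k * Q) * u * 2%:R ^+ Q = X.
    apply: (mulIf (x := 2%:R ^+ Q)); first by rewrite gt_eqF.
    by rewrite XV -uV LE; ring.
  have e2 : 2%:R ^+ (k * Q) * (u + D) <= 2%:R ^+ (k * Q) * u * 2.
    by rewrite -mulrA ler_pM2l //; lra.
  apply: le_trans e2 _; apply: (@le_trans _ _ (2%:R ^+ (k * Q) * u * 2%:R ^+ Q)); last by rewrite e1.
  apply: ler_wpM2l => //.
  by apply: mulr_ge0 => //; apply: ltW.
have Hd : (\sum_(o < NK) (long o)%:R) * D <= k%:R * X.
  have -> : \sum_(o < NK) (long o)%:R = (\sum_(o < NK | long o) 1)%:R :> R.
    by rewrite natr_sum [RHS]big_mkcond; apply: eq_bigr => o _; case: long.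
  apply: (@le_trans _ _ ((b0 * k)%:R * D)).
    by apply: ler_wpM2r => //; rewrite ler_nat long_count.
  rewrite natrM -(ler_pM2r (p2 Q)) -[k%:R * X * _]mulrA XV -dV b1E.
  by rewrite [leRHS](_ : _ = b0%:R * k%:R * D * 2%:R ^+ Q) //; ring.
have loadX l j : (l < m)%N -> (j < k)%N ->
    \sum_(i < n | SH i == l) pt (i * k + j)%N <= T + 2 * X.
  move=> lm jk.
  have := machine_load d0 small_bound forced_shop small_shop lm jk.
  rewrite -/u -/D => h; rewrite -(ler_pM2l (p2 Q)); apply: le_trans h _.
  by have := ler_wpM2l (ltW (p2 Q)) uX; lra.
have ptP i j : (i < n)%N -> (j < k)%N -> pt (i * k + j)%N <= P i.
  move=> iN jk; rewrite PE // (bigD1 (Ordinal jk)) //= lerDl sumr_ge0 // => j' _.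
  by apply/pt0/op_lt.
have T0 := ns_T NS.
(* Long operations need [2 * k * X] for their delays; short ones need [2 * X] for the load and one
   [X] for the length of their job. *)
exists (T + (2 * k + 3)%:R * X); split.
  split.
  - by move=> o /longN[oN h0 h1]; have [_ -> _] := opo _ oN.
  - exact: d0.
  - by move=> o /longN[oN _ _]; apply: (ns_ge0 NS).
  - move=> z zN; have [_ -> _] := opo _ zN; rewrite -leqNgt => sm.
    have i0 : (z %/ k < n)%N by rewrite ltn_divLR.
    apply: le_trans (small_bound i0 sm); rewrite {1}(divn_eq z k).
    by apply: ptP => //; apply: ltn_pmod.
  - move=> o o' lo o'N fl' nl; rewrite prl //.
    have [_ e /(_ _)] := opo _ o'N; rewrite e in fl'; move=> /(_ fl').
    rewrite /long o'N /= in nl; rewrite (negPf nl) => ->.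
    by rewrite index_mem mem_long_order.
  - move=> o o' lo lo'; rewrite !prl //; apply: order_of_inj.
      by rewrite -(mem_sort (lexle pt s)) mem_long_order.
    by rewrite -(mem_sort (lexle pt s)) mem_long_order.
  - move=> o o' lo lo'; rewrite !prl // => le.
    apply: (lexle_le (pt := pt)); apply: order_of_index le.
      by rewrite -(mem_sort (lexle pt s)) mem_long_order.
    by rewrite -(mem_sort (lexle pt s)) mem_long_order.
  - move=> o o' lo lo' /eqP ne; rewrite !prl // => le cf.
    have [oN h0 h1] := longN _ lo; have [o'N h0' h1'] := longN _ lo'.
    have i0 : (o %/ k < n)%N by rewrite ltn_divLR.
    have i0' : (o' %/ k < n)%N by rewrite ltn_divLR.
    apply: (lexle_conflict pt0 NS) => //; last first.
      apply: order_of_index le.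
        by rewrite -(mem_sort (lexle pt s)) mem_long_order.
      by rewrite -(mem_sort (lexle pt s)) mem_long_order.
    case: cf => [|]; last by rewrite !jbE //; right.
    have [-> _ _] := opo _ oN; have [-> _ _] := opo _ o'N.
    move=> /(machine_inj (ltn_pmod _ k0) (ltn_pmod _ k0))[e1 e2]; left; split=> //.
    by rewrite -!forced_shop // -ltnNge.
  - move=> o z lo zN; have [_ -> _] := opo _ zN; have [oN _ h1] := longN _ lo.
    by rewrite !jbE //; apply: contra => /eqP <-.
  - by rewrite addr_ge0 // mulr_ge0 // ler0n.
  - by move=> o oN lo; have := ns_le NS oN; rewrite -/D natrD natrM; move: Hd; lra.
  - move=> z zN; have [_ -> _] := opo _ zN; rewrite -leqNgt => sm.
    have i0 : (z %/ k < n)%N by rewrite ltn_divLR.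
    have jk := ltn_pmod z k0.
    have e1 : \sum_(o < NK) (if iarr st' 6 o == iarr st' 6 z then pt o else 0) =
        \sum_(i < n | SH i == SH (z %/ k)%N) pt (i * k + z %% k)%N.
      rewrite -(sum_machine (fun i => SH i == SH (z %/ k)%N) pt jk); apply: eq_bigr => o _.
      have [-> _ _] := opo _ zN; have [-> _ _] := opo _ (ltn_ord o).
      case: (boolP (_ && _)) => [/andP[/eqP -> /eqP ->]|]; first by rewrite eqxx.
      move=> nb; rewrite ifF //; apply: contraNF nb => /eqP.
      by move=> /(machine_inj (ltn_pmod _ k0) (ltn_pmod _ k0))[-> ->]; rewrite !eqxx.
    have e2 : \sum_(o < NK) (if jb o == jb z then pt o else 0) = P (z %/ k)%N.
      rewrite (sum_ops n k (fun o => if jb o == jb z then pt o else 0)) (bigD1 (Ordinal i0)) //=.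
      rewrite [X in _ + X]big1 ?addr0 => [|i ne].
        rewrite PE //; apply: eq_bigr => j _; rewrite !jbE // ?op_lt // op_div //.
        by rewrite eqxx.
      rewrite big1 // => j _; rewrite !jbE // ?op_lt // op_div //.
      by rewrite ifF //; apply: contraNF ne => /eqP e; apply/eqP/val_inj.
    rewrite e1 e2; have := loadX _ _ (shop_lt i0) jk; have := small_bound i0 sm.
    rewrite -/D natrD natrM; have : 0 <= k%:R * X by rewrite mulr_ge0 // ler0n.
    by lra.
have -> : \sum_(o < NK) (if (iarr st' 7 o != 0%N) && ~~ long o then pt o else 0) =
    \sum_(i < n | (b0 <= RK i < b1)%N) P i.
  rewrite (sum_ops n k (fun o => if (iarr st' 7 o != 0%N) && ~~ long o then pt o else 0)).
  rewrite [RHS]big_mkcond; apply: eq_bigr => i _.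
  rewrite (eq_bigr (fun j : 'I_k => if (b0 <= RK i < b1)%N then pt (i * k + j)%N else 0)).
    by case: ifP => _; [rewrite PE|rewrite big1].
  move=> j _; have [_ -> _] := op _ _ (ltn_ord i) (ltn_ord j).
  by rewrite /long op_lt // op_div //= -leqNgt andbC.
have := med_small; set Y := \sum_(i < n | _) _ => medY.
have QR : 0 < Q%:R :> R by rewrite ltr0n.
have ER : 0 < E%:R :> R by rewrite ltr0n.
have XQ : Q%:R * X <= V.
  rewrite -XV mulrC; apply: ler_wpM2l => //.
  by rewrite -natrX ler_nat ltnW // Q_lt2.
have QE : Q%:R = 2 * m%:R * k%:R * (2 * k%:R + 3) * E%:R :> R.
  by rewrite /paramQ /cQ !natrM natrD natrM.
have := V_le; rewrite natrM => VT.
(* The errors sum to at most [(2 * k + 4) * V / Q]; the factor [2 * (2 * k + 3)] in [Q] outweighs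
   [2 * k + 4]. *)
rewrite -(ler_pM2l QR) !mulrDr.
have : Q%:R * (E%:R^-1 * T) = 2 * m%:R * k%:R * (2 * k%:R + 3) * T.
  by rewrite QE; field; rewrite gt_eqF.
have m1 : 0 < m%:R :> R by rewrite ltr0n.
have k1 : 0 < k%:R :> R by rewrite ltr0n.
have := ler_wpM2l (ltW k1) XQ; have := ler_wpM2l (ltW k1) VT.
have := mulr_ge0 (mulr_ge0 (ltW m1) (ltW k1)) T0 => h1.
have := mulr_ge0 (ltW k1) h1.
rewrite natrD natrM mulrDl mul1r.
by move: medY XQ VT h1; nra.
Qed.
End Target.

(** The digits are fixed before any state is considered: they come from the reference schedule,
    which the program never sees. *)
Lemma good_digits : exists d : nat -> nat, (forall pos, (d pos < M)%N) /\
  forall st st' : state R,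
    rarr st 2 = P -> iarr st 2 = RK -> iarr st 3 = CL -> rvar st 2 = V ->
    ivar st 22 = L -> ivar st 3 = M -> ivar st 16 = d (3 * M)%N ->
    (forall pos, (pos < 4 * M)%N -> iarr st 4 pos = d pos) ->
    (forall i, (i < n)%N ->
      shop_ok m st i (iarr st' 5 i) /\ forall j, (j < k)%N -> op_ok k st st' i j) ->
    forall jb, (forall o, (o < NK)%N -> jb o = (o %/ k)%N) ->
    exists H delta Z, quality NK pt (iarr st' 6) jb (iarr st' 8)
      (fun o => iarr st' 7 o != 0%N) H s delta Z /\
    Z + \sum_(o < NK) (if (iarr st' 7 o != 0%N) && ~~ H o then pt o else 0) <=
      (1 + E%:R^-1) * T.
Proof.
have [t tQ] := @rank_block R n P P_ge0 level Q Q_gt0 (fun t => ltac:(by rewrite levelS leq_pmulr // expn_gt0)).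
rewrite (eq_bigl (fun i : 'I_n => (level t <= RK i < level t.+1)%N)); last first.
  by move=> i; rewrite RKE.
move=> med; exists (digit t); split; first exact: digit_lt.
move=> st st' h1 h2 h3 h4 h5 h6 h7 h8 h9 jb h10.
have [Z hZ] := target_quality tQ med h1 h2 h3 h4 h5 h6 h7 h8 h9 h10.
by exists (long t), (V / (level t.+1)%:R), Z.
Qed.
End Analysis.

(** * The approximation scheme *)

Lemma nth_allpairs (S T U : Type) (x0 : U) (f : S -> T -> U) (a : seq S) (b : seq T) i j sa tb :
  (i < size a)%N -> (j < size b)%N ->
  nth x0 [seq f x y | x <- a, y <- b] (i * size b + j)%N = f (nth sa a i) (nth tb b j).
Proof.
move=> + jb; elim: a i => [|x a IH] [|i] //= ia; rewrite nth_cat size_map.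
  by rewrite jb (nth_map tb).
by rewrite ifF; [rewrite mulSn -addnA addKn IH|lia].
Qed.

Section Main.
Variables (m k : nat) (m0 : (0 < m)%N) (k0 : (0 < k)%N).

Definition growth C E := (2 ^ (C * paramM m k E * paramM m k E))%N.

Lemma computable_growth C : computable (growth C).
Proof.
pose c := ISetVar 1 (IVar 0) ;; ISetVar 2 (imulc (cQ m k) vE) ;;
  pow2 3 vQ (IAdd vQ (IConst (k + 4))) ;; pow2 27 (imulc C vM) vM ;;
  ISetVar 0 (IVar 27).
exists c => E; set Q := paramQ m k E; set M := paramM m k E.
set s0 := State _ _ _ _.
(* Only termination matters here, so any budget that covers the loop bounds will do. *)
have [t [s' [ex _ e]]] : wp (Q + (Q + (k + 4)) + C * M + M) c s0
    (fun s' => ivar s' 0 = growth C E).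
  apply: (wp_step (Q1 := fun s' => ivar s' 1 = E)); first by apply: wp_iset.
  move=> s1' fr1' E1; apply: (wp_step (Q1 := fun s' => ivar s' 2 = Q)).
    by apply: wp_iset; rewrite /= updE /= ieval_imulc /= E1.
  move=> s1 fr1 q1; apply: (wp_step (wp_pow2 _ _ _ _ _)) => //=; try by rewrite q1; lia.
  rewrite q1 => s2 fr2; rewrite -/(paramM m k E) -/M => e3.
  apply: (wp_step (wp_pow2 _ _ _ _ _)) => //=; try by rewrite ?ieval_imulc /= e3; lia.
    by rewrite !stable_imulc.
  rewrite ieval_imulc /= e3 => s3 fr3 e27.
  by apply: wp_iset; rewrite /= updE /= e27.
by exists t, s'.
Qed.

(** * Correctness and running time of the whole program *)

Section Run.
Variables (R : archiRealFieldType) (n : nat) (p : 'I_n -> 'I_k -> R) (eps : R).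
Hypothesis p0 : forall i j, 0 <= p i j.
Hypothesis eps01 : 0 < eps < 1.

Local Notation E := (`|Num.ceil eps^-1|%N).
Local Notation Q := (paramQ m k E).
Local Notation M := (paramM m k E).
Local Notation N := (paramN m k E).
Local Notation L := ((k + 2) * Q)%N.
Local Notation NK := (n * k)%N.
Local Notation Z := (N * n.+1)%N.

Lemma E_gt0 : (0 < E)%N.
Proof.
have c0 : 0 < Num.ceil eps^-1 by rewrite ceil_gt0 invr_gt0; case/andP: eps01.
by rewrite absz_gt0 gt_eqF.
Qed.

Lemma Einv_le : E%:R^-1 <= eps.
Proof.
have [e0 _] := andP eps01; have ER : 0 < E%:R :> R by rewrite ltr0n E_gt0.
rewrite -[leRHS]invrK lef_pV2 ?posrE ?invr_gt0 //.
have c0 : 0 <= Num.ceil eps^-1 by rewrite ltW // ceil_gt0 invr_gt0.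
by rewrite natr_absz ger0_norm // ceil_ge.
Qed.

(** A single budget [N * n.+1] covers all loops: over candidates, digits, bits, jobs and
    operations. *)
Lemma Z_bounds : [/\ (N <= Z)%N, (4 * M <= N)%N, (L <= M)%N & (Q <= M)%N] /\
  [/\ (k <= Q)%N, (E <= Z)%N, (n <= Z)%N & (NK <= Z)%N].
Proof.
have E0 := E_gt0; have Q0 : (0 < Q)%N := Q_gt0 m0 k0 E0.
have kQ : (k <= Q)%N := k_leQ k m0 E0.
have eM : (Q * (Q + (k + 4)) < M)%N by apply: ltn_expl.
have eN : (4 * M * M < N)%N by apply: ltn_expl.
have M0 : (0 < M)%N by rewrite expn_gt0.
have MM : (4 * M <= 4 * M * M)%N by rewrite leq_pmulr.
have NZ : (N <= Z)%N by rewrite leq_pmulr.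
have QM : (Q <= M)%N by apply: leq_trans (ltnW eM); rewrite leq_pmulr // addnA addnS.
have kN : (k <= N)%N by lia.
have nZ : (n * N <= Z)%N by rewrite mulnC leq_mul2l leqnSn orbT.
have QZ : (Q <= Z)%N by apply: leq_trans NZ; lia.
split; split=> //; [lia| |by apply: leq_trans QZ; rewrite leq_pmull // /cQ !muln_gt0 m0 k0 addnS| |].
- by apply: leq_trans (ltnW eM); rewrite mulnC leq_mul2l; apply/orP; right; lia.
- by apply: leq_trans nZ; rewrite leq_pmulr // expn_gt0.
- by apply: leq_trans nZ; rewrite leq_mul2l kN orbT.
Qed.

Local Notation inp := (nth 0 [seq p i j | i <- enum 'I_n, j <- enum 'I_k]).

Lemma inpE (i : 'I_n) (j : 'I_k) : inp (i * k + j)%N = p i j.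
Proof.
have := @nth_allpairs _ _ R 0 p (enum 'I_n) (enum 'I_k) i j i j.
by rewrite !size_enum_ord !nth_ord_enum => ->.
Qed.

Definition ready (s : state R) :=
  [/\ [/\ ivar s 0 = n, ivar s 3 = M, ivar s 4 = N, ivar s 7 = NK & ivar s 22 = L],
      rvar s 2 = \sum_(i < n) rarr s 2 i,
      forall (i : 'I_n) (j : 'I_k), p i j = rarr s 1 (i * k + j)%N,
      forall o, (o < NK)%N -> iarr s 1 o = (o %/ k)%N &
      [/\ forall i, (i < n)%N -> rarr s 2 i = \sum_(j < k) rarr s 1 (i * k + j)%N,
        forall i, (i < n)%N -> iarr s 2 i = rank n (rarr s 2) i &
        forall i, (i < n)%N -> exists2 f, forall j, (j < k)%N ->
          bitsval Q (rarr s 1 (i * k + j)%N) (rarr s 2 i) (f j) &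
          iarr s 3 i = pack Q f k]].

Lemma wp_init : wp Z (prog_init m k) (input_state p eps) ready.
Proof.
have [[NZ MN LM QM] [kQ EZ nZ NKZ]] := Z_bounds; have [e0 _] := andP eps01.
set s0 := input_state p eps.
apply: (wp_step (wp_E (s := s0) _ _ _ _)) => //=.
rewrite updE /= => s1 fr1 e1.
apply: (wp_step (wp_params _ _)); rewrite ?e1 //; first exact: (Q_gt0 m0 k0 E_gt0).
move=> s2 fr2 [q2 m2 l2 n2].
have i20 : ivar s2 0 = n by rewrite (frame_ivar fr2) // (frame_ivar fr1) //= updE.
have r20 : rarr s2 0 = inp.
  by rewrite (frame_rarr fr2) // (frame_rarr fr1) //= updE.
have kZ : (k <= Z)%N by move: {EZ} NZ MN QM kQ; lia.
apply: (wp_step (wp_data _ kZ)); rewrite i20 // r20 => s3 fr3 [i37 r32 P3 pt3 jb3].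
have i30 : ivar s3 0 = n by rewrite (frame_ivar fr3).
apply: (wp_step (wp_rank _)); rewrite i30 // => s4 fr4 rk4.
have r41 : rarr s4 1 = rarr s3 1 by rewrite (frame_rarr fr4).
have r42 : rarr s4 2 = rarr s3 2 by rewrite (frame_rarr fr4).
have i40 : ivar s4 0 = n by rewrite (frame_ivar fr4).
have i42 : ivar s4 2 = Q by rewrite (frame_ivar fr4) // (frame_ivar fr3).
have PE i : (i < n)%N -> rarr s3 2 i = \sum_(j < k) rarr s3 1 (i * k + j)%N.
  by move=> iN; rewrite P3 //; apply: eq_bigr => j _; rewrite pt3 // op_lt.
have pE (i : 'I_n) (j : 'I_k) : rarr s3 1 (i * k + j)%N = p i j.
  by rewrite pt3 ?op_lt // inpE.
have pP i j : (i < n)%N -> (j < k)%N -> 0 <= rarr s3 1 (i * k + j)%N <= rarr s3 2 i.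
  move=> iN jk; rewrite PE // (bigD1 (Ordinal jk)) //=.
  have := pE (Ordinal iN) (Ordinal jk) => /= ->; rewrite p0 lerDl sumr_ge0 // => j' _.
  by have := pE (Ordinal iN) j' => /= ->.
have QZ : (Q <= Z)%N by move: {EZ} NZ MN QM; lia.
apply: wp_conseq (wp_class (k := k) _ _ _ _) _; rewrite ?i40 ?i42 ?r41 ?r42 //.
move=> s5 fr5 cl5.
have f x : ~~ writes_ivar prog_rank x -> ~~ writes_ivar (prog_class k) x -> ivar s5 x = ivar s3 x.
  by move=> h h'; rewrite (frame_ivar fr5) // (frame_ivar fr4).
have r51 : rarr s5 1 = rarr s3 1 by rewrite (frame_rarr fr5).
have r52 : rarr s5 2 = rarr s3 2 by rewrite (frame_rarr fr5).
split.
- by rewrite !f // i37 i30 !(frame_ivar fr3) //.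
- rewrite (frame_rvar fr5) // (frame_rvar fr4) // r32 r52; apply: eq_bigr => i _.
  by rewrite P3.
- by move=> i j; rewrite r51 pE.
- by move=> o oN; rewrite (frame_iarr fr5) // (frame_iarr fr4) // jb3.
- rewrite r51 r52; split=> // i iN.
  by rewrite (frame_iarr fr5) // rk4.
Qed.

Definition output_ok (sh : nat -> nat) (st : nat -> R) mk :=
  exists S : schedule R m k n,
    [/\ forall i : 'I_n, sh i = shop S i,
        forall (i : 'I_n) (j : 'I_k), st (i * k + j)%N = start S i j,
        feasible p S & makespan p S <= mk].

(** Every candidate gives a feasible schedule; the bound holds from the good candidate [x0] on,
    because the kept makespan never increases. *)
Lemma wp_main s opt : ready s -> is_min_makespan m p opt ->
  wp Z (prog_main m k) s (fun s' =>
    output_ok (iarr s' 0) (rarr s' 0) (rvar s' 8) /\ rvar s' 8 <= (1 + E%:R^-1) * opt).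
Proof.
move=> [[i0 i3 i4 i7 i22] VE pE jbE [PE RKE CLE]] [[So FSo optE] _].
have [[NZ MN LM QM] [kQ EZ nZ NKZ]] := Z_bounds.
have M0 : (0 < M)%N by rewrite expn_gt0.
have pt0 o : (o < NK)%N -> 0 <= rarr s 1 o.
  by move=> oN; have [i [j [-> _ _]]] := op_split k0 oN; rewrite -pE.
have [so [so_s [NS _]]] := nsched_of_feasible k0 pE FSo; rewrite optE in NS.
have [d [dM dP]] := good_digits m0 k0 E_gt0 pt0 PE RKE CLE NS.
have [x0 x0M x0d] := digits_ex M0 (Lam := (4 * M)%N) (fun i _ => dM i).
have x0N : (x0 < N)%N.
  apply: leq_trans x0M _; rewrite /paramM -expnM leq_exp2l // mulnC -/M.
  by rewrite leq_mul2l ltnW ?orbT // ltn_expl.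
apply: (wp_for (I := fun x s' =>
   ((0 < x)%N -> output_ok (iarr s' 0) (rarr s' 0) (rvar s' 8)) /\
   ((x0 < x)%N -> rvar s' 8 <= (1 + E%:R^-1) * opt))) => //=; rewrite i4 //.
move=> x s1 xN fr1 sx [Iok Ibest].
have i13 : ivar s1 3 = M by rewrite (frame_ivar fr1).
have i10 : ivar s1 0 = n by rewrite (frame_ivar fr1).
apply: (wp_step (wp_decode _ _ _)); rewrite ?i13 ?sx //; try by lia.
move=> s2 fr2 D2.
have i23 : ivar s2 3 = M by rewrite (frame_ivar fr2).
apply/wp_seq/wp_iset; set s3 := State _ _ _ _.
have b3 : ivar s3 16 = iarr s2 4 (3 * M).
  by rewrite /s3 /= updE /= i23; congr (iarr _ _ _); lia.
have fr3 : frame (prog_main m k) s s3.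
  apply: (frame_trans fr1); apply: (@frame_trans _ _ _ s2); first by apply: frame_sub fr2; sub_writes.
  by split=> //= y ny; rewrite updE; case: (y =P 16%N) ny => [->|].
have [c0 c7] : ivar s3 0 = n /\ ivar s3 7 = NK by rewrite !(frame_ivar fr3).
have [r31 r32] : rarr s3 1 = rarr s 1 /\ rarr s3 2 = rarr s 2 by rewrite !(frame_rarr fr3).
have P0 i : (i < n)%N -> 0 <= rarr s 2 i.
  by move=> iN; rewrite PE //; apply: sumr_ge0 => j _; apply/pt0/op_lt.
apply: (wp_step (wp_assign m (k := k) k0 _ _ _ _ _)).
- by rewrite c0.
- by lia.
- by rewrite (frame_ivar fr3) // i22; lia.
- by rewrite c0 r32.
- by rewrite c0 r32 (frame_rvar fr3).
rewrite c0 => s4 fr4 asg.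
have fr14 : frame (prog_main m k) s s4.
  by apply: (frame_trans fr3); apply: frame_sub fr4; sub_writes.
have [d0 d7] : ivar s4 0 = n /\ ivar s4 7 = NK by rewrite !(frame_ivar fr14).
have e1 : iarr s4 1 = iarr s 1 by rewrite (frame_iarr fr14).
have r41 : rarr s4 1 = rarr s 1 by rewrite (frame_rarr fr14).
have opz o : (o < NK)%N -> [/\ iarr s4 6 o = (k * iarr s4 5 (o %/ k) + o %% k)%N,
    iarr s4 9 o = 0%N, rarr s4 4 (iarr s4 6 o) = 0 & rarr s4 5 (o %/ k)%N = 0].
  move=> oN; have [i [j [-> -> ->]]] := op_split k0 oN.
  have [_ /(_ _ (ltn_ord j)) [a1 _ _ [a2 a3 a4]]] := asg _ (ltn_ord i).
  by [].
have shm i : (i < n)%N -> (iarr s4 5 i < m)%N.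
  by move=> iN; have [h _] := asg _ iN; apply: shop_ok_lt h.
pose G := ginv NK (rarr s 1) (iarr s4 6) (iarr s 1) (fun o => iarr s4 7 o != 0%N).
pose good g mk := exists H delta W, [/\ quality NK (rarr s 1) (iarr s4 6) (iarr s 1)
      (iarr s4 8) (fun o => iarr s4 7 o != 0%N) H so_s delta W,
    qinv NK (rarr s 1) (iarr s4 6) (iarr s 1) (iarr s4 8) (fun o => iarr s4 7 o != 0%N)
      H so_s delta W g mk &
    W + \sum_(o < NK) (if (iarr s4 7 o != 0%N) && ~~ H o then rarr s 1 o else 0) <=
      (1 + E%:R^-1) * opt].
(* The number [x0] is unknown to the program and enters through this implication only. *)
pose Pg c g mk := [/\ G c g mk, 0 <= mk & x = x0 -> good g mk].
have z9 o : (o < NK)%N -> placed (gof s4) o = 0%N by move=> /opz[_ ? _ _].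
have z4 o : (o < NK)%N -> mavail (gof s4) (iarr s4 6 o) = 0 by move=> /opz[_ _ ? _].
have z5 o : (o < NK)%N -> javail (gof s4) (iarr s 1 o) = 0.
  by move=> oN; rewrite jbE //; case: (opz _ oN).
apply: (wp_step (wp_greedy (P := Pg) _ _ _ _)); rewrite ?d7 //.
- split=> //; first by apply: ginv_init.
  move=> xx; have [||||||||H [dl [W [qu le]]]] := dP s3 s4 _ _ _ _ _ _ _ _ asg _ jbE.
  - by rewrite (frame_rarr fr3).
  - by rewrite (frame_iarr fr3).
  - by rewrite (frame_iarr fr3).
  - by rewrite (frame_rvar fr3).
  - by rewrite (frame_ivar fr3).
  - by rewrite (frame_ivar fr3).
  - by rewrite b3 D2 ?xx ?x0d //; lia.
  - by move=> pos pM; rewrite /s3 /= D2 // xx x0d.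
  by exists H, dl, W; split=> //; by have := qinv_init qu z9 z4 z5.
- by move=> c g mk cN [I _ _]; apply: ginv_waiting I cN.
- move=> c g mk o cN [I mk0 qg]; rewrite r41 e1 => sel; split.
  + by have := ginv_place pt0 I sel; apply.
  + by rewrite le_max mk0.
  + move=> xx; have [H [dl [W [qu qi le]]]] := qg xx; exists H, dl, W; split=> //.
    by have := qinv_place pt0 qu I qi sel; apply.
move=> s5 fr5 [I mk0 qg].
have e5 : iarr s5 5 = iarr s4 5 by rewrite (frame_iarr fr5).
have pl o : (o < NK)%N -> placed (gof s5) o != 0%N by move=> oN; apply: ginv_all I _ oN.
have maI o o' : (o < NK)%N -> (o' < NK)%N ->
    iarr s4 5 (o %/ k)%N = iarr s4 5 (o' %/ k)%N -> (o %% k = o' %% k)%N ->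
    iarr s4 6 o = iarr s4 6 o'.
  by move=> oN o'N e e'; have [-> _ _ _] := opz _ oN; have [-> _ _ _] := opz _ o'N; rewrite e e'.
have ok sh st : (forall i, (i < n)%N -> sh i = iarr s5 5 i) ->
    (forall o, (o < NK)%N -> st o = rarr s5 6 o) -> output_ok sh st (rvar s5 7).
  move=> shE stE.
  apply: (feasible_of_starts k0 pE) => //.
  - by move=> i iN; rewrite shE // e5 shm.
  - by move=> o oN; rewrite stE //; apply: (gi_start I) => //; apply: pl.
  - move=> o o' oN o'N ne cf; rewrite !stE //; apply: (gi_excl I) => //; try exact: pl.
    have [i1 i1'] : (o %/ k < n)%N /\ (o' %/ k < n)%N by rewrite !ltn_divLR.
    case: cf => [|e]; last by rewrite !jbE //; right.
    by rewrite !shE // e5 => -[e e']; left; apply: maI.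
  - by move=> o oN; rewrite stE //; apply: (gi_mk I) => //; apply: pl.
have fr15 : frame (prog_main m k) s s5.
  by apply: (frame_trans fr14); apply: frame_sub fr5; sub_writes.
have old : [/\ ivar s5 12 = x, iarr s5 0 = iarr s1 0, rarr s5 0 = rarr s1 0 & rvar s5 8 = rvar s1 8].
  rewrite (frame_ivar fr5) // (frame_ivar fr4) //= updE /= (frame_ivar fr2) // sx.
  rewrite (frame_iarr fr5) // (frame_iarr fr4) //= (frame_iarr fr2) //.
  rewrite (frame_rarr fr5) // (frame_rarr fr4) //= (frame_rarr fr2) //.
  by rewrite (frame_rvar fr5) // (frame_rvar fr4) //= (frame_rvar fr2).
have [o12 oi or ov] := old.
have best : x = x0 -> rvar s5 7 <= (1 + E%:R^-1) * opt.
  move=> /qg[H [dl [W [qu qi le]]]]; apply: le_trans le.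
  by have := qinv_le pt0 qi.
apply: (wp_keep (Q := fun sh st mk => ((0 < x.+1)%N -> output_ok sh st mk) /\
   ((x0 < x.+1)%N -> mk <= (1 + E%:R^-1) * opt))).
- by rewrite (frame_ivar fr15) // i0.
- by rewrite (frame_ivar fr15) // i7.
- rewrite (frame_ivar fr15 (x := 0%N)) // (frame_ivar fr15 (x := 7%N)) // i0 i7 => sh st new shE stE; split=> [_|]; first exact: ok.
  rewrite ltnS leq_eqVlt => /orP[/eqP/esym/best//|lt].
  apply: le_trans (Ibest lt); rewrite -ov; apply: new; rewrite o12.
  exact: leq_ltn_trans lt.
- rewrite o12 oi or ov => x_gt0 le; split=> [_|]; first exact: Iok.
  rewrite ltnS leq_eqVlt => /orP[/eqP/esym/best h|/Ibest//].
  exact: le_trans le h.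
by move=> s' fr [h1 h2]; split; [apply: h1; rewrite expn_gt0|apply: h2].
Qed.

Lemma wp_prog opt : is_min_makespan m p opt ->
  wp Z (prog m k) (input_state p eps) (fun s' =>
    output_ok (iarr s' 0) (rarr s' 0) (rvar s' 8) /\ rvar s' 8 <= (1 + eps) * opt).
Proof.
move=> mopt; apply: (wp_step wp_init) => s fr rs.
apply: wp_conseq (wp_main rs mopt) _ => s' fr' [ok le]; split=> //.
apply: le_trans le _; have [[So FSo <-] _] := mopt.
by apply: ler_wpM2r; [exact: makespan_ge0|rewrite lerD2l Einv_le].
Qed.

(** Here [Z.+1 <= 2 * N * n.+1], and [2 * N] has exponent [4 * M * M + 1], at most [5 * M * M]; the
    constant [K] is at most [2 ^ K]. *)
Lemma time_bound K d : (K * Z.+1 ^ d <= growth (K + 5 * d) E * n.+1 ^ d)%N.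
Proof.
have M0 : (0 < M)%N by rewrite expn_gt0.
have Z2 : (Z.+1 <= 2 * N * n.+1)%N.
  have : (0 < N)%N by rewrite expn_gt0.
  by move: N => a a0; nia.
have mono a b : (a <= b -> a ^ d <= b ^ d)%N by case: d => // d' h; rewrite leq_exp2r.
apply: (@leq_trans (K * ((2 * N) ^ d * n.+1 ^ d))).
  by rewrite leq_mul2l -expnMn mono ?orbT.
rewrite mulnA leq_mul2r; apply/orP; right.
apply: (@leq_trans (2 ^ K * (2 * N) ^ d)); first by rewrite leq_mul2r ltnW ?orbT // ltn_expl.
rewrite /growth /paramN -expnS -expnM -expnD leq_pexp2l //.
have : (0 < M * M)%N by rewrite muln_gt0 M0.
by rewrite -!mulnA; move: (M * M)%N => x x0; nia.
Qed.
End Run.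
End Main.

Unset Implicit Arguments.

Theorem theorem1 (m k : nat) (hm : (1 <= m)%N) (hk : (1 <= k)%N) :
  exists (alg : cmd) (f : nat -> nat) (c : nat),
    computable f /\
    forall (R : archiRealFieldType) (n : nat) (p : 'I_n -> 'I_k -> R) (eps : R),
      (forall i j, 0 <= p i j) -> 0 < eps < 1 ->
      exists (t : nat) (s : state R) (S : schedule R m k n) (opt : R),
        [/\ exec alg (input_state p eps) t s,
            output_is s S,
            feasible p S,
            is_min_makespan m p opt /\ makespan p S <= (1 + eps) * opt
          & (t <= f `|Num.ceil eps^-1| * n.+1 ^ c)%N].
Proof.
have [K [d Kd]] := tbound_poly (prog m k).
exists (prog m k), (growth m k (K + 5 * d)), d; split; first exact: computable_growth.
move=> R n p eps p0 eps01.
pose pt o := nth 0 [seq p i j | i <- enum 'I_n, j <- enum 'I_k] o.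
have pE (i : 'I_n) (j : 'I_k) : p i j = pt (i * k + j)%N by rewrite /pt inpE.
have pt0 o : (o < n * k)%N -> 0 <= pt o.
  by move=> /(op_split hk)[i [j [-> _ _]]]; rewrite -pE.
have [opt mopt] := opt_exists hk pt0 hm pE.
have [t [s [ex tb [[S [shE stE FS le1]] le2]]]] := wp_prog hm hk p0 eps01 mopt.
exists t, s, S, opt; split=> //.
  by split=> //; apply: le_trans le1 le2.
by apply: leq_trans tb _; apply: leq_trans (Kd _) _; apply: time_bound.
Qed.
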